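(* Let $S-\lambda T$ be a block companion pencil. The Schur form computed in floating point arithmetic by the structured product eigenvalue algorithm (described in the context) is the exact Schur form of a perturbed pencil $(S+\delta S)-\lambda(T+\delta T)$, where $$\|\delta T\|\lesssim\|T\|^2u,\qquad \|\delta S\|\lesssim\|S\|^2u,$$ and $u$ is the unit round-off.
   Context: Block companion pencil. Let $P(\lambda)=\sum_{i=0}^dP_i\lambda^i$ with $P_i\in\mathbb{C}^{k\times k}$ and $n=dk$. The pencil $S-\lambda T\in\mathbb{C}^{n\times n}[\lambda]$ is formed with $S$ having identity blocks $I_k$ on the block subdiagonal, last block column $-M_0,-M_1,\dots,-M_{d-1}$ and zeros elsewhere, and $T$ having the first $d-1$ block columns of the identity and last block column $N_1,\dots,N_d$, where $M_0=P_0$, $N_d=P_d$, and $M_i+N_i=P_i$ for the other $i$. After a preprocessing unitary equivalence, $N_d$ is upper triangular, and $M_0$ is lower triangular (Frobenius factorization) or upper triangular (Gaussian factorization). Factorizations. Let $\mathcal{Q}\in\mathbb{C}^{n\times n}$ be the cyclic downshift matrix (ones on the subdiagonal and in position $(1,n)$). One writes $T=T_1\cdots T_k$ with each $T_i$ upper triangular and identity-plus-spike (identity plus a matrix with a single nonzero column), the spike in column $n+1-i$, and either $S=\mathcal{Q}R_1\mathcal{Q}R_2\cdots\mathcal{Q}R_k$ (Frobenius factorization; each $\mathcal{Q}R_i$ is a scalar companion matrix and the spike of $R_i$ is in column $n$) or $S=\mathcal{Q}^kR_1\cdots R_k$ (Gaussian factorization; the spike of $R_i$ is in column $n+1-i$),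 each $R_i$ upper triangular identity-plus-spike. No arithmetic is involved in forming these factors. Storage and operations. A core transformation is an identity matrix except for a unitary $2\times2$ diagonal block in rows and columns $i,i+1$. $\mathcal{Q}$ is a product of $n-1$ core transformations. Each upper triangular factor $R$ is stored as $R=\Pi^T\mathcal{C}^*(\mathcal{B}+e_1\underline{y}^T)\Pi$, with $\Pi\in\mathbb{C}^{(n+1)\times n}$ the identity with an extra zero bottom row and $\mathcal{C}=C_1\cdots C_n$, $\mathcal{B}=B_1\cdots B_n$ products of core transformations; only $\mathcal{C},\mathcal{B}$ are stored, and $\underline{y}^T=-(e_{n+1}^T\mathcal{C}^*e_1)^{-1}e_{n+1}^T\mathcal{C}^*\mathcal{B}$ is recovered from them. The operations are: fusion (multiplying two core transformations acting on the same rows), turnover (refactoring a product $F_iG_{i+1}H_i$ of core transformations as $F'_{i+1}G'_iH'_{i+1}$ or vice versa), and pass-through (moving a core transformation $G$ from one side of an upper triangular factor to the other, $RG=\tilde G\tilde R$, executed by two turnovers on $\mathcal{C}^*\mathcal{B}$ only). Fusions and turnovers are backward stable: they introduce only errors of order $u$ and keep the factors unitary. Algorithm. Using only these operations, one performs a unitary equivalence that chases away all core transformations not belonging to the first factor of $S$, reaching Hessenberg-triangular form with all factors except the first factor of $S$ upper triangular (core transformations reaching the outer left are moved to the outer right by similarity on $ST^{-1}$, and passing through $T_i^{-1}$ is done by passing the conjugate transpose through $T_i$). Then implicitly shifted (Francis) QR steps are applied to the product $ST^{-1}$ in factored form by core chasing; zero eigenvalues are deflated beforehand, and deflations occur when a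 core transformation in the leading Hessenberg factor is numerically diagonal. This continues until $U^*SV=\hat S$ and $U^*TV=\hat T$ are upper triangular ($U,V$ unitary), giving the (generalized) Schur form $\hat S-\lambda\hat T$. The computed Schur form being the exact Schur form of the perturbed pencil means that the computed $\hat S,\hat T$ satisfy $\hat S=U^*(S+\delta S)V$ and $\hat T=U^*(T+\delta T)V$ for unitary $U,V$. Conventions. $\|\cdot\|$ is the Frobenius norm; $\lesssim$ means less than or equal up to multiplication by a polynomial in $d$ and $k$ of modest degree; the error analysis is to first order in $u$ (higher-order terms are dropped).
   Formalization: The bound is proved for degree d at least 2 and for runs using at most q(d,k) rounded operations, q any polynomial; the hidden polynomial factor is a fixed polynomial in d and k times 1+q. Without these conditions the bound can fail. *)

(* Defs.v *)
From mathcomp Require Import all_boot all_order all_algebra.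
From mathcomp Require Import spectral sesquilinear complex reals zify.

Set Implicit Arguments.
Unset Strict Implicit.
Unset Printing Implicit Defensive.

Import Order.TTheory GRing.Theory Num.Theory.
Local Open Scope ring_scope.
Local Open Scope sesquilinear_scope.

Definition fnorm (R : rcfType) (m n : nat) (A : 'M[R[i]]_(m, n)) : R :=
  Num.sqrt (\sum_i \sum_j ComplexField.Normc.normc (A i j) ^+ 2).

Definition upper_tri (R : rcfType) (n : nat) (A : 'M[R[i]]_n) : Prop :=
  forall i j : 'I_n, (j < i)%N -> A i j = 0.

Definition lower_tri (R : rcfType) (n : nat) (A : 'M[R[i]]_n) : Prop :=
  forall i j : 'I_n, (i < j)%N -> A i j = 0.

(* All row, column and core indices below are 0-based. *)
Definition entry (R : rcfType) (n : nat) (A : 'M[R[i]]_n) (r s : nat) : R[i] :=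
  if (insub r : option 'I_n, insub s : option 'I_n) is (Some r', Some s')
  then A r' s' else 0.

Fact block_pos_proof (d k : nat) (r : 'I_(d * k)) : (r %/ k < d)%N.
Proof.
have k_gt0 : (0 < k)%N by move: (ltn_ord r); case: k r => //; rewrite muln0.
by rewrite ltn_divLR.
Qed.

Fact block_off_proof (d k : nat) (r : 'I_(d * k)) : (r %% k < k)%N.
Proof.
by rewrite ltn_mod; move: (ltn_ord r); case: k r => //; rewrite muln0.
Qed.

Definition block_pos (d k : nat) (r : 'I_(d * k)) : 'I_d :=
  Ordinal (block_pos_proof r).
Definition block_off (d k : nat) (r : 'I_(d * k)) : 'I_k :=
  Ordinal (block_off_proof r).

Definition companion_S (R : rcfType) (d k : nat) (M : nat -> 'M[R[i]]_k) :
    'M[R[i]]_(d * k) :=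
  \matrix_(r, s)
    if ((block_pos s).+1 == d)%N
    then - M (block_pos r) (block_off r) (block_off s)
    else (((block_pos r == (block_pos s).+1 :> nat)
           && (block_off r == block_off s)) : bool)%:R.

Definition companion_T (R : rcfType) (d k : nat) (N : nat -> 'M[R[i]]_k) :
    'M[R[i]]_(d * k) :=
  \matrix_(r, s)
    if ((block_pos s).+1 == d)%N
    then N (block_pos r).+1 (block_off r) (block_off s)
    else (r == s)%:R.

(* P, M, N are read at 0..d, 0..d-1 and 1..d respectively. *)
Definition companion_splitting (R : rcfType) (d k : nat)
    (P M N : nat -> 'M[R[i]]_k) : Prop :=
  [/\ M 0%N = P 0%N, N d = P d
    & forall j : nat, (0 < j < d)%N -> M j + N j = P j].

Variant factorization := Frobenius | Gaussian.

Definition preprocessed (R : rcfType) (kind : factorization) (d k : nat)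
    (M N : nat -> 'M[R[i]]_k) : Prop :=
  upper_tri (N d) /\
  match kind with
  | Frobenius => lower_tri (M 0%N)
  | Gaussian => upper_tri (M 0%N)
  end.

Definition downshift (R : rcfType) (n : nat) : 'M[R[i]]_n :=
  \matrix_(r, s) (r == (s.+1 %% n)%N :> nat)%:R.

(* For A = T, and for A = Q^-k S in the Gaussian case, the last k columns of A
   are themselves the spikes. *)
Definition spike_factor (R : rcfType) (n : nat) (A : 'M[R[i]]_n) (j : nat) :
    'M[R[i]]_n :=
  \matrix_(r, s) if s == j :> nat then A r s else (r == s)%:R.

Definition gauss_factor (R : rcfType) (n k : nat) (S : 'M[R[i]]_n) (j : nat) :
    'M[R[i]]_n :=
  spike_factor (((downshift R n)^t*) ^+ k *m S) j.

(* The i-th scalar companion matrix Q R_i has as last column the (n-k+i)-th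
   column of S moved up by i places, the i vacated bottom entries being 0.
   Any solution of S = Q R_1 ... Q R_k agrees with this one when P_0 is
   nonsingular; when it is singular this is the one that needs no
   arithmetic. *)
Definition frob_factor (R : rcfType) (n k : nat) (S : 'M[R[i]]_n) (i : nat) :
    'M[R[i]]_n :=
  \matrix_(r, s)
    if (s.+1 == n)%N then
      if (r.+1 == n)%N then entry S i (n - k + i)%N
      else entry S (r + i).+1 (n - k + i)%N
    else (r == s)%:R.

Lemma sum_pick (A : pzRingType) n (f : 'I_n -> A) (P : pred 'I_n) (l0 : 'I_n) :
  (forall l, P l = (l == l0)) -> \sum_l (f l * (P l)%:R) = f l0.
Proof.
move=> h; rewrite (bigD1 l0) //= h eqxx mulr1 big1 ?addr0 // => l hl.
by rewrite h (negbTE hl) mulr0.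
Qed.

Lemma spike_factorization (R : rcfType) (n k : nat) (A : 'M[R[i]]_n) :
  (k <= n)%N -> upper_tri A ->
  (forall r s : 'I_n, (s < n - k)%N -> A r s = (r == s)%:R) ->
  A = \prod_(i < k) spike_factor A (n - i.+1).
Proof.
move=> kn Au Aid.
suff H m : (m <= k)%N -> forall r s : 'I_n,
   (\prod_(i < m) spike_factor A (n - i.+1)) r s =
   if (s < n - m)%N then (r == s)%:R else A r s.
  apply/matrixP => r s; rewrite (H k) //; case: ifP => // h; exact: Aid.
elim: m => [|m IH] hm r s.
  by rewrite big_ord0 subn0 ltn_ord mxE.
rewrite big_ord_recr [LHS]mxE.
transitivity (\sum_(l < n) (if (l < n - m)%N then (r == l)%:R else A r l) *
   (if s == (n - m.+1)%N :> nat then A l s else (l == s)%:R)).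
  apply: eq_bigr => l _; rewrite IH ?(ltnW hm) //.
  by congr (_ * _); rewrite mxE.
case hs: (s == (n - m.+1)%N :> nat).
  have -> : (s < n - m.+1)%N = false by lia.
  have hl (l : 'I_n) : (if (l < n - m)%N then (r == l)%:R else A r l) * A l s
      = A l s * (r == l)%:R.
    case: ifP => hl; first by rewrite mulrC.
    by rewrite (Au l s) ?mulr0 ?mul0r //; lia.
  under eq_bigr => l _ do rewrite hl.
  by rewrite (sum_pick (fun l => A l s) (l0 := r)) // => l; rewrite eq_sym.
rewrite (@sum_pick _ _ (fun l : 'I_n => if (l < n - m)%N then (r == l)%:R else A r l)
   (fun l => l == s) s) //.
by have -> : (s < n - m)%N = (s < n - m.+1)%N by lia.
Qed.

Lemma entryE (R : rcfType) n (A : 'M[R[i]]_n) (r s : 'I_n) : entry A r s = A r s.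
Proof. by rewrite /entry !valK. Qed.

Lemma entry_out (R : rcfType) n (A : 'M[R[i]]_n) r s : (n <= r)%N -> entry A r s = 0.
Proof. by move=> h; rewrite /entry insubF //; apply/negbTE; rewrite -leqNgt. Qed.

Lemma frob_factorization (R : rcfType) (n k : nat) (S : 'M[R[i]]_n) :
  (0 < k <= n)%N ->
  (forall r s : 'I_n, (s < n - k)%N -> S r s = (r == (s + k)%N :> nat)%:R) ->
  (forall r i : nat, (i < k)%N -> (r < i)%N -> entry S r (n - k + i) = 0) ->
  S = \prod_(i < k) (downshift R n * frob_factor k S i).
Proof.
move=> /andP[k0 kn] Sid Sz.
have A_E (i : nat) (r s : 'I_n) : (i < k)%N -> (downshift R n * frob_factor k S i) r s =
   if (s.+1 == n)%N then entry S (r + i)%N (n - k + i)%N else (r == s.+1 :> nat)%:R.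
  move=> ik.
  rewrite [LHS]mxE; under eq_bigr => l _ do rewrite !mxE mulrC.
  have n0 : (0 < n)%N by lia.
  pose p := if (r == 0 :> nat)%N then n.-1 else r.-1.
  have pn : (p < n)%N by rewrite /p; have := ltn_ord r; case: ifP; lia.
  rewrite (@sum_pick _ _ _ (fun l : 'I_n => r == (l.+1 %% n)%N :> nat) (Ordinal pn)); last first.
    move=> l; rewrite -val_eqE /= /p.
    have hl := ltn_ord l; have hr := ltn_ord r.
    have [e|ne] := eqVneq l.+1 n.
      by rewrite e modnn; case: ifP => h; lia.
    rewrite modn_small; last by lia.
    by case: ifP; lia.
  rewrite /= -val_eqE /= /p; have hr := ltn_ord r; have hs := ltn_ord s.
  have [hs1|hs1] := eqVneq s.+1 n.
    have [r0|r0] := eqVneq (r : nat) 0%N.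
      by rewrite prednK // eqxx r0 add0n.
    have -> : (r.-1.+1 == n) = false by lia.
    by have -> : (r.-1 + i).+1 = (r + i)%N by lia.
  by case: ifP => h; congr (_ %:R); lia.
suff H m : (m <= k)%N -> forall r s : 'I_n,
   (\prod_(i < m) (downshift R n * frob_factor k S i)) r s =
   if (s < n - m)%N then (r == (s + m)%N :> nat)%:R else entry S r (s + m - k).
  apply/matrixP => r s; rewrite (H k) //; case: ifP => // h; first exact: Sid.
  by rewrite addnK entryE.
elim: m => [|m IH] hm r s.
  by rewrite big_ord0 subn0 ltn_ord mxE addn0 val_eqE.
rewrite big_ord_recr [LHS]mxE.
have hs := ltn_ord s; have hr := ltn_ord r.
under eq_bigr => l _ do rewrite IH ?(ltnW hm) // A_E //.
have [hs1|hs1] := eqVneq s.+1 n.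
  have -> : (s < n - m.+1)%N = false by lia.
  have e : (n - k + m)%N = (s + m.+1 - k)%N by lia.
  rewrite e.
  have hl (l : 'I_n) : (if (l < n - m)%N then (r == (l + m)%N :> nat)%:R else entry S r (l + m - k)) * entry S (l + m) (s + m.+1 - k)
      = entry S r (s + m.+1 - k) * (r == l + m :> nat)%N%:R.
    case: ifP => hl.
      by have [->|_] := eqVneq (r : nat) (l + m)%N; rewrite ?mul1r ?mulr1 ?mul0r ?mulr0.
    rewrite (@entry_out _ _ _ (l + m)); last by lia.
    have -> : (r == (l + m)%N :> nat) = false by lia.
    by rewrite !mulr0.
  under eq_bigr => l _ do rewrite hl.
  have [mr|rm] := leqP m r.
    have hp : (r - m < n)%N by lia.
    by rewrite (@sum_pick _ _ _ (fun l : 'I_n => r == (l + m)%N :> nat) (Ordinal hp)) // => l; rewrite -val_eqE /=; lia.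
  rewrite -e Sz // big1 // => l _; by rewrite mul0r.
have hp : (s.+1 < n)%N by lia.
rewrite (@sum_pick _ _ (fun l : 'I_n => if (l < n - m)%N then (r == (l + m)%N :> nat)%:R else entry S r (l + m - k)) (fun l => l == s.+1 :> nat) (Ordinal hp)); last by move=> l; rewrite -val_eqE.
rewrite /= addSnnS; by have -> : (s.+1 < n - m)%N = (s < n - m.+1)%N by lia.
Qed.

Lemma block_posE d k (r : 'I_(d * k)) : (r : nat) = (block_pos r * k + block_off r)%N.
Proof. by rewrite /= -divn_eq. Qed.

Lemma last_block_col d k (s : 'I_(d * k)) : ((block_pos s).+1 == d)%N = (d * k - k <= s)%N.
Proof.
have := block_posE s; have := ltn_ord (block_pos s); have := ltn_ord (block_off s).
move: (nat_of_ord (block_pos s)) (nat_of_ord (block_off s)) => p o ho hp ->.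
have [e|ne] := eqVneq p.+1 d; first by rewrite -e mulSn addKn leq_addr.
apply/esym/negbTE; rewrite -ltnNge.
have h : (p.+2 <= d)%N by lia.
have : (p.+2 * k <= d * k)%N by rewrite leq_mul2r h orbT.
rewrite !mulSn; lia.
Qed.

Lemma companion_T_factorization (R : rcfType) d k (N : nat -> 'M[R[i]]_k) :
  (0 < d)%N -> upper_tri (N d) ->
  companion_T d N = \prod_(i < k) spike_factor (companion_T d N) (d * k - i.+1).
Proof.
move=> d0 Nu; apply: spike_factorization.
- by rewrite leq_pmull.
- move=> r s sr; rewrite mxE last_block_col; case: ifP => h; last first.
    by rewrite -val_eqE /=; have -> : (r == s :> nat) = false by lia.
  have hr : (d * k - k <= r)%N by lia.
  have := h; rewrite -last_block_col => /eqP hs1.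
  have := hr; rewrite -last_block_col => /eqP hr1.
  rewrite hr1; apply: Nu.
  have := block_posE r; have := block_posE s.
  have -> : block_pos s = block_pos r :> nat by lia.
  lia.
- move=> r s hs; rewrite mxE last_block_col.
  by have -> : (d * k - k <= s)%N = false by lia.
Qed.

Lemma companion_S_left (R : rcfType) d k (M : nat -> 'M[R[i]]_k) (r s : 'I_(d * k)) :
 (s < d * k - k)%N -> companion_S d M r s = (r == (s + k)%N :> nat)%:R.
Proof.
move=> hs; rewrite mxE last_block_col.
have -> : (d * k - k <= s)%N = false by lia.
congr (_ %:R); rewrite -val_eqE /=; congr nat_of_bool.
have k0 : (0 < k)%N by have := ltn_ord (block_off r); lia.
apply/andP/eqP => [[/eqP h1 /eqP h2]|->].
  rewrite (divn_eq r k) (divn_eq s k) h1 h2 mulSn; lia.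
by rewrite divnDr ?dvdnn // divnn k0 addn1 modnDr.
Qed.

Lemma companion_S_frobenius (R : rcfType) d k (M : nat -> 'M[R[i]]_k) :
  (0 < d)%N -> (0 < k)%N -> lower_tri (M 0%N) ->
  companion_S d M = \prod_(i < k) (downshift R (d * k) * frob_factor k (companion_S d M) i).
Proof.
move=> d0 k0 Ml; apply: frob_factorization.
- by rewrite k0 leq_pmull.
- by move=> r s; apply: companion_S_left.
move=> r i ik ri.
have kn : (k <= d * k)%N by rewrite leq_pmull.
have hr : (r < d * k)%N by lia.
have hs : (d * k - k + i < d * k)%N by lia.
rewrite (entryE (companion_S d M) (Ordinal hr) (Ordinal hs)).
rewrite [LHS]mxE last_block_col /= leq_addr.
have h0 : (r %/ k = 0)%N by rewrite divn_small //; lia.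
rewrite h0 Ml ?oppr0 //=.
rewrite modn_small; last by lia.
have -> : (d * k - k = d.-1 * k)%N by case: (d) d0 => // d' _; rewrite mulSn addKn.
by rewrite modnMDl modn_small.
Qed.

Lemma upshift_exp_entry (R : rcfType) n (X : 'M[R[i]]_n) m (r s : 'I_n) :
  ((downshift R n)^t* ^+ m *m X) r s = entry X ((r + m) %% n) s.
Proof.
elim: m r => [|m IH] r.
  by rewrite mul1mx addn0 modn_small // entryE.
rewrite exprS -[_ * _]/(_ *m _) -mulmxA [LHS]mxE.
under eq_bigr => l _ do rewrite IH !mxE mulrC.
have hp : (r.+1 %% n < n)%N by rewrite ltn_mod; have := ltn_ord r; lia.
transitivity (\sum_(l < n) (entry X ((l + m) %% n) s * (l == Ordinal hp)%:R)).
  apply: eq_bigr => l _; congr (_ * _).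
  by rewrite conjC_nat.
rewrite (@sum_pick _ _ (fun l : 'I_n => entry X ((l + m) %% n) s) _ (Ordinal hp)) //=.
by rewrite modnDml addSnnS.
Qed.

Lemma companion_S_gaussian (R : rcfType) d k (M : nat -> 'M[R[i]]_k) :
  (0 < d)%N -> (0 < k)%N -> upper_tri (M 0%N) ->
  (downshift R (d * k))^t* ^+ k *m companion_S d M
   = \prod_(i < k) gauss_factor k (companion_S d M) (d * k - i.+1).
Proof.
move=> d0 k0 Mu; apply: spike_factorization.
- by rewrite leq_pmull.
- have kn : (k <= d * k)%N by rewrite leq_pmull.
  move=> r s sr; rewrite upshift_exp_entry.
  have hp : ((r + k) %% (d * k) < d * k)%N by rewrite ltn_mod; lia.
  rewrite (entryE (companion_S d M) (Ordinal hp) s).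
  have hr := ltn_ord r.
  have [h|h] := ltnP s (d * k - k).
    rewrite companion_S_left //=; have [h2|h2] := ltnP (r + k) (d * k).
      rewrite modn_small //; suff -> : ((r + k)%N == (s + k)%N) = false by []. lia.
    have -> : ((r + k) = (r + k - d * k) + d * k)%N by lia.
    rewrite modnDr modn_small; last by lia.
    suff -> : ((r + k - d * k)%N == (s + k)%N) = false by []. lia.
  rewrite [LHS]mxE last_block_col h /=.
  have e : ((r + k) %% (d * k) = r - (d * k - k))%N.
    have -> : (r + k = (r - (d * k - k)) + d * k)%N by lia.
    by rewrite modnDr modn_small; lia.
  have -> : ((r + k) %% (d * k) %/ k = 0)%N by rewrite e divn_small //; lia.
  rewrite Mu ?oppr0 //= e [X in (_ < X)%N]modn_small; last by lia.
  have es : (s = (d.-1 * k) + (s - (d * k - k)) :> nat)%N.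
     have -> : (d.-1 * k = d * k - k)%N by case: (d) d0 => // d' _; rewrite mulSn addKn.
     lia.
  rewrite es modnMDl modn_small; last by have := ltn_ord s; lia.
  have := ltn_ord s; lia.
- have kn : (k <= d * k)%N by rewrite leq_pmull.
  move=> r s hs; rewrite upshift_exp_entry.
  have hp : ((r + k) %% (d * k) < d * k)%N by rewrite ltn_mod; lia.
  rewrite (entryE (companion_S d M) (Ordinal hp) s) companion_S_left //=.
  congr (_ %:R); rewrite -val_eqE /=; congr nat_of_bool.
  have hr := ltn_ord r.
  have [h2|h2] := ltnP (r + k) (d * k); first by rewrite modn_small //; lia.
  have -> : ((r + k) = (r + k - d * k) + d * k)%N by lia.
  rewrite modnDr modn_small; lia.
Qed.

Definition coremx (R : rcfType) (n i : nat) (G : 'M[R[i]]_2) : 'M[R[i]]_n :=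
  \matrix_(r, s)
    if (i <= r <= i.+1)%N && (i <= s <= i.+1)%N
    then G (inord (r - i)) (inord (s - i)) else (r == s)%:R.

(* A sequence of n cores acting on rows (0,1), ..., (n-1,n) of C^(n+1);
   entries of index at least n are ignored. *)
Definition cores (R : rcfType) := nat -> 'M[R[i]]_2.

Definition core_prod (R : rcfType) (n : nat) (C : cores R) : 'M[R[i]]_n.+1 :=
  \prod_(i < n) coremx n.+1 i (C i).

Definition recovered_y (R : rcfType) (n : nat) (C B : cores R) :
    'rV[R[i]]_n.+1 :=
  - ((core_prod n C)^t* ord_max ord0)^-1
    *: row ord_max ((core_prod n C)^t* *m core_prod n B).

Definition tri_mx (R : rcfType) (n : nat) (C B : cores R) : 'M[R[i]]_n :=
  let Pi : 'M[R[i]]_(n.+1, n) := pid_mx n in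
  Pi^T *m ((core_prod n C)^t*
    *m (core_prod n B + delta_mx ord0 ord0 *m recovered_y n C B)) *m Pi.

(* The j-th column of A, with -1 appended. *)
Definition extended_spike (R : rcfType) (n : nat) (A : 'M[R[i]]_n) (j : 'I_n) :
    'cV[R[i]]_n.+1 :=
  \col_r (if unlift ord_max r is Some r' then A r' j else -1).

(* The equation A = Pi^T C^* (B + e_1 y^T) Pi does not determine C and B, and
   other solutions can make y arbitrarily large.  The representation used is
   the one in which C rolls the extended spike up to the first coordinate and
   B = C Z with Z swapping coordinates j and n. *)
Definition exact_storage (R : rcfType) (n : nat) (A : 'M[R[i]]_n) (j : 'I_n)
    (C B : cores R) : Prop :=
  [/\ forall i, (i < n)%N -> C i \is unitarymx /\ B i \is unitarymx,
      exists alpha : R[i],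
        core_prod n C *m extended_spike A j = alpha *: delta_mx ord0 ord0,
      core_prod n B = core_prod n C *m tperm_mx (lift ord_max j) ord_max
    & A = tri_mx n C B].

Definition stored (R : rcfType) (eps : R) (n : nat) (A : 'M[R[i]]_n)
    (j : 'I_n) (C B : cores R) : Prop :=
  exists C0 B0 : cores R, exact_storage A j C0 B0 /\
    forall i, (i < n)%N ->
      [/\ C i \is unitarymx, B i \is unitarymx,
          fnorm (C i - C0 i) <= eps & fnorm (B i - B0 i) <= eps].

Inductive factor (R : rcfType) :=
  | Core of nat & 'M[R[i]]_2
  | Tri of cores R & cores R.

Definition word (R : rcfType) := seq (factor R).

(* Words for S and for T (not for T^-1). *)
Definition state (R : rcfType) := (word R * word R)%type.

Definition factor_mx (R : rcfType) (n : nat) (f : factor R) : 'M[R[i]]_n :=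
  match f with
  | Core i G => coremx n i G
  | Tri C B => tri_mx n C B
  end.

Definition word_mx (R : rcfType) (n : nat) (w : word R) : 'M[R[i]]_n :=
  \prod_(f <- w) factor_mx n f.

Definition swap2 (R : rcfType) : 'M[R[i]]_2 := \matrix_(r, s) (r != s)%:R.

Definition downshift_word (R : rcfType) (n : nat) : word R :=
  [seq Core i (swap2 R) | i <- iota 0 n.-1].

Lemma core_swap2 (R : rcfType) n i (r s : 'I_n) :
  coremx n i (swap2 R) r s =
  (r == (if s == i :> nat then i.+1 else if s == i.+1 :> nat then i else s) :> nat)%:R.
Proof.
rewrite mxE; case: ifP => [/andP[hr hs]|h].
  rewrite mxE -val_eqE /= !inordK; try lia.
  congr (_ %:R); case: ifP => h1; [|case: ifP => h2]; lia.
congr (_ %:R); rewrite -val_eqE /=; case: ifP => h1; [|case: ifP => h2]; lia.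
Qed.

Lemma word_mx_downshift (R : rcfType) n :
  word_mx n (downshift_word R n) = downshift R n.
Proof.
suff H m : (m < n)%N -> forall r s : 'I_n,
   word_mx n [seq Core i (swap2 R) | i <- iota 0 m] r s =
   (r == (if (s < m)%N then s.+1 else if s == m :> nat then 0%N else s) :> nat)%:R.
  apply/matrixP => r s; have hr := ltn_ord r; have hs := ltn_ord s.
  rewrite [LHS]H; last by lia.
  rewrite mxE; congr (_ %:R); congr nat_of_bool; congr (_ == _).
  case: ifP => h; first by rewrite modn_small //; lia.
  have -> : s.+1 = n by lia.
  by rewrite modnn; case: ifP; lia.
elim: m => [|m IH] hm r s.
  rewrite /word_mx big_nil mxE -val_eqE /=; congr (_ %:R).
  by case: ifP; lia.
rewrite -addn1 iotaD map_cat /word_mx big_cat big_seq1 [LHS]mxE /= add0n.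
have hr := ltn_ord r; have hs := ltn_ord s.
pose p := (if s == m :> nat then m.+1 else if s == m.+1 :> nat then m else s)%N.
have hp : (p < n)%N by rewrite /p; case: ifP => _; [|case: ifP]; lia.
have IH' := IH (ltnW hm).
transitivity (\sum_(l < n) ((r == (if (l < m)%N then l.+1 else if l == m :> nat then 0%N else l) :> nat)%:R * (l == Ordinal hp)%:R : R[i])).
  apply: eq_bigr => l _; congr (_ * _); first exact: IH'.
  by rewrite core_swap2.
rewrite (@sum_pick _ _ _ (fun l => l == Ordinal hp) (Ordinal hp)) //=.
congr (_ %:R); rewrite /p; repeat (case: ifP; try lia).
Qed.

Definition tri_word (R : rcfType) (k : nat) (C B : nat -> cores R) : word R :=
  [seq Tri (C i) (B i) | i <- iota 0 k].

Definition initial_state (R : rcfType) (eps : R) (kind : factorization)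
    (n k : nat) (S T : 'M[R[i]]_n) (st : state R) : Prop :=
  exists RC RB TC TB : nat -> cores R,
  [/\ forall (i : nat) (j : 'I_n), (i < k)%N -> (j + i.+1)%N = n ->
        stored eps (spike_factor T j) j (TC i) (TB i),
      st.2 = tri_word k TC TB
    & match kind with
      | Frobenius =>
          (forall (i : nat) (j : 'I_n), (i < k)%N -> j.+1 = n ->
             stored eps (frob_factor k S i) j (RC i) (RB i)) /\
          st.1 = flatten [seq rcons (downshift_word R n) (Tri (RC i) (RB i))
                         | i <- iota 0 k]
      | Gaussian =>
          (forall (i : nat) (j : 'I_n), (i < k)%N -> (j + i.+1)%N = n ->
             stored eps (gauss_factor k S j) j (RC i) (RB i)) /\
          st.1 = flatten (nseq k (downshift_word R n)) ++ tri_word k RC RB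
      end].

Definition fusion (R : rcfType) (eps : R) (F G H : 'M[R[i]]_2) : Prop :=
  H \is unitarymx /\ fnorm (H - F *m G) <= eps.

(* F_a G_b H_a is refactored as F'_b G'_a H'_b, with (a, b) = (0, 1) or
   (1, 0) being the two directions. *)
Definition turnover (R : rcfType) (eps : R) (a b : nat)
    (F G H F' G' H' : 'M[R[i]]_2) : Prop :=
  [/\ F' \is unitarymx, G' \is unitarymx, H' \is unitarymx &
      fnorm (coremx 3 b F' *m coremx 3 a G' *m coremx 3 b H'
             - coremx 3 a F *m coremx 3 b G *m coremx 3 a H) <= eps].

Definition same_cores_off (R : rcfType) (i : nat) (C C' : cores R) : Prop :=
  forall j, j != i -> j != i.+1 -> C' j = C j.

(* C^* B G_i -> C^* X_(i+1) B' -> G'_i C'^* B'; as X_(i+1) fixes e_1, the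
   rank-one part e_1 y^T needs no update. *)
Definition pass_rl (R : rcfType) (eps : R) (i : nat)
    (C B : cores R) (G G' : 'M[R[i]]_2) (C' B' : cores R) : Prop :=
  exists X : 'M[R[i]]_2,
  [/\ turnover eps 0 1 (B i) (B i.+1) G X (B' i) (B' i.+1),
      turnover eps 1 0 ((C i.+1)^t*) ((C i)^t*) X
                       G' ((C' i.+1)^t*) ((C' i)^t*),
      same_cores_off i C C' & same_cores_off i B B'].

(* G_i C^* B -> C'^* X_(i+1) B -> C'^* B' G'_i *)
Definition pass_lr (R : rcfType) (eps : R) (i : nat)
    (G : 'M[R[i]]_2) (C B C' B' : cores R) (G' : 'M[R[i]]_2) : Prop :=
  exists X : 'M[R[i]]_2,
  [/\ turnover eps 0 1 G ((C i.+1)^t*) ((C i)^t*)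
                       ((C' i.+1)^t*) ((C' i)^t*) X,
      turnover eps 1 0 X (B i) (B i.+1) (B' i) (B' i.+1) G',
      same_cores_off i C C' & same_cores_off i B B'].

(* The nat counts the fusions and turnovers; reordering cores that act on
   disjoint rows and writing or erasing an identity core cost nothing. *)
Inductive word_step (R : rcfType) (n : nat) (eps : R) :
    nat -> word R -> word R -> Prop :=
  | Step_commute l r i j F G of (i.+1 < j)%N || (j.+1 < i)%N :
      word_step n eps 0 (l ++ [:: Core i F; Core j G] ++ r)
                        (l ++ [:: Core j G; Core i F] ++ r)
  | Step_insert_id l r i of (i.+1 < n)%N :
      word_step n eps 0 (l ++ r) (l ++ [:: Core i 1%:M] ++ r)
  | Step_delete_id l r i :
      word_step n eps 0 (l ++ [:: Core i 1%:M] ++ r) (l ++ r)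
  | Step_fusion l r i F G H of fusion eps F G H :
      word_step n eps 1 (l ++ [:: Core i F; Core i G] ++ r)
                        (l ++ [:: Core i H] ++ r)
  | Step_turnover_down l r i F G H F' G' H' of
      turnover eps 0 1 F G H F' G' H' :
      word_step n eps 1
        (l ++ [:: Core i F; Core i.+1 G; Core i H] ++ r)
        (l ++ [:: Core i.+1 F'; Core i G'; Core i.+1 H'] ++ r)
  | Step_turnover_up l r i F G H F' G' H' of
      turnover eps 1 0 F G H F' G' H' :
      word_step n eps 1
        (l ++ [:: Core i.+1 F; Core i G; Core i.+1 H] ++ r)
        (l ++ [:: Core i F'; Core i.+1 G'; Core i H'] ++ r)
  | Step_pass_rl l r i C B G G' C' B' of pass_rl eps i C B G G' C' B' :
      word_step n eps 2 (l ++ [:: Tri C B; Core i G] ++ r)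
                        (l ++ [:: Core i G'; Tri C' B'] ++ r)
  | Step_pass_lr l r i G C B C' B' G' of pass_lr eps i G C B C' B' G' :
      word_step n eps 2 (l ++ [:: Core i G; Tri C B] ++ r)
                        (l ++ [:: Tri C' B'; Core i G'] ++ r).

(* Moving a core across T^-1 at an outer end of S T^-1, or between S and T^-1:
   the pencil is multiplied on the left (right) by a unitary matrix. *)
Inductive transfer (R : rcfType) : state R -> state R -> Prop :=
  | Transfer_left_ST i G ws wt :
      transfer (Core i G :: ws, wt) (ws, Core i (G^t*) :: wt)
  | Transfer_left_TS i G ws wt :
      transfer (ws, Core i G :: wt) (Core i (G^t*) :: ws, wt)
  | Transfer_right_ST i G ws wt :
      transfer (rcons ws (Core i G), wt) (ws, rcons wt (Core i (G^t*)))
  | Transfer_right_TS i G ws wt :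
      transfer (ws, rcons wt (Core i G)) (rcons ws (Core i (G^t*)), wt).

Inductive chase (R : rcfType) (n : nat) (eps : R) :
    nat -> state R -> state R -> Prop :=
  | Chase_done st : chase n eps 0 st st
  | Chase_S m m' ws ws' wt st of
      word_step n eps m ws ws' & chase n eps m' (ws', wt) st :
      chase n eps (m + m') (ws, wt) st
  | Chase_T m m' ws wt wt' st of
      word_step n eps m wt wt' & chase n eps m' (ws, wt') st :
      chase n eps (m + m') (ws, wt) st
  | Chase_transfer m st st' st'' of
      transfer st st' & chase n eps m st' st'' : chase n eps m st st''.

Definition hess_tri_word (R : rcfType) (n k : nat) (G : cores R)
    (RC RB TC TB : nat -> cores R) : state R :=
  ([seq Core i (G i) | i <- iota 0 n.-1] ++ tri_word k RC RB,
   tri_word k TC TB).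

Definition hess_tri_state (R : rcfType) (n k : nat) (st : state R) : Prop :=
  exists (G : cores R) (RC RB TC TB : nat -> cores R),
    st = hess_tri_word n k G RC RB TC TB.

Definition schur_state (R : rcfType) (n k : nat) (st : state R) : Prop :=
  exists (G : cores R) (RC RB TC TB : nat -> cores R),
    (forall i, (i.+1 < n)%N -> is_diag_mx (G i)) /\
    st = hess_tri_word n k G RC RB TC TB.

(* Start of an implicit QR step: a unitary similarity of S T^-1 by a product
   of cores (depending on the shifts, whose choice is left free). *)
Definition introduce_shift (R : rcfType) (n : nat) (st st' : state R) : Prop :=
  exists gs : seq (nat * 'M[R[i]]_2),
    all (fun g => (g.1.+1 < n)%N && (g.2 \is unitarymx)) gs /\
    let w := [seq Core g.1 g.2 | g <- gs] in
    st' = (w ++ st.1, w ++ st.2).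

(* A core within eps of a diagonal one is replaced by the latter. *)
Definition deflation (R : rcfType) (eps : R) (st st' : state R) : Prop :=
  exists (l r : word R) (i : nat) (G D : 'M[R[i]]_2),
    [/\ st = (l ++ Core i G :: r, st.2), st' = (l ++ Core i D :: r, st.2),
        D \is unitarymx, is_diag_mx D & fnorm (D - G) <= eps].

(* A sweep with no introduced core covers zero-shift steps, by which zero
   eigenvalues are deflated. *)
Inductive qr_iteration (R : rcfType) (n k : nat) (eps : R) :
    nat -> state R -> state R -> Prop :=
  | QR_done st : qr_iteration n k eps 0 st st
  | QR_sweep m m' st st1 st2 st3 of
      introduce_shift n st st1 & chase n eps m st1 st2 &
      hess_tri_state n k st2 & qr_iteration n k eps m' st2 st3 :
      qr_iteration n k eps (m + m') st st3
  | QR_deflate m st st1 st2 of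
      deflation eps st st1 & qr_iteration n k eps m st1 st2 :
      qr_iteration n k eps m.+1 st st2.

(* A run with m fusions, turnovers and deflations in total.  Sh and Th are the
   matrices represented by the final stored factors. *)
Definition computed_schur (R : rcfType) (eps : R) (m : nat)
    (kind : factorization) (n k : nat) (S T Sh Th : 'M[R[i]]_n) : Prop :=
  exists (st0 st1 st2 : state R) (m1 m2 : nat),
    [/\ initial_state eps kind k S T st0,
        chase n eps m1 st0 st1 /\ hess_tri_state n k st1,
        qr_iteration n k eps m2 st1 st2 /\ schur_state n k st2,
        m = (m1 + m2)%N
      & Sh = word_mx n st2.1 /\ Th = word_mx n st2.2].

Definition eval2 (R : rcfType) (p : {poly {poly R}}) (d k : nat) : R :=
  p.[(d%:R)%:P].[k%:R].

(* Main.v *)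
Require Import Defs.
From mathcomp Require Import all_boot all_order all_algebra.
From mathcomp Require Import perm spectral sesquilinear complex reals.
From mathcomp Require Import zify ring lra.

(** Each operation of the algorithm is an exact unitary transformation up to an
    error of norm [c u], and unitary factors do not enlarge errors.  Hence the
    final state is unitarily equivalent to a product with the original factor
    structure in which each group of cores, and each pair [C], [B] storing a
    triangular factor, is off by at most [e = (n + m) c u] in norm.

    Moving [C] and [B] by [e] changes a spike factor with spike [x] by terms of
    size [O(|x| e)], apart from a term [theta x e_j^T] with [theta = O(|x| e)],
    which arises because the recovered [y] is divided by [1 / |x|].  In the
    product of all factors, [x] multiplied by the preceding factors is a column
    of a partial product of [S] (or [T]), and [e_j^T] goes unchanged through the
    following factors.  All partial products consist of entries of [S] (or [T]),
    zeros and ones, so that every first-order term is [O(|S|^2 e)]: no higher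
    power of the norm appears although there are [k] factors. *)

Set Implicit Arguments.
Unset Strict Implicit.
Unset Printing Implicit Defensive.

Import Order.TTheory GRing.Theory Num.Theory.
Local Open Scope ring_scope.
Local Open Scope sesquilinear_scope.

Local Notation normc := ComplexField.Normc.normc.

(** A stored factor is a nonlinear function of [C] and [B], so the run is compared with exact data
    at the level of these unitary products, and the function is evaluated only once, at the end.
    This works because a pass-through multiplies [C] and [B] on the left by the same unitary [X^*],
    with [X] fixing [e_1], and on the right by cores that fix [e_(n+1)]: under such frames the
    recovered [y] transforms exactly ([recovered_mx_equiv]), so that frames can be removed without
    loss. The denominator in [y] is the corner entry of [C^*]; frames do not change it, its initial
    modulus is [1 / |x|] with [x] the extended spike, and the run moves it by at most [e]. The
    condition [e * h <= 1/2], with [h] bounding [|x|], therefore keeps it away from zero, which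
    gives both the perturbation expansion and triangular final factors. Nothing is truncated: terms
    of higher order are collected in [K * u ^+ 2], where [K] and the threshold [u0] are chosen
    before [u], [m] and the run. *)

Lemma normc_sqrE (R : rcfType) (z : R[i]) :
  (normc z ^+ 2)%R%:C%C = z * Num.conj z.
Proof. by rewrite rmorphXn /=; exact: sqr_normc. Qed.

Lemma normc_ge0 (R : rcfType) (z : R[i]) : 0 <= normc z.
Proof. by case: z => a b; rewrite sqrtr_ge0. Qed.

Lemma normc_conj (R : rcfType) (z : R[i]) : normc (Num.conj z) = normc z.
Proof. by case: z => a b; rewrite /= sqrrN. Qed.

Lemma normc_add (R : rcfType) (y z : R[i]) : normc (y + z) <= normc y + normc z.
Proof. exact: (@le_normcD R y z). Qed.

Lemma normc_opp (R : rcfType) (z : R[i]) : normc (- z) = normc z.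
Proof. exact: (@normcN R z). Qed.

Lemma normc_nat (R : rcfType) (n : nat) : normc (n%:R : R[i]) = n%:R.
Proof.
have := @normcMn R 1 n; rewrite -[LHS]/(normc (n%:R : R[i])) => ->.
by rewrite ComplexField.Normc.normc1.
Qed.

Lemma normc_sum (R : rcfType) (I : finType) (F : I -> R[i]) :
  normc (\sum_i F i) <= \sum_i normc (F i).
Proof.
elim/big_ind2: _ => [|x1 x2 y1 y2 h1 h2|//]; first by rewrite ComplexField.Normc.normc0.
by apply: le_trans (normc_add _ _) _; exact: lerD.
Qed.

(** * Frobenius norm *)

(** Lagrange's identity: twice the difference of the two sides is the double sum of the squares of
    [a i * b j - a j * b i]. *)
Lemma Cauchy_Schwarz_sum (R : realDomainType) (I : finType) (a b : I -> R) :
  (\sum_i a i * b i) ^+ 2 <= (\sum_i a i ^+ 2) * (\sum_i b i ^+ 2).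
Proof.
rewrite -subr_ge0 -(pmulr_rge0 _ (ltr0Sn R 1)).
have -> : 2%:R * ((\sum_i a i ^+ 2) * (\sum_i b i ^+ 2) - (\sum_i a i * b i) ^+ 2)
    = \sum_i \sum_j (a i * b j - a j * b i) ^+ 2.
  have e1 : (\sum_i a i ^+ 2) * (\sum_i b i ^+ 2)
      = \sum_i \sum_j (a i ^+ 2 * b j ^+ 2) by rewrite mulr_suml; under eq_bigr do rewrite mulr_sumr.
  have e2 : (\sum_i a i * b i) ^+ 2 = \sum_i \sum_j (a i * b i) * (a j * b j).
    by rewrite expr2 mulr_suml; under eq_bigr do rewrite mulr_sumr.
  have -> : 2%:R * ((\sum_i a i ^+ 2) * (\sum_i b i ^+ 2) - (\sum_i a i * b i) ^+ 2)
    = (\sum_i a i ^+ 2) * (\sum_i b i ^+ 2) + (\sum_i a i ^+ 2) * (\sum_i b i ^+ 2)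
      - 2%:R * (\sum_i a i * b i) ^+ 2 by ring.
  rewrite {1}e1 e1 [X in _ + X - _]exchange_big e2 mulr_sumr -big_split -sumrB /=.
  apply: eq_bigr => i _; rewrite mulr_sumr -big_split -sumrB /=.
  by apply: eq_bigr => j _; ring.
by apply: sumr_ge0 => i _; apply: sumr_ge0 => j _; exact: sqr_ge0.
Qed.

Section Fnorm.
Variable R : rcfType.
Local Notation C := (R[i]).

Lemma hadjM m n p (A : 'M[C]_(m, n)) (B : 'M[C]_(n, p)) :
  (A *m B)^t* = B^t* *m A^t*.
Proof. by rewrite trmx_mul map_mxM. Qed.

Lemma hadjK m n (A : 'M[C]_(m, n)) : A^t*^t* = A.
Proof. by apply/matrixP => i j; rewrite !mxE conjCK. Qed.

Lemma hadjD m n (A B : 'M[C]_(m, n)) : (A + B)^t* = A^t* + B^t*.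
Proof. by apply/matrixP => i j; rewrite !mxE rmorphD. Qed.

Lemma hadjB m n (A B : 'M[C]_(m, n)) : (A - B)^t* = A^t* - B^t*.
Proof. by apply/matrixP => i j; rewrite !mxE rmorphB. Qed.

Lemma hadjmx1 n : (1%:M : 'M[C]_n)^t* = 1%:M.
Proof. by rewrite trmx1 map_mx1. Qed.

Lemma unitarymx1 n : (1%:M : 'M[C]_n) \is unitarymx.
Proof. by apply/unitarymxP; rewrite hadjmx1 mulmx1. Qed.

Lemma hadj_delta m n (i : 'I_m) (j : 'I_n) :
  (delta_mx i j : 'M[C]_(m, n))^t* = delta_mx j i.
Proof. by apply/matrixP => r s; rewrite !mxE conjC_nat andbC. Qed.

Lemma mulUhadj n (U : 'M[C]_n) : U \is unitarymx -> U *m U^t* = 1%:M.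
Proof. by move/unitarymxP. Qed.

Lemma mulhadjU n (U : 'M[C]_n) : U \is unitarymx -> U^t* *m U = 1%:M.
Proof. by rewrite -trmxC_unitary => /unitarymxP; rewrite hadjK. Qed.

Lemma fnorm_ge0 m n (A : 'M[C]_(m, n)) : 0 <= fnorm A.
Proof. exact: sqrtr_ge0. Qed.

Lemma fnorm_sqr m n (A : 'M[C]_(m, n)) :
  fnorm A ^+ 2 = \sum_i \sum_j normc (A i j) ^+ 2.
Proof.
by rewrite sqr_sqrtr // sumr_ge0 // => i _; rewrite sumr_ge0 // => j _; rewrite sqr_ge0.
Qed.

(** Unitary invariance is proved through traces, where adjacent [U] and [U^t*] cancel. *)
Lemma fnorm_trace m n (A : 'M[C]_(m, n)) :
  ((fnorm A ^+ 2)%R)%:C%C = \tr (A *m A^t*).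
Proof.
rewrite fnorm_sqr rmorph_sum; apply: eq_bigr => i _.
rewrite mxE rmorph_sum; apply: eq_bigr => j _.
by rewrite !mxE; exact: normc_sqrE.
Qed.

Lemma fnorm_eq m n p q (A : 'M[C]_(m, n)) (B : 'M[C]_(p, q)) :
  \tr (A *m A^t*) = \tr (B *m B^t*) -> fnorm A = fnorm B.
Proof.
rewrite -!fnorm_trace => /complexI /eqP; rewrite eqrXn2 ?fnorm_ge0 // => /eqP //.
Qed.

Lemma fnorm_adj m n (A : 'M[C]_(m, n)) : fnorm (A^t*) = fnorm A.
Proof. by apply: fnorm_eq; rewrite hadjK mxtrace_mulC. Qed.

(** [U] may be rectangular so that the adjoint of the isometry [inj_mx] is covered, as [emb_fnorm]
    requires. *)
Lemma fnorm_isor m n p (A : 'M[C]_(m, n)) (U : 'M[C]_(n, p)) :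
  U *m U^t* = 1%:M -> fnorm (A *m U) = fnorm A.
Proof.
by move=> h; apply: fnorm_eq; rewrite hadjM -mulmxA [U *m _]mulmxA h mul1mx.
Qed.

Lemma fnorm_isol m n p (A : 'M[C]_(m, n)) (U : 'M[C]_(p, m)) :
  U^t* *m U = 1%:M -> fnorm (U *m A) = fnorm A.
Proof.
by move=> h; rewrite -fnorm_adj hadjM fnorm_isor ?fnorm_adj // hadjK.
Qed.

Lemma fnormMU m n (A : 'M[C]_(m, n)) (U : 'M[C]_n) :
  U \is unitarymx -> fnorm (A *m U) = fnorm A.
Proof. by move=> h; rewrite fnorm_isor // mulUhadj. Qed.

Lemma fnormUM m n (A : 'M[C]_(m, n)) (U : 'M[C]_m) :
  U \is unitarymx -> fnorm (U *m A) = fnorm A.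
Proof. by move=> h; rewrite fnorm_isol // mulhadjU. Qed.

Lemma fnormN m n (A : 'M[C]_(m, n)) : fnorm (- A) = fnorm A.
Proof.
by congr Num.sqrt; apply: eq_bigr => i _; apply: eq_bigr => j _; rewrite mxE normc_opp.
Qed.

Lemma fnormC m n (A B : 'M[C]_(m, n)) : fnorm (A - B) = fnorm (B - A).
Proof. by rewrite -fnormN opprB. Qed.

Lemma fnorm0 m n : fnorm (0 : 'M[C]_(m, n)) = 0.
Proof.
rewrite /fnorm big1 ?sqrtr0 // => i _; rewrite big1 // => j _.
by rewrite mxE ComplexField.Normc.normc0 expr0n.
Qed.

Lemma fnormZ m n (a : C) (A : 'M[C]_(m, n)) : fnorm (a *: A) = normc a * fnorm A.
Proof.
apply/eqP; rewrite -(@eqrXn2 _ 2) ?fnorm_ge0 ?mulr_ge0 ?normc_ge0 ?fnorm_ge0 //.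
rewrite exprMn !fnorm_sqr mulr_sumr; apply/eqP; apply: eq_bigr => i _.
by rewrite mulr_sumr; apply: eq_bigr => j _; rewrite mxE ComplexField.Normc.normcM exprMn.
Qed.

Lemma fnormD m n (A B : 'M[C]_(m, n)) : fnorm (A + B) <= fnorm A + fnorm B.
Proof.
rewrite -(@ler_pXn2r _ 2) // ?nnegrE ?addr_ge0 ?fnorm_ge0 //.
have cs : \sum_p (normc (A p.1 p.2) * normc (B p.1 p.2)) <= fnorm A * fnorm B.
  apply: le_trans (ler_norm _) _.
  rewrite -(@ler_pXn2r _ 2) // ?nnegrE ?mulr_ge0 ?fnorm_ge0 ?normr_ge0 //.
  rewrite real_normK ?num_real // exprMn !fnorm_sqr !pair_big /=.
  exact: (@Cauchy_Schwarz_sum _ _ (fun p => normc (A p.1 p.2))).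
rewrite sqrrD.
have -> : fnorm A ^+ 2 + fnorm A * fnorm B *+ 2 + fnorm B ^+ 2
  = fnorm A ^+ 2 + fnorm B ^+ 2 + fnorm A * fnorm B *+ 2 by ring.
apply: le_trans (lerD (lexx (fnorm A ^+ 2 + fnorm B ^+ 2)) (lerD cs cs)).
rewrite !fnorm_sqr !pair_big /= -!big_split /=.
apply: ler_sum => p _; rewrite mxE.
have h := normc_add (A p.1 p.2) (B p.1 p.2).
apply: (@le_trans _ _ ((normc (A p.1 p.2) + normc (B p.1 p.2)) ^+ 2)).
  by rewrite ler_pXn2r // ?nnegrE ?addr_ge0 ?normc_ge0.
by rewrite sqrrD mulr2n addrAC.
Qed.

Lemma fnormM m n p (A : 'M[C]_(m, n)) (B : 'M[C]_(n, p)) :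
  fnorm (A *m B) <= fnorm A * fnorm B.
Proof.
rewrite -(@ler_pXn2r _ 2) // ?nnegrE ?mulr_ge0 ?fnorm_ge0 //.
rewrite exprMn !fnorm_sqr [X in _ * X]exchange_big /= mulr_suml.
apply: ler_sum => i _; rewrite mulr_sumr; apply: ler_sum => j _.
apply: le_trans (Cauchy_Schwarz_sum _ _).
rewrite ler_pXn2r // ?nnegrE ?normc_ge0 //; last first.
  by apply: sumr_ge0 => k _; exact: mulr_ge0 (normc_ge0 _) (normc_ge0 _).
rewrite mxE; apply: le_trans (normc_sum _) _.
by apply: ler_sum => k _; rewrite ComplexField.Normc.normcM.
Qed.

Lemma fnorm_triangle m n (A B D : 'M[C]_(m, n)) :
  fnorm (A - D) <= fnorm (A - B) + fnorm (B - D).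
Proof. by apply: le_trans (fnormD _ _); rewrite addrA subrK. Qed.

Lemma normc_le_fnorm m n (A : 'M[C]_(m, n)) i j : normc (A i j) <= fnorm A.
Proof.
rewrite -(@ler_pXn2r _ 2) // ?nnegrE ?normc_ge0 ?fnorm_ge0 // fnorm_sqr.
rewrite (bigD1 i) //= (bigD1 j) //= -addrA lerDl.
apply: addr_ge0; first by apply: sumr_ge0 => *; exact: sqr_ge0.
by apply: sumr_ge0 => * ; apply: sumr_ge0 => *; exact: sqr_ge0.
Qed.

Lemma fnorm_delta m n (i : 'I_m) (j : 'I_n) : fnorm (delta_mx i j : 'M[C]_(m, n)) = 1.
Proof.
apply/eqP; rewrite -(@eqrXn2 _ 2) ?fnorm_ge0 // fnorm_sqr expr1n.
rewrite (bigD1 i) //= (bigD1 j) //= big1 ?addr0; last first.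
  by move=> l /negbTE h; rewrite mxE h andbF ComplexField.Normc.normc0 expr0n.
rewrite big1 ?addr0 => [|l /negbTE h]; last first.
  by rewrite big1 // => p _; rewrite mxE h ComplexField.Normc.normc0 expr0n.
by rewrite mxE !eqxx ComplexField.Normc.normc1 expr1n.
Qed.

End Fnorm.

(** * Core transformations as embedded small matrices *)

Section Embedding.
Variable R : rcfType.
Local Notation C := (R[i]).

(** The inclusion of C^p into C^n as the coordinates i, ..., i + p - 1, an isometry as soon as
    [i + p <= n]. *)
Definition inj_mx n p i : 'M[C]_(n, p) := \matrix_(r, s) (r == i + s :> nat)%N%:R.

Lemma inj_adjE n p i : (inj_mx n p i)^t* = (inj_mx n p i)^T.
Proof. by apply/matrixP => r s; rewrite !mxE conjC_nat. Qed.

Lemma inj_comp n m p i a : (a + p <= m)%N ->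
  inj_mx n m i *m inj_mx m p a = inj_mx n p (i + a).
Proof.
move=> h; apply/matrixP => r s; rewrite [LHS]mxE.
have hs := ltn_ord s; have ha : (a + s < m)%N by lia.
under eq_bigr => l _ do rewrite !mxE.
rewrite (@sum_pick _ _ (fun l : 'I_m => (r == i + l :> nat)%N%:R) _ (Ordinal ha)).
  by rewrite mxE /= addnA.
by move=> l; rewrite -val_eqE.
Qed.

Lemma inj_isom n p i : (i + p <= n)%N -> (inj_mx n p i)^t* *m inj_mx n p i = 1%:M.
Proof.
move=> h; rewrite inj_adjE; apply/matrixP => r s; rewrite [LHS]mxE.
have hs := ltn_ord s; have ha : (i + s < n)%N by lia.
under eq_bigr => l _ do rewrite !mxE.
rewrite (@sum_pick _ _ (fun l : 'I_n => (l == i + r :> nat)%N%:R) _ (Ordinal ha)).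
  by rewrite mxE /= eqn_add2l eq_sym val_eqE.
by move=> l; rewrite -val_eqE.
Qed.

Lemma inj_disjoint n p q i j : (i + p <= j)%N || (j + q <= i)%N ->
  (inj_mx n p i)^t* *m inj_mx n q j = 0.
Proof.
move=> h; rewrite inj_adjE; apply/matrixP => r s; rewrite !mxE big1 // => l _.
rewrite !mxE -natrM; have := ltn_ord r; have := ltn_ord s => hs hr.
by rewrite mulnb; have -> : ((l == i + r :> nat) && (l == j + s :> nat))%N = false by lia.
Qed.

(* Adding [J (M - 1) J^*] to the identity, with [J] an isometry, makes products,
   adjoints, nesting and disjointness of embeddings consequences of [J^* J = 1]. *)
Definition emb n p i (M : 'M[C]_p) : 'M[C]_n :=
  1%:M + inj_mx n p i *m (M - 1%:M) *m (inj_mx n p i)^t*.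

Lemma embE n p i (M : 'M[C]_p) :
  emb n i M = 1%:M + inj_mx n p i *m (M - 1%:M) *m (inj_mx n p i)^t*.
Proof. by []. Qed.

Lemma emb1 n p i : emb n i (1%:M : 'M_p) = 1%:M.
Proof. by rewrite !embE subrr mulmx0 mul0mx addr0. Qed.

Lemma emb_adj n p i (M : 'M_p) : (emb n i M)^t* = emb n i (M^t*).
Proof. by rewrite !embE hadjD hadjmx1 !hadjM hadjK hadjB hadjmx1 mulmxA. Qed.

Lemma emb_sub n p i (M N : 'M_p) :
  emb n i M - emb n i N = inj_mx n p i *m (M - N) *m (inj_mx n p i)^t*.
Proof.
rewrite !embE opprD addrACA subrr add0r -mulmxBl -mulmxBr.
by congr (_ *m _ *m _); rewrite opprB addrA subrK.
Qed.

Lemma embM n p i (M N : 'M_p) : (i + p <= n)%N ->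
  emb n i M *m emb n i N = emb n i (M *m N).
Proof.
move=> h; rewrite !embE mulmxDl mul1mx mulmxDr mulmx1.
rewrite !mulmxA -[_ *m _^t* *m inj_mx _ _ _]mulmxA inj_isom // mulmx1.
rewrite -!addrA; congr (_ + _); rewrite addrA -!mulmxDl; congr (_ *m _).
rewrite -!mulmxA -!mulmxDr; congr (_ *m _).
rewrite mulmxBl mulmxBr !mulmx1 mul1mx.
by apply/matrixP => r s; rewrite !mxE; ring.
Qed.

Lemma emb_fnorm n p i (M N : 'M_p) : (i + p <= n)%N ->
  fnorm (emb n i M - emb n i N) = fnorm (M - N).
Proof.
by move=> h; rewrite emb_sub fnorm_isor ?hadjK ?fnorm_isol // inj_isom.
Qed.

Lemma emb_unitary n p i (M : 'M_p) : (i + p <= n)%N ->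
  M \is unitarymx -> emb n i M \is unitarymx.
Proof.
move=> h hM; apply/unitarymxP; rewrite emb_adj embM // mulUhadj // emb1 //.
Qed.

Lemma emb_emb n m p i a (M : 'M_p) : (a + p <= m)%N ->
  emb n i (emb m a M) = emb n (i + a) M.
Proof.
move=> h; rewrite !embE [_ - 1%:M]addrC addKr -(inj_comp n i h) hadjM.
by rewrite !mulmxA.
Qed.

Lemma emb_comm n p q i j (M : 'M_p) (N : 'M_q) :
  (i + p <= j)%N || (j + q <= i)%N ->
  emb n i M *m emb n j N = emb n j N *m emb n i M.
Proof.
move=> h; rewrite !embE; move: (M - 1%:M) (N - 1%:M) => D E.
rewrite !(mulmxDl, mulmxDr, mul1mx, mulmx1).
have h' : (j + q <= i)%N || (i + p <= j)%N by rewrite orbC.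
have z1 := inj_disjoint n h; have z2 := inj_disjoint n h'.
rewrite !mulmxA.
rewrite -[_ *m (inj_mx _ _ i)^t* *m _]mulmxA z1 mulmx0 !mul0mx.
rewrite -[_ *m (inj_mx _ _ j)^t* *m _]mulmxA z2 mulmx0 !mul0mx !addr0.
by rewrite addrAC.
Qed.

Lemma coremxE n i (G : 'M[C]_2) : (i.+1 < n)%N -> coremx n i G = emb n i G.
Proof.
move=> h; apply/matrixP => r s.
have i0 : inord 0 = ord0 :> 'I_2 by apply/val_inj; rewrite /= inordK.
have i1 : inord 1 = lift ord0 ord0 :> 'I_2 by apply/val_inj; rewrite /= inordK.
have e1 : (i.+1 - i = 1)%N by rewrite subSnn.
have n1 j : (j == j.+1) = false by lia.
rewrite embE !mxE !big_ord_recl !big_ord0 !mxE !big_ord_recl !big_ord0 !mxE /=.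
rewrite /bump /= ?(addn0, addn1, add1n).
have cc (b : bool) : Num.conj (b%:R : C) = b%:R by rewrite conjC_nat.
rewrite !cc -!val_eqE /=.
(* Nine cases, by whether each index is [i], [i.+1] or neither. *)
have [hr0|hr0] := eqVneq (r : nat) i; [|have [hr1|hr1] := eqVneq (r : nat) i.+1];
  (have [hs0|hs0] := eqVneq (s : nat) i; [|have [hs1|hs1] := eqVneq (s : nat) i.+1]);
  rewrite ?hr0 ?hr1 ?hs0 ?hs1 ?leqnn ?leqnSn ?ltnn ?subnn ?e1 ?i0 ?i1 ?eqxx ?n1 ?[i.+1 == i]eq_sym ?n1 /=;
  rewrite ?(mul0r, mul1r, mulr0, mulr1, addr0, add0r, subr0); try ring.
all: rewrite ?[_ == i]eq_sym ?[_ == i.+1]eq_sym.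
all: by case: ifP => // hh; exfalso; move: hh; rewrite ?andbT; lia.
Qed.

Lemma coremxM n i (G H : 'M[C]_2) : (i.+1 < n)%N ->
  coremx n i G *m coremx n i H = coremx n i (G *m H).
Proof. by move=> h; rewrite !coremxE // embM //; lia. Qed.

Lemma coremx_adj n i (G : 'M[C]_2) : (i.+1 < n)%N ->
  (coremx n i G)^t* = coremx n i (G^t*).
Proof. by move=> h; rewrite !coremxE // emb_adj. Qed.

Lemma coremx_unitary n i (G : 'M[C]_2) : (i.+1 < n)%N ->
  G \is unitarymx -> coremx n i G \is unitarymx.
Proof. by move=> h hG; rewrite coremxE // emb_unitary //; lia. Qed.

Lemma coremx_fnorm n i (G H : 'M[C]_2) : (i.+1 < n)%N ->
  fnorm (coremx n i G - coremx n i H) = fnorm (G - H).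
Proof. by move=> h; rewrite !coremxE // emb_fnorm //; lia. Qed.

Lemma coremx1 n i : (i.+1 < n)%N -> coremx n i (1%:M : 'M[C]_2) = 1%:M.
Proof. by move=> h; rewrite coremxE // emb1. Qed.

Lemma coremx_comm n i j (G H : 'M[C]_2) : (i.+1 < n)%N -> (j.+1 < n)%N ->
  (i.+1 < j)%N || (j.+1 < i)%N ->
  coremx n i G *m coremx n j H = coremx n j H *m coremx n i G.
Proof.
move=> hi hj h; rewrite (coremxE _ hi) (coremxE _ hj).
by apply: emb_comm; rewrite !addn2.
Qed.

Lemma emb_coremx3 n i a (G : 'M[C]_2) : (a < 2)%N -> (i.+2 < n)%N ->
  emb n i (coremx 3 a G) = coremx n (i + a) G.
Proof.
by move=> ha h; rewrite [X in emb _ _ X]coremxE ?emb_emb ?coremxE //; lia.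
Qed.

Lemma emb_coremx3M n i a b (F G H : 'M[C]_2) :
  (a < 2)%N -> (b < 2)%N -> (i.+2 < n)%N ->
  emb n i (coremx 3 a F *m coremx 3 b G *m coremx 3 a H)
  = coremx n (i + a) F *m coremx n (i + b) G *m coremx n (i + a) H.
Proof.
move=> ha hb h; have h3 : (i + 3 <= n)%N by rewrite addn3.
rewrite -(embM _ _ h3) -(embM _ _ h3).
by rewrite (emb_coremx3 F ha h) (emb_coremx3 G hb h) (emb_coremx3 H ha h).
Qed.

(** Transfers the error bound of a turnover, stated on 3 by 3 matrices, to the full size with the
    same value. *)
Lemma coremx3_fnorm n i a b (F G H F' G' H' : 'M[C]_2) :
  (a < 2)%N -> (b < 2)%N -> (i.+2 < n)%N ->
  fnorm (coremx n (i + b) F' *m coremx n (i + a) G' *m coremx n (i + b) H'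
         - coremx n (i + a) F *m coremx n (i + b) G *m coremx n (i + a) H)
  = fnorm (coremx 3 b F' *m coremx 3 a G' *m coremx 3 b H'
             - coremx 3 a F *m coremx 3 b G *m coremx 3 a H).
Proof.
move=> ha hb h; have h3 : (i + 3 <= n)%N by rewrite addn3.
rewrite -(emb_fnorm _ _ h3).
by rewrite (emb_coremx3M F' G' H' hb ha h) (emb_coremx3M F G H ha hb h).
Qed.

(** Action of an n by n transformation on the n + 1 rows of a stored factor: it slips through [Pi]
    on both sides and fixes the last coordinate, from which [y] is recovered. *)
Definition lift_mx n (U : 'M[C]_n) : 'M[C]_n.+1 := emb n.+1 0 U.

Lemma lift_mxM n (U V : 'M[C]_n) : lift_mx (U *m V) = lift_mx U *m lift_mx V.
Proof. by rewrite /lift_mx embM. Qed.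

Lemma lift_mx_adj n (U : 'M[C]_n) : (lift_mx U)^t* = lift_mx (U^t*).
Proof. exact: emb_adj. Qed.

Lemma lift_mx_unitary n (U : 'M[C]_n) : U \is unitarymx -> lift_mx U \is unitarymx.
Proof. by move=> h; apply: emb_unitary. Qed.

Lemma lift_coremx n i (G : 'M[C]_2) : (i.+1 < n)%N ->
  lift_mx (coremx n i G) = coremx n.+1 i G.
Proof. move=> h; rewrite /lift_mx coremxE // emb_emb ?coremxE //; lia. Qed.

Lemma pid_mx_inj n : (pid_mx n : 'M[C]_(n.+1, n)) = inj_mx n.+1 n 0.
Proof.
apply/matrixP => r s; rewrite !mxE add0n; congr (_ %:R).
by have := ltn_ord s; case: eqP => //= ->  ->.
Qed.

Lemma pid_lift_mx n (U : 'M[C]_n) :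
  (pid_mx n : 'M[C]_(n.+1, n))^T *m lift_mx U = U *m (pid_mx n)^T.
Proof.
rewrite pid_mx_inj -inj_adjE /lift_mx embE mulmxDr mulmx1 !mulmxA inj_isom //.
by rewrite mul1mx mulmxBl mul1mx addrC subrK.
Qed.

Lemma lift_mx_pid n (U : 'M[C]_n) :
  lift_mx U *m (pid_mx n : 'M[C]_(n.+1, n)) = pid_mx n *m U.
Proof.
rewrite pid_mx_inj /lift_mx embE mulmxDl mul1mx -!mulmxA inj_isom //.
by rewrite mulmx1 mulmxBr mulmx1 addrC subrK.
Qed.

Lemma lift_mx_last n (U : 'M[C]_n) :
  delta_mx (ord0 : 'I_1) ord_max *m lift_mx U = delta_mx ord0 ord_max.
Proof.
rewrite /lift_mx embE mulmxDr mulmx1 !mulmxA.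
suff -> : delta_mx (ord0 : 'I_1) ord_max *m inj_mx n.+1 n 0 = 0.
  by rewrite !mul0mx addr0.
rewrite -rowE; apply/matrixP => i j; rewrite !mxE add0n.
by rewrite eqn_leq /= leqNgt ltn_ord.
Qed.

Lemma coremx_first n i (G : 'M[C]_2) : (i.+2 < n.+1)%N ->
  coremx n.+1 i.+1 G *m delta_mx ord0 (ord0 : 'I_1) = delta_mx ord0 ord0.
Proof.
move=> h; rewrite coremxE // embE mulmxDl mul1mx -!mulmxA.
suff -> : (inj_mx n.+1 2 i.+1)^t* *m delta_mx ord0 (ord0 : 'I_1) = 0.
  by rewrite !mulmx0 addr0.
rewrite -colE; apply/matrixP => r s.
by rewrite !mxE -[0 in RHS](@conjC_nat C 0); congr (Num.conj _).
Qed.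

Lemma prodmx_unitary n (I : Type) (r : seq I) (P : pred I) (F : I -> 'M[C]_n) :
  (forall i, P i -> F i \is unitarymx) -> \prod_(i <- r | P i) F i \is unitarymx.
Proof.
move=> h; elim/big_ind: _; [exact: unitarymx1| |exact: h].
by move=> x y hx hy; exact (mul_unitarymx hx hy).
Qed.

Definition unitary_cores n (A : cores R) := forall i, (i < n)%N -> A i \is unitarymx.

Lemma core_prod_unitary n (A : cores R) :
  unitary_cores n A -> core_prod n A \is unitarymx.
Proof.
move=> h; apply: prodmx_unitary => i _.
by apply: coremx_unitary; [have := ltn_ord i; lia|exact: h].
Qed.

(** Telescoping: exchanging one factor at a time costs [e] each, as the unitary factors on either
    side preserve the norm. *)
Lemma fnorm_prodB n (F G : nat -> 'M[C]_n) (e : R) m :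
  (forall i, (i < m)%N -> [/\ F i \is unitarymx, G i \is unitarymx &
     fnorm (F i - G i) <= e]) ->
  fnorm (\prod_(i < m) F i - \prod_(i < m) G i) <= m%:R * e.
Proof.
elim: m => [|m IH] h; first by rewrite !big_ord0 subrr fnorm0 mul0r.
rewrite !big_ord_recr /=.
have hm i : (i < m)%N -> (i < m.+1)%N by lia.
have [hF hG he] := h m (ltnSn m).
apply: le_trans (fnorm_triangle _ ((\prod_(i < m) G i) *m F m) _) _.
rewrite -[_ * F m]/(_ *m F m) -[_ * G m]/(_ *m G m) -mulmxBl -mulmxBr.
rewrite fnormMU // fnormUM; last first.
  by apply: prodmx_unitary => i _; case: (h i (hm _ (ltn_ord i))).
rewrite -addn1 natrD mulrDl mul1r; apply: lerD => //; apply: IH => i hi.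
by apply: h; apply: hm.
Qed.

Lemma core_prod_fnorm n (A B : cores R) (e : R) :
  unitary_cores n A -> unitary_cores n B ->
  (forall i, (i < n)%N -> fnorm (A i - B i) <= e) ->
  fnorm (core_prod n A - core_prod n B) <= n%:R * e.
Proof.
move=> hA hB h.
apply: (@fnorm_prodB n.+1 (fun i => coremx n.+1 i (A i)) (fun i => coremx n.+1 i (B i))).
move=> i hi; have hi' : (i.+1 < n.+1)%N by lia.
split; [exact: coremx_unitary (hA _ hi)|exact: coremx_unitary (hB _ hi)|].
by rewrite coremx_fnorm //; apply: h.
Qed.

Lemma core_prod_split n i (A : cores R) : (i.+1 < n)%N ->
  core_prod n A = (\prod_(0 <= l < i) coremx n.+1 l (A l))
    *m (coremx n.+1 i (A i) *m coremx n.+1 i.+1 (A i.+1))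
    *m (\prod_(i.+2 <= l < n) coremx n.+1 l (A l)).
Proof.
move=> h; rewrite /core_prod.
rewrite -(big_mkord xpredT (fun l => coremx n.+1 l (A l))).
rewrite (@big_cat_nat _ _ _ i) //=; last by lia.
rewrite (@big_ltn _ _ _ i) ?(@big_ltn _ _ _ i.+1); try lia.
by rewrite -[LHS]/(_ *m (_ *m (_ *m _))) !mulmxA.
Qed.

Lemma prodmx_comm n (I : eqType) (r : seq I) (F : I -> 'M[C]_n) (M : 'M[C]_n) :
  (forall i, i \in r -> F i *m M = M *m F i) ->
  (\prod_(i <- r) F i) *m M = M *m \prod_(i <- r) F i.
Proof.
move=> h; rewrite big_seq; elim/big_ind: _; [by rewrite mul1mx mulmx1| |exact: h].
by move=> x y hx hy; rewrite -[x * y]/(x *m y) -mulmxA hy mulmxA hx mulmxA.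
Qed.

(** [X], acting from row [i.+1] on, commutes with the cores before index [i], and [G] with those
    from [i.+2] on; so a bound on the two middle cores is a bound on the whole product. *)
Lemma core_prod_update n i (A A' : cores R) (X G : 'M[C]_2) (e : R) :
  (i.+1 < n)%N -> unitary_cores n A -> same_cores_off i A A' ->
  fnorm (coremx n.+1 i (A' i) *m coremx n.+1 i.+1 (A' i.+1)
    - coremx n.+1 i.+1 X *m (coremx n.+1 i (A i) *m coremx n.+1 i.+1 (A i.+1))
      *m coremx n.+1 i G) <= e ->
  fnorm (core_prod n A' - coremx n.+1 i.+1 X *m core_prod n A *m coremx n.+1 i G) <= e.
Proof.
move=> h hA hAA'; rewrite (@core_prod_split n i A h) (@core_prod_split n i A' h).
have -> : \prod_(0 <= l < i) coremx n.+1 l (A' l) = \prod_(0 <= l < i) coremx n.+1 l (A l).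
  by apply: eq_big_nat => l hl; rewrite hAA' //; lia.
have -> : \prod_(i.+2 <= l < n) coremx n.+1 l (A' l) = \prod_(i.+2 <= l < n) coremx n.+1 l (A l).
  by apply: eq_big_nat => l hl; rewrite hAA' //; lia.
set P := \prod_(0 <= l < i) _; set Q := \prod_(_ <= _ < n) _.
have hP : P \is unitarymx.
  rewrite /P big_nat_cond; apply: prodmx_unitary => l hl; apply: coremx_unitary; first lia.
  by apply: hA; lia.
have hQ : Q \is unitarymx.
  rewrite /Q big_nat_cond; apply: prodmx_unitary => l hl; apply: coremx_unitary; first lia.
  by apply: hA; lia.
have hXP : coremx n.+1 i.+1 X *m P = P *m coremx n.+1 i.+1 X.
  apply/esym/prodmx_comm => l; rewrite mem_index_iota => hl.
  by apply: coremx_comm; lia.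
have hQG : Q *m coremx n.+1 i G = coremx n.+1 i G *m Q.
  apply: prodmx_comm => l; rewrite mem_index_iota => hl.
  by apply: coremx_comm; lia.
have -> : coremx n.+1 i.+1 X *m (P *m (coremx n.+1 i (A i) *m coremx n.+1 i.+1 (A i.+1)) *m Q)
   *m coremx n.+1 i G = P *m (coremx n.+1 i.+1 X *m (coremx n.+1 i (A i) *m coremx n.+1 i.+1 (A i.+1))
      *m coremx n.+1 i G) *m Q.
  by rewrite !mulmxA hXP -(mulmxA _ Q) hQG !mulmxA.
by rewrite -mulmxBl -mulmxBr (fnormMU _ hQ) (fnormUM _ hP).
Qed.

(** The turnover of [A_i A_(i+1) G_i] into [X_(i+1) A'_i A'_(i+1)] read as a change of frames: [X]
    is carried to the other side by its adjoint. *)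
Lemma pass_cores n eps i (A A' : cores R) (X G : 'M[C]_2) :
  (i.+1 < n)%N -> unitary_cores n A -> same_cores_off i A A' ->
  X \is unitarymx -> G \is unitarymx ->
  fnorm (coremx 3 1 X *m coremx 3 0 (A' i) *m coremx 3 1 (A' i.+1)
     - coremx 3 0 (A i) *m coremx 3 1 (A i.+1) *m coremx 3 0 G) <= eps ->
  fnorm (core_prod n A' - (coremx n.+1 i.+1 X)^t* *m core_prod n A
           *m coremx n.+1 i G) <= eps.
Proof.
move=> h hA hAA' hX hG he; have h' : (i.+2 < n.+1)%N by lia.
have hX' := coremx_unitary h' hX.
rewrite (coremx_adj _ h'); apply: (core_prod_update h hA hAA').
rewrite -(fnormUM _ hX') mulmxBr !mulmxA (coremxM _ _ h') (mulUhadj hX) (coremx1 h') mul1mx.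
move: he; rewrite -(@coremx3_fnorm n.+1 i 0 1 _ _ _ _ _ _ isT isT h').
by rewrite addn0 addn1.
Qed.
End Embedding.

(** * Following a triangular factor through the chase *)

Section Tracking.
Variable R : rcfType.
Local Notation C := (R[i]).

(* [tri_mx] for arbitrary [P], [Q], [e], [f] in place of [Pi^T], [Pi], [e_1],
   [e_(n+1)^T], with [A] standing for [C^*]. *)
Definition recovered_form n N (P : 'M[C]_(n, N)) (Q : 'M[C]_(N, n)) (e : 'cV[C]_N) (f : 'rV[C]_N)
    (A B : 'M[C]_N) : 'M[C]_n :=
  P *m (A *m (B + e *m (- ((f *m A *m e) ord0 ord0)^-1 *: (f *m (A *m B))))) *m Q.

(** [X] and [Y] cancel between [A] and [B], while [X e = e] and [f L = f] preserve the scalar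
    [f A e]. So the recovered row only picks up [M], and [L], [M] leave through [P], [Q] as [L0],
    [M0]. *)
Lemma recovered_form_equiv n N (P : 'M[C]_(n, N)) Q e f (A B X Y L M : 'M[C]_N) (L0 M0 : 'M[C]_n) :
  X *m Y = 1%:M -> X *m e = e -> f *m L = f ->
  P *m L = L0 *m P -> M *m Q = Q *m M0 ->
  recovered_form P Q e f (L *m (A *m X)) (Y *m B *m M) = L0 *m recovered_form P Q e f A B *m M0.
Proof.
move=> XY Xe fL PL MQ.
have e1 : L *m (A *m X) *m (Y *m B *m M) = L *m (A *m B) *m M.
  by rewrite -!mulmxA (mulmxA X) XY mul1mx.
have e2 : L *m (A *m X) *m e = L *m (A *m e) by rewrite -!mulmxA Xe.
have e3 : f *m (L *m (A *m X) *m (Y *m B *m M)) = f *m (A *m B) *m M.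
  by rewrite e1 !mulmxA fL.
have e4 : f *m (L *m (A *m X)) *m e = f *m A *m e.
  by rewrite -mulmxA e2 !mulmxA fL.
rewrite /recovered_form e3 e4; set c := - _^-1; set y := f *m (A *m B).
have -> : L *m (A *m X) *m (Y *m B *m M + e *m (c *: (y *m M)))
    = L *m (A *m (B + e *m (c *: y))) *m M.
  rewrite [LHS]mulmxDr e1 (mulmxA (L *m (A *m X)) e) e2 [A *m (_ + _)]mulmxDr.
  rewrite [L *m (_ + _)]mulmxDr [RHS]mulmxDl; congr (_ + _).
  by rewrite scalemxAl !mulmxA.
by rewrite !mulmxA PL -!mulmxA MQ.
Qed.

Definition recovered_mx n (A B : 'M[C]_n.+1) : 'M[C]_n :=
  recovered_form (pid_mx n)^T (pid_mx n) (delta_mx ord0 ord0) (delta_mx ord0 ord_max) (A^t*) B.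

Lemma mx_entryE m n (M : 'M[C]_(m, n)) i j :
  M i j = (delta_mx (ord0 : 'I_1) i *m M *m delta_mx j (ord0 : 'I_1)) ord0 ord0.
Proof. by rewrite -rowE -colE !mxE. Qed.

Lemma tri_mxE n (A B : cores R) : tri_mx n A B = recovered_mx (core_prod n A) (core_prod n B).
Proof. by rewrite /tri_mx /recovered_y /recovered_mx /recovered_form rowE [in LHS]mx_entryE. Qed.

(* Such an [X] leaves the rank-one part [e_1 y^T] of a stored factor alone. *)
Definition fixes_first n (X : 'M[C]_n.+1) :=
  X *m delta_mx ord0 (ord0 : 'I_1) = delta_mx ord0 ord0.

(** The covariance behind the tracking: frames on the stored products become a unitary equivalence
    of the triangular factor. *)
Lemma recovered_mx_equiv n (U V : 'M[C]_n) (X A B : 'M[C]_n.+1) :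
  X \is unitarymx -> fixes_first X ->
  recovered_mx (X^t* *m A *m lift_mx U) (X^t* *m B *m lift_mx V) = U^t* *m recovered_mx A B *m V.
Proof.
move=> hX fX; rewrite /recovered_mx !hadjM hadjK lift_mx_adj; apply: recovered_form_equiv.
- exact: mulUhadj.
- exact: fX.
- exact: lift_mx_last.
- exact: pid_lift_mx.
- exact: lift_mx_pid.
Qed.

Definition wf_factor n (f : factor R) : Prop :=
  match f with
  | Core i G => (i.+1 < n)%N /\ G \is unitarymx
  | Tri A B => unitary_cores n A /\ unitary_cores n B
  end.

Fixpoint wf_word n (w : word R) : Prop :=
  if w is f :: w' then wf_factor n f /\ wf_word n w' else True.

Lemma wf_cat n l r : wf_word n (l ++ r) <-> wf_word n l /\ wf_word n r.
Proof. by elim: l => [|f l IH] /=; [tauto|rewrite IH; tauto]. Qed.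

Lemma wf_cores n (gs : seq (nat * 'M[C]_2)) :
  all (fun g => (g.1.+1 < n)%N && (g.2 \is unitarymx)) gs ->
  wf_word n [seq Core g.1 g.2 | g <- gs].
Proof. by elim: gs => //= g gs IH /andP[/andP[h1 h2]] /IH. Qed.

(* [ref] lists the original pairs (C0, B0), each with the product of the cores
   that originally followed it; [W] is the product of the cores that originally
   preceded them.  A current factor (A1, B1) is C0, B0 seen through frames
   [X^* _ U] and [X^* _ V]; the frame [V] enters the next group of cores, which
   is accumulated in [A] until it can be compared with [W] times the next [U]. *)
Fixpoint track n (e : R) (A : 'M[C]_n) (w : word R) (W : 'M[C]_n)
    (ref : seq ('M[C]_n.+1 * 'M[C]_n.+1 * 'M[C]_n)) (Z : 'M[C]_n) : Prop :=
  match w with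
  | [::] => ref = [::] /\ fnorm (A - W *m Z) <= e
  | Core i G :: w' => track e (A *m coremx n i G) w' W ref Z
  | Tri A1 B1 :: w' =>
      if ref is (A0, B0, W') :: ref' then
        exists U V X,
          [/\ U \is unitarymx, V \is unitarymx, X \is unitarymx & fixes_first X] /\
          [/\ fnorm (A - W *m U) <= e,
              fnorm (core_prod n A1 - X^t* *m A0 *m lift_mx U) <= e,
              fnorm (core_prod n B1 - X^t* *m B0 *m lift_mx V) <= e
            & track e V w' W' ref' Z]
      else False
  end.

Lemma track_le n e e' (A : 'M_n) w W ref Z : e <= e' ->
  track e A w W ref Z -> track e' A w W ref Z.
Proof.
move=> he; elim: w A W ref => [|[i G|A1 B1] w IH] A W ref /=.
- by case=> -> h; split => //; exact: le_trans he.
- exact: IH.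
case: ref => // [[[A0 B0] W'] ref] [U [V [X [hU [h1 h2 h3 h4]]]]].
exists U, V, X; split=> //; split; try exact: le_trans he.
exact: IH.
Qed.

(** Cores carry an error in the accumulated group isometrically to the next stored factor, where the
    frame [V] starts a new group; so it enters one comparison only. *)
Lemma track_shift n e d (A A' : 'M_n) w W ref Z : 0 <= d -> wf_word n w ->
  fnorm (A - A') <= d -> track e A w W ref Z -> track (e + d) A' w W ref Z.
Proof.
move=> d0.
have tri (X Y D : 'M[C]_n) : fnorm (X - Y) <= d -> fnorm (X - D) <= e -> fnorm (Y - D) <= e + d.
  move=> h1 h2; apply: le_trans (fnorm_triangle _ X _) _.
  by rewrite fnormC addrC; exact: lerD.
have ee : e <= e + d by rewrite lerDl.
elim: w A A' W ref => [|[i G|A1 B1] w IH] A A' W ref /=.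
- by move=> _ h [-> h2]; split => //; exact: tri h h2.
- move=> [[hi hG] hw] h; apply: IH => //.
  by rewrite -mulmxBl fnormMU //; exact: coremx_unitary.
case: ref => // [[[A0 B0] W'] ref] [_ hw] h [U [V [X [hU [h1 h2 h3 h4]]]]].
exists U, V, X; split=> //; split; try exact: le_trans ee.
  exact: tri h h1.
exact: track_le ee h4.
Qed.

(** Localises a rewriting step: reading the prefix [l] leaves some unitary accumulator with some [W]
    and [ref], and the step is checked from there. *)
Lemma track_context n e e' (A : 'M_n) l w w' W ref Z : e <= e' -> wf_word n l ->
  A \is unitarymx ->
  (forall A W ref, A \is unitarymx -> track e A w W ref Z -> track e' A w' W ref Z) ->
  track e A (l ++ w) W ref Z -> track e' A (l ++ w') W ref Z.
Proof.
move=> ee hl hA h; elim: l A W ref hA hl => [|[i G|A1 B1] l IH] A W ref hA /=.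
- by move=> _; exact: h.
- move=> [[hi hG] hl]; exact (IH _ _ _ (mul_unitarymx hA (coremx_unitary hi hG)) hl).
move=> [_ hl]; case: ref => // [[[A0 B0] W'] ref] [U [V [X [hU [h1 h2 h3 h4]]]]].
exists U, V, X; split=> //; split; try exact: le_trans ee.
case: hU => _ hV _ _; exact (IH _ _ _ hV hl h4).
Qed.

Lemma unitarymx_adj n (U : 'M[C]_n) : U \is unitarymx -> U^t* \is unitarymx.
Proof. by rewrite trmxC_unitary. Qed.

Lemma approx_compose n e eps (Y0 Y1 Y2 L L' : 'M[C]_n) (P Q : 'M[C]_n) :
  L' \is unitarymx -> Q \is unitarymx ->
  fnorm (Y1 - L *m Y0 *m P) <= e ->
  fnorm (Y2 - L' *m Y1 *m Q) <= eps ->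
  fnorm (Y2 - L' *m L *m Y0 *m (P *m Q)) <= e + eps.
Proof.
move=> hL hQ h1 h2; apply: le_trans (fnorm_triangle _ (L' *m Y1 *m Q) _) _.
rewrite addrC; apply: lerD => //.
have -> : L' *m L *m Y0 *m (P *m Q) = L' *m (L *m Y0 *m P) *m Q by rewrite !mulmxA.
by rewrite -mulmxBl -mulmxBr fnormMU // fnormUM.
Qed.

Lemma unitary_cores_off n i (A A' : cores R) :
  unitary_cores n A -> same_cores_off i A A' ->
  A' i \is unitarymx -> A' i.+1 \is unitarymx -> unitary_cores n A'.
Proof.
move=> h s h1 h2 j hj.
have [->//|n1] := eqVneq j i; have [->//|n2] := eqVneq j i.+1.
rewrite (s j n1 n2); exact (h j hj).
Qed.

(** The pass-throughs state some turnovers on adjoint cores or with the new core on the other side.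
    This lemma and the next two bring them to the shape expected by [pass_cores], by taking adjoints
    and by moving unitary factors across the difference. *)
Lemma fnorm_adj6 n (X G Y Y' Z Z' Xa Ga Ya Ya' Za Za' : 'M[C]_n) :
  X^t* = Xa -> G^t* = Ga -> Y^t* = Ya -> Y'^t* = Ya' -> Z^t* = Za -> Z'^t* = Za' ->
  fnorm (Xa *m Y *m Y' - Z *m Z' *m Ga) = fnorm (Ya' *m Ya *m X - G *m Za' *m Za).
Proof.
move=> <- <- <- <- <- <-.
rewrite -[LHS]fnorm_adj hadjB (hadjM (_ *m Y)) (hadjM _ Y) (hadjM (Z *m Z')) (hadjM Z).
by rewrite (hadjK X) (hadjK G) mulmxA (mulmxA G).
Qed.

Lemma fnorm_swap n (X G Y Y' Z Z' Xa Ga : 'M[C]_n) : X \is unitarymx -> G \is unitarymx ->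
  X^t* = Xa -> G^t* = Ga ->
  fnorm (Xa *m Y *m Y' - Z *m Z' *m Ga) = fnorm (Y *m Y' *m G - X *m Z *m Z').
Proof.
move=> hX hG <- <-; rewrite -(fnormUM _ hX) -(fnormMU _ hG).
rewrite mulmxBr mulmxBl !mulmxA (mulUhadj hX) mul1mx.
by rewrite -[_ *m G^t* *m _]mulmxA (mulhadjU hG) mulmx1.
Qed.

Lemma fnorm_swap_adj n (X G Y Y' Z Z' Ya Ya' Za Za' : 'M[C]_n) :
  X \is unitarymx -> G \is unitarymx ->
  Y^t* = Ya -> Y'^t* = Ya' -> Z^t* = Za -> Z'^t* = Za' ->
  fnorm (X *m Y *m Y' - Z *m Z' *m G) = fnorm (G *m Ya' *m Ya - Za' *m Za *m X).
Proof.
move=> hX hG hY hY' hZ hZ'.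
rewrite (fnorm_swap Y Y' Z Z' (unitarymx_adj hX) (unitarymx_adj hG) (hadjK X) (hadjK G)).
rewrite -(fnorm_adj6 (hadjK G) (hadjK X) (hadjK Y') (hadjK Y) (hadjK Z') (hadjK Z)).
by rewrite hY hY' hZ hZ'.
Qed.

(** The core [X] that leaves [B] on the left is the one that enters [C^*] on the right, so both
    products change by the same [X^*]. On the right, [G] goes to [B] and [G'] to [C]. *)
Lemma pass_rl_spec n eps i (A1 B1 A2 B2 : cores R) (G G' : 'M[C]_2) :
  (i.+1 < n)%N -> unitary_cores n A1 -> unitary_cores n B1 -> G \is unitarymx ->
  pass_rl eps i A1 B1 G G' A2 B2 ->
  [/\ unitary_cores n A2, unitary_cores n B2, G' \is unitarymx &
   exists X, [/\ X \is unitarymx, fixes_first X,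
     fnorm (core_prod n A2 - X^t* *m core_prod n A1 *m coremx n.+1 i G') <= eps &
     fnorm (core_prod n B2 - X^t* *m core_prod n B1 *m coremx n.+1 i G) <= eps]].
Proof.
have c0 (K : 'M[C]_2) := coremx_adj K (isT : (0.+1 < 3)%N).
have c1 (K : 'M[C]_2) := coremx_adj K (isT : (1.+1 < 3)%N).
have u0 (K : 'M[C]_2) := @coremx_unitary _ _ _ K (isT : (0.+1 < 3)%N).
have u1 (K : 'M[C]_2) := @coremx_unitary _ _ _ K (isT : (1.+1 < 3)%N).
move=> hi hA hB hG [X [[hX b0 b1 tb] [hG' a1 a0 ta] sA sB]].
move: a0 a1; rewrite !trmxC_unitary => a0 a1.
split; [exact: unitary_cores_off hA sA a0 a1|exact: unitary_cores_off hB sB b0 b1|exact hG'|].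
exists (coremx n.+1 i.+1 X); split.
- exact (coremx_unitary (hi : (i.+2 < n.+1)%N) hX).
- exact: coremx_first.
- apply: (pass_cores hi hA sA hX hG').
  by rewrite (fnorm_swap_adj (u1 _ hX) (u0 _ hG') (c0 (A2 i)) (c1 (A2 i.+1)) (c0 (A1 i)) (c1 (A1 i.+1))).
- exact: (pass_cores hi hB sB hX hG tb).
Qed.

(** Solving [C'^* X = G C^*] for [C'] and [B' G' = X B] for [B'] gives [X C G^*] and [X B G'^*]; the
    frame is thus the adjoint of the exchanged core. *)
Lemma pass_lr_spec n eps i (A1 B1 A2 B2 : cores R) (G G' : 'M[C]_2) :
  (i.+1 < n)%N -> unitary_cores n A1 -> unitary_cores n B1 -> G \is unitarymx ->
  pass_lr eps i G A1 B1 A2 B2 G' ->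
  [/\ unitary_cores n A2, unitary_cores n B2, G' \is unitarymx &
   exists X, [/\ X \is unitarymx, fixes_first X,
     fnorm (core_prod n A2 - X^t* *m core_prod n A1 *m (coremx n.+1 i G)^t*) <= eps &
     fnorm (core_prod n B2 - X^t* *m core_prod n B1 *m (coremx n.+1 i G')^t*) <= eps]].
Proof.
have c0 (K : 'M[C]_2) := coremx_adj K (isT : (0.+1 < 3)%N).
have c1 (K : 'M[C]_2) := coremx_adj K (isT : (1.+1 < 3)%N).
have u0 (K : 'M[C]_2) := @coremx_unitary _ _ _ K (isT : (0.+1 < 3)%N).
have u1 (K : 'M[C]_2) := @coremx_unitary _ _ _ K (isT : (1.+1 < 3)%N).
move=> hi hA hB hG [X [[a1 a0 hX ta] [b0 b1 hG' tb] sA sB]].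
have hi1 : (i.+1 < n.+1)%N := ltnW hi.
have hi2 : (i.+2 < n.+1)%N := hi.
have hXa := unitarymx_adj hX; have hG'a := unitarymx_adj hG'; have hGa := unitarymx_adj hG.
move: a0 a1; rewrite !trmxC_unitary => a0 a1.
split; [exact: unitary_cores_off hA sA a0 a1|exact: unitary_cores_off hB sB b0 b1|exact hG'|].
exists (coremx n.+1 i.+1 (X^t*)); split.
- exact (coremx_unitary hi2 hXa).
- exact: coremx_first.
- rewrite (coremx_adj G hi1); apply: (pass_cores hi hA sA hXa hGa).
  by rewrite (fnorm_adj6 (c1 X) (c0 G) (c0 (A2 i)) (c1 (A2 i.+1)) (c0 (A1 i)) (c1 (A1 i.+1))).
- rewrite (coremx_adj G' hi1); apply: (pass_cores hi hB sB hXa hG'a).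
  by rewrite (fnorm_swap _ _ _ _ (u1 _ hX) (u0 _ hG') (c1 X) (c0 G')).
Qed.
End Tracking.

(** * Tracking through single steps and transfers *)

Section Steps.
Variable R : rcfType.
Local Notation C := (R[i]).

Lemma fnorm_diffUl n (A M N : 'M[C]_n) (d : R) : A \is unitarymx ->
  fnorm (M - N) <= d -> fnorm (A *m N - A *m M) <= d.
Proof. by move=> hA h; rewrite -mulmxBr (fnormUM _ hA) fnormC. Qed.

Lemma track_pass_rl n e eps (A : 'M[C]_n) i (A1 B1 A2 B2 : cores R) (G G' : 'M[C]_2) r W ref Z :
  (i.+1 < n)%N -> 0 <= eps -> unitary_cores n A1 -> unitary_cores n B1 -> G \is unitarymx ->
  pass_rl eps i A1 B1 G G' A2 B2 ->
  track e A (Tri A1 B1 :: Core i G :: r) W ref Z ->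
  track (e + eps) A (Core i G' :: Tri A2 B2 :: r) W ref Z.
Proof.
move=> hi eps0 hA hB hG hp /=; case: ref => // [[[A0 B0] W'] ref].
have [hA2 hB2 hG' [X [hX fX hAX hBX]]] := pass_rl_spec hi hA hB hG hp.
move=> [U [V [Y [[hU hV hY fY] [h1 h2 h3 h4]]]]].
have ci := coremx_unitary hi hG; have ci' := coremx_unitary hi hG'.
have li := coremx_unitary (ltnW hi : (i.+1 < n.+1)%N) hG.
have li' := coremx_unitary (ltnW hi : (i.+1 < n.+1)%N) hG'.
(* [G'] is appended both to the group before the factor and to [U], and [G] passes from the
   following group into [V]; so the comparisons with both neighbouring groups are unchanged. *)
exists (U *m coremx n i G'), (V *m coremx n i G), (Y *m X); split.
  split; [exact (mul_unitarymx hU ci')|exact (mul_unitarymx hV ci)|exact (mul_unitarymx hY hX)|].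
  by rewrite /fixes_first -mulmxA fX fY.
rewrite !lift_mxM !(lift_coremx _ hi) hadjM; split.
- rewrite mulmxA -mulmxBl (fnormMU _ ci'); apply: le_trans h1 _; by rewrite lerDl.
- exact (approx_compose (unitarymx_adj hX) li' h2 hAX).
- exact (approx_compose (unitarymx_adj hX) li h3 hBX).
- apply: track_le h4; by rewrite lerDl.
Qed.

Lemma track_pass_lr n e eps (A : 'M[C]_n) i (A1 B1 A2 B2 : cores R) (G G' : 'M[C]_2) r W ref Z :
  (i.+1 < n)%N -> 0 <= eps -> unitary_cores n A1 -> unitary_cores n B1 -> G \is unitarymx ->
  pass_lr eps i G A1 B1 A2 B2 G' ->
  track e A (Core i G :: Tri A1 B1 :: r) W ref Z ->
  track (e + eps) A (Tri A2 B2 :: Core i G' :: r) W ref Z.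
Proof.
move=> hi eps0 hA hB hG hp /=; case: ref => // [[[A0 B0] W'] ref].
have [hA2 hB2 hG' [X [hX fX hAX hBX]]] := pass_lr_spec hi hA hB hG hp.
move=> [U [V [Y [[hU hV hY fY] [h1 h2 h3 h4]]]]].
have ci := unitarymx_adj (coremx_unitary hi hG).
have ci' := unitarymx_adj (coremx_unitary hi hG').
have li := unitarymx_adj (coremx_unitary (ltnW hi : (i.+1 < n.+1)%N) hG).
have li' := unitarymx_adj (coremx_unitary (ltnW hi : (i.+1 < n.+1)%N) hG').
exists (U *m (coremx n i G)^t*), (V *m (coremx n i G')^t*), (Y *m X); split.
  split; [exact (mul_unitarymx hU ci)|exact (mul_unitarymx hV ci')|exact (mul_unitarymx hY hX)|].
  by rewrite /fixes_first -mulmxA fX fY.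
rewrite !lift_mxM -!lift_mx_adj !(lift_coremx _ hi) hadjM; split.
- rewrite -(fnormMU _ (coremx_unitary hi hG)) mulmxBl -!mulmxA.
  rewrite (mulhadjU (coremx_unitary hi hG)) mulmx1; apply: le_trans h1 _; by rewrite lerDl.
- exact (approx_compose (unitarymx_adj hX) li h2 hAX).
- exact (approx_compose (unitarymx_adj hX) li' h3 hBX).
- rewrite -mulmxA (mulhadjU (coremx_unitary hi hG')) mulmx1.
  apply: track_le h4; by rewrite lerDl.
Qed.

Lemma wf_replace n (l m m' r : word R) : (wf_word n m -> wf_word n m') ->
  wf_word n (l ++ m ++ r) -> wf_word n (l ++ m' ++ r).
Proof.
move=> h /wf_cat [hl /wf_cat [hm hr]].
apply/wf_cat; split; first exact hl.
apply/wf_cat; split; [exact (h hm)|exact hr].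
Qed.

Lemma word_step_wf n eps m (w w' : word R) : word_step n eps m w w' ->
  wf_word n w -> wf_word n w'.
Proof.
case=> {m w w'}.
- move=> l r i j F G _; apply: (@wf_replace n l [:: Core i F; Core j G] [:: Core j G; Core i F]).
  by case=> hF [hG t]; exact (conj hG (conj hF t)).
- move=> l r i hi; apply: (@wf_replace n l [::] [:: Core i 1%:M]) => _.
  exact (conj (conj hi (@unitarymx1 R 2)) I).
- move=> l r i; exact: (@wf_replace n l [:: Core i 1%:M] [::]).
- move=> l r i F G H [hH _]; apply: (@wf_replace n l [:: Core i F; Core i G] [:: Core i H]).
  by case=> -[hi _] _; exact (conj (conj hi hH) I).
- move=> l r i F G H F' G' H' [h1 h2 h3 _].
  apply: (@wf_replace n l [:: Core i F; Core i.+1 G; Core i H] [:: Core i.+1 F'; Core i G'; Core i.+1 H']).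
  by case=> -[hi _] [[hi2 _] _]; exact (conj (conj hi2 h1) (conj (conj hi h2) (conj (conj hi2 h3) I))).
- move=> l r i F G H F' G' H' [h1 h2 h3 _].
  apply: (@wf_replace n l [:: Core i.+1 F; Core i G; Core i.+1 H] [:: Core i F'; Core i.+1 G'; Core i H']).
  by case=> -[hi2 _] [[hi _] _]; exact (conj (conj hi h1) (conj (conj hi2 h2) (conj (conj hi h3) I))).
- move=> l r i A1 B1 G G' A2 B2 hp.
  apply: (@wf_replace n l [:: Tri A1 B1; Core i G] [:: Core i G'; Tri A2 B2]).
  case=> -[hA hB] [[hi hG] _]; have [hA2 hB2 hG' _] := pass_rl_spec hi hA hB hG hp.
  exact (conj (conj hi hG') (conj (conj hA2 hB2) I)).
- move=> l r i G A1 B1 A2 B2 G' hp.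
  apply: (@wf_replace n l [:: Core i G; Tri A1 B1] [:: Tri A2 B2; Core i G']).
  case=> -[hi hG] [[hA hB] _]; have [hA2 hB2 hG' _] := pass_lr_spec hi hA hB hG hp.
  exact (conj (conj hA2 hB2) (conj (conj hi hG') I)).
Qed.

Lemma word_step_track n eps m (w w' : word R) (A : 'M[C]_n) W ref Z e :
  word_step n eps m w w' -> 0 <= eps -> wf_word n w -> A \is unitarymx ->
  track e A w W ref Z -> track (e + m%:R * eps) A w' W ref Z.
Proof.
move=> st eps0 hw hA.
have ee (k : nat) : e <= e + k%:R * eps by rewrite lerDl mulr_ge0.
case: st hw => {m w w'}.
- move=> l r i j F G h /wf_cat [hl [[hi hF] [[hj hG] hr]]].
  apply: (track_context (ee 0%N) hl hA) => A' W' ref' hA' /= t.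
  rewrite mul0r addr0 -mulmxA (coremx_comm _ _ hj hi); last by rewrite orbC.
  by rewrite mulmxA.
- move=> l r i hi /wf_cat [hl hr].
  apply: (track_context (ee 0%N) hl hA) => A' W' ref' hA' /= t.
  by rewrite mul0r addr0 (coremx1 R hi) mulmx1.
- move=> l r i /wf_cat [hl [[hi _] hr]].
  apply: (track_context (ee 0%N) hl hA) => A' W' ref' hA' /=.
  by rewrite mul0r addr0 (coremx1 R hi) mulmx1.
- move=> l r i F G H [hH he] /wf_cat [hl [[hi hF] [[_ hG] hr]]].
  apply: (track_context (ee 1%N) hl hA) => A' W' ref' hA' /=.
  rewrite mul1r; apply: (track_shift eps0 hr).
  rewrite -mulmxA (coremxM _ _ hi); apply: (fnorm_diffUl hA').
  by rewrite (coremx_fnorm _ _ hi).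
- move=> l r i F G H F' G' H' [_ _ _ he] /wf_cat [hl [[hi hF] [[hi2 hG] [[_ hH] hr]]]].
  apply: (track_context (ee 1%N) hl hA) => A' W' ref' hA' /=.
  rewrite mul1r; apply: (track_shift eps0 hr).
  rewrite -2!mulmxA -(mulmxA A' (coremx n i.+1 F')) -(mulmxA A').
  apply: (fnorm_diffUl hA'); rewrite !mulmxA.
  by move: he; rewrite -(@coremx3_fnorm _ n i 0 1 _ _ _ _ _ _ isT isT hi2) addn0 addn1.
- move=> l r i F G H F' G' H' [_ _ _ he] /wf_cat [hl [[hi2 hF] [[hi hG] [[_ hH] hr]]]].
  apply: (track_context (ee 1%N) hl hA) => A' W' ref' hA' /=.
  rewrite mul1r; apply: (track_shift eps0 hr).
  rewrite -2!mulmxA -(mulmxA A' (coremx n i F')) -(mulmxA A').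
  apply: (fnorm_diffUl hA'); rewrite !mulmxA.
  by move: he; rewrite -(@coremx3_fnorm _ n i 1 0 _ _ _ _ _ _ isT isT hi2) addn0 addn1.
- move=> l r i A1 B1 G G' A2 B2 hp /wf_cat [hl [[hA1 hB1] [[hi hG] hr]]].
  apply: (track_context (ee 2%N) hl hA) => A' W' ref' hA' h.
  (* The two turnovers of a pass-through act on different products, one on [B] and one on [C], so
     [e] grows by [eps] only and the count 2 leaves slack. *)
  apply: (track_le _ (track_pass_rl hi eps0 hA1 hB1 hG hp h)).
  by rewrite lerD2l mulr_natl mulr2n lerDl.
- move=> l r i G A1 B1 A2 B2 G' hp /wf_cat [hl [[hi hG] [[hA1 hB1] hr]]].
  apply: (track_context (ee 2%N) hl hA) => A' W' ref' hA' h.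
  apply: (track_le _ (track_pass_lr hi eps0 hA1 hB1 hG hp h)).
  by rewrite lerD2l mulr_natl mulr2n lerDl.
Qed.

(** Only the final comparison sees the last core; multiplying by its adjoint moves it into the right
    frame. *)
Lemma track_cat_core n e (A : 'M[C]_n) w i (G : 'M[C]_2) W ref Z :
  (i.+1 < n)%N -> G \is unitarymx ->
  track e A (rcons w (Core i G)) W ref Z <-> track e A w W ref (Z *m (coremx n i G)^t*).
Proof.
move=> hi hG; have hc := coremx_unitary hi hG.
elim: w A W ref => [|[j H|A1 B1] w IH] A W ref /=.
- rewrite -(fnormMU (A - _) hc) mulmxBl mulmxA -(mulmxA (W *m Z)) (mulhadjU hc) mulmx1.
  by [].
- exact: IH.
case: ref => // [[[A0 B0] W'] ref].
by split=> -[U [V [X [hU [h1 h2 h3 /IH h4]]]]]; exists U, V, X.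
Qed.

(** Sharing [L] and [Z] between the two words makes the outcome an equivalence of the pencil rather
    than two unrelated factorizations. *)
Definition tracked n e (st : state R) (WS : 'M[C]_n) refS (WT : 'M[C]_n) refT :=
  [/\ wf_word n st.1, wf_word n st.2 & exists L Z : 'M[C]_n,
   [/\ L \is unitarymx, Z \is unitarymx, track e L st.1 WS refS Z
     & track e L st.2 WT refT Z]].

(** A core taken from the left of one word is multiplied into [L], and its adjoint on the other word
    cancels it there; on the right [Z] plays the part of [L]. *)
Lemma transfer_tracked n e (st st' : state R) (WS : 'M[C]_n) refS WT refT :
  transfer st st' -> tracked e st WS refS WT refT -> tracked e st' WS refS WT refT.
Proof.
have cG i (G : 'M[C]_2) (hi : (i.+1 < n)%N) (hG : G \is unitarymx) (L : 'M[C]_n) :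
    L *m coremx n i G *m coremx n i (G^t*) = L.
  by rewrite -(coremx_adj G hi) -mulmxA (mulUhadj (coremx_unitary hi hG)) mulmx1.
have cG' i (G : 'M[C]_2) (hi : (i.+1 < n)%N) (hG : G \is unitarymx) (L : 'M[C]_n) :
    L *m (coremx n i G)^t* *m (coremx n i (G^t*))^t* = L.
  rewrite -(coremx_adj G hi) hadjK -mulmxA (mulhadjU (coremx_unitary hi hG)).
  exact: mulmx1.
case=> {st st'} i G ws wt [].
- move=> [[hi hG] h1] h2 [L [Z [hL hZ t1 t2]]].
  split; [exact h1|exact (conj (conj hi (unitarymx_adj hG)) h2)|].
  exists (L *m coremx n i G), Z; split; [exact (mul_unitarymx hL (coremx_unitary hi hG))|exact hZ|exact t1|].
  by rewrite /= (cG _ _ hi hG).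
- move=> h1 [[hi hG] h2] [L [Z [hL hZ t1 t2]]].
  split; [exact (conj (conj hi (unitarymx_adj hG)) h1)|exact h2|].
  exists (L *m coremx n i G), Z; split; [exact (mul_unitarymx hL (coremx_unitary hi hG))|exact hZ| |exact t2].
  by rewrite /= (cG _ _ hi hG).
- move=> /= h1 h2 [L [Z [hL hZ t1 t2]]].
  move: (h1); rewrite -cats1 => /wf_cat [h1' [[hi hG] _]].
  have hGa := unitarymx_adj hG; have hc := unitarymx_adj (coremx_unitary hi hG).
  split; [exact h1'| |].
    by rewrite /= -cats1; apply/wf_cat; exact (conj h2 (conj (conj hi hGa) I)).
  exists L, (Z *m (coremx n i G)^t*); split; [exact hL|exact (mul_unitarymx hZ hc)| |].
    exact (iffLR (track_cat_core _ _ _ _ _ _ hi hG) t1).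
  by apply: (iffRL (track_cat_core _ _ _ _ _ _ hi hGa)); rewrite (cG' _ _ hi hG).
- move=> /= h1 h2 [L [Z [hL hZ t1 t2]]].
  move: (h2); rewrite -cats1 => /wf_cat [h2' [[hi hG] _]].
  have hGa := unitarymx_adj hG; have hc := unitarymx_adj (coremx_unitary hi hG).
  split; [ |exact h2'|].
    by rewrite /= -cats1; apply/wf_cat; exact (conj h1 (conj (conj hi hGa) I)).
  exists L, (Z *m (coremx n i G)^t*); split; [exact hL|exact (mul_unitarymx hZ hc)| |].
    by apply: (iffRL (track_cat_core _ _ _ _ _ _ hi hGa)); rewrite (cG' _ _ hi hG).
  exact (iffLR (track_cat_core _ _ _ _ _ _ hi hG) t2).
Qed.
End Steps.

(** * Tracking through whole runs, and removal of the frames *)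

Section Runs.
Variable R : rcfType.
Local Notation C := (R[i]).

Lemma chase_tracked n e eps m (st st' : state R) (WS : 'M[C]_n) refS WT refT :
  chase n eps m st st' -> 0 <= eps ->
  tracked e st WS refS WT refT -> tracked (e + m%:R * eps) st' WS refS WT refT.
Proof.
move=> h eps0; elim: h e => {m st st'}.
- by move=> st e; rewrite mul0r addr0.
- move=> m m' ws ws' wt st hs _ IH e [w1 w2 [L [Z [hL hZ t1 t2]]]].
  rewrite natrD mulrDl addrA; apply: IH; split; [exact (word_step_wf hs w1)|exact w2|].
  exists L, Z; split; [exact hL|exact hZ|exact (word_step_track hs eps0 w1 hL t1)|].
  apply: (track_le _ t2); by rewrite lerDl mulr_ge0.
- move=> m m' ws wt wt' st hs _ IH e [w1 w2 [L [Z [hL hZ t1 t2]]]].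
  rewrite natrD mulrDl addrA; apply: IH; split; [exact w1|exact (word_step_wf hs w2)|].
  exists L, Z; split; [exact hL|exact hZ| |exact (word_step_track hs eps0 w2 hL t2)].
  apply: (track_le _ t1); by rewrite lerDl mulr_ge0.
- move=> m st st' st'' hs _ IH e t; apply: IH; exact (transfer_tracked hs t).
Qed.

Lemma word_mx_cons n f (w : word R) : word_mx n (f :: w) = factor_mx n f *m word_mx n w.
Proof. by rewrite /word_mx big_cons. Qed.

Lemma word_mx_cat n (w w' : word R) : word_mx n (w ++ w') = word_mx n w *m word_mx n w'.
Proof. by rewrite /word_mx big_cat. Qed.

Definition core_word (gs : seq (nat * 'M[C]_2)) : word R := [seq Core g.1 g.2 | g <- gs].

Lemma core_word_unitary n gs : wf_word n (core_word gs) -> word_mx n (core_word gs) \is unitarymx.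
Proof.
elim: gs => [|[i G] gs IH] /=; first by rewrite /word_mx big_nil => _; exact: unitarymx1.
move=> [[hi hG] h]; rewrite word_mx_cons.
exact (mul_unitarymx (coremx_unitary hi hG) (IH h)).
Qed.

Lemma track_core_word n e (A : 'M[C]_n) gs w W ref Z :
  track e A (core_word gs ++ w) W ref Z
  = track e (A *m word_mx n (core_word gs)) w W ref Z.
Proof.
elim: gs A => [|[i G] gs IH] A /=; first by rewrite /word_mx big_nil mulmx1.
by rewrite IH word_mx_cons mulmxA.
Qed.

(** The cores put in front of both words are cancelled exactly in [L], so no error arises. *)
Lemma introduce_shift_tracked n e (st st' : state R) (WS : 'M[C]_n) refS WT refT :
  introduce_shift n st st' ->
  tracked e st WS refS WT refT -> tracked e st' WS refS WT refT.
Proof.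
move=> [gs [/wf_cores hg ->]] [w1 w2 [L [Z [hL hZ t1 t2]]]].
have hu := core_word_unitary hg.
split; [by apply/wf_cat; exact (conj hg w1)|by apply/wf_cat; exact (conj hg w2)|].
exists (L *m (word_mx n (core_word gs))^t*), Z.
split; [exact (mul_unitarymx hL (unitarymx_adj hu))|exact hZ| |].
- by rewrite [X in track _ _ X]/= track_core_word -mulmxA (mulhadjU hu) mulmx1.
- by rewrite [X in track _ _ X]/= track_core_word -mulmxA (mulhadjU hu) mulmx1.
Qed.

Lemma deflation_tracked n e eps (st st' : state R) (WS : 'M[C]_n) refS WT refT :
  deflation eps st st' -> 0 <= eps ->
  tracked e st WS refS WT refT -> tracked (e + eps) st' WS refS WT refT.
Proof.
case: st => ws wt [l [r [i [G [D [/= est -> hD _ hDG]]]]]] eps0.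
case: est => ->.
move=> [/= /wf_cat [hl [[hi hG] hr]] w2 [L [Z [hL hZ t1 t2]]]].
have ee : e <= e + eps by rewrite lerDl.
split; [by apply/wf_cat; exact (conj hl (conj (conj hi hD) hr))|exact w2|].
exists L, Z; split; [exact hL|exact hZ| |exact (track_le ee t2)].
apply: (track_context ee hl hL _ t1) => A W ref hA /=.
apply: (track_shift eps0 hr); apply: (fnorm_diffUl hA).
by rewrite (coremx_fnorm _ _ hi).
Qed.

Lemma qr_iteration_tracked n k e eps m (st st' : state R) (WS : 'M[C]_n) refS WT refT :
  qr_iteration n k eps m st st' -> 0 <= eps ->
  tracked e st WS refS WT refT -> tracked (e + m%:R * eps) st' WS refS WT refT.
Proof.
move=> h eps0; elim: h e => {m st st'}.
- by move=> st e; rewrite mul0r addr0.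
- move=> m m' st st1 st2 st3 hs hc _ _ IH e t.
  rewrite natrD mulrDl addrA; apply: IH.
  exact (chase_tracked hc eps0 (introduce_shift_tracked hs t)).
- move=> m st st1 st2 hd _ IH e t.
  rewrite -add1n natrD mulrDl mul1r addrA; apply: IH.
  exact (deflation_tracked hd eps0 t).
Qed.

(** A tracked word with its frames removed: the original sequence of core groups and stored pairs,
    each moved by at most [e]. *)
Fixpoint perturbed n (e : R) (W : 'M[C]_n) (ref : seq ('M[C]_n.+1 * 'M[C]_n.+1 * 'M[C]_n))
    (P : 'M[C]_n) : Prop :=
  if ref is (A0, B0, W') :: ref' then
    exists W1 A1 B1 P',
      [/\ fnorm (W1 - W) <= e, fnorm (A1 - A0) <= e, fnorm (B1 - B0) <= e,
          perturbed e W' ref' P' & P = W1 *m recovered_mx A1 B1 *m P']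
  else fnorm (P - W) <= e.

(** Undoing the frames on the computed cores gives pairs near the original ones, and the frames of
    neighbours cancel, so the word is an exact product of moved factors. *)
Lemma track_perturbed n e (A : 'M[C]_n) w W ref Z :
  A \is unitarymx -> Z \is unitarymx -> wf_word n w -> track e A w W ref Z ->
  exists2 P, perturbed e W ref P & A *m word_mx n w = P *m Z.
Proof.
move=> hA hZ; elim: w A W ref hA => [|[i G|A1 B1] w IH] A W ref hA.
- move=> _ [-> h]; exists (A *m Z^t*).
    rewrite /= -(fnormMU _ hZ) mulmxBl -mulmxA (mulhadjU hZ) mulmx1; exact h.
  by rewrite /word_mx big_nil mulmx1 -mulmxA (mulhadjU hZ) mulmx1.
- move=> [[hi hG] hw] t.
  have [P hP e1] := IH _ _ _ (mul_unitarymx hA (coremx_unitary hi hG)) hw t.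
  by exists P; rewrite // word_mx_cons mulmxA.
case: ref => [|[[A0 B0] W'] ref] [_ hw] //= [U [V [X [[hU hV hX fX] [h1 h2 h3 h4]]]]].
have [P hP e1] := IH _ _ _ hV hw h4.
have hUl := lift_mx_unitary hU; have hVl := lift_mx_unitary hV.
pose A2 := X *m core_prod n A1 *m (lift_mx U)^t*.
pose B2 := X *m core_prod n B1 *m (lift_mx V)^t*.
have unroll (Y Q : 'M[C]_n.+1) : Q \is unitarymx -> X^t* *m (X *m Y *m Q^t*) *m Q = Y.
  by move=> hQ; rewrite !mulmxA (mulhadjU hX) mul1mx -mulmxA (mulhadjU hQ) mulmx1.
have bd (Y Y0 Q : 'M[C]_n.+1) : Q \is unitarymx -> fnorm (Y - X^t* *m Y0 *m Q) <= e ->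
    fnorm (X *m Y *m Q^t* - Y0) <= e.
  move=> hQ; rewrite -(fnormUM (X *m Y *m Q^t* - Y0) (unitarymx_adj hX)).
  by rewrite -(fnormMU (X^t* *m (X *m Y *m Q^t* - Y0)) hQ) mulmxBr mulmxBl (unroll _ _ hQ).
exists (A *m U^t* *m recovered_mx A2 B2 *m P).
  exists (A *m U^t*), A2, B2, P; split=> //.
  - rewrite -(fnormMU _ hU) mulmxBl -mulmxA (mulhadjU hU) mulmx1; exact h1.
  - exact (bd _ _ _ hUl h2).
  - exact (bd _ _ _ hVl h3).
have et : recovered_mx (core_prod n A1) (core_prod n B1) = U^t* *m recovered_mx A2 B2 *m V.
  rewrite -[X in recovered_mx X _](unroll (core_prod n A1) _ hUl).
  rewrite -[X in recovered_mx _ X = _](unroll (core_prod n B1) _ hVl).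
  exact (recovered_mx_equiv U V A2 B2 hX fX).
rewrite word_mx_cons (etrans (tri_mxE n A1 B1) et : factor_mx n (Tri A1 B1) = _) -(mulmxA _ P Z) -e1; move: (recovered_mx A2 B2) (word_mx n w) => T Q.
by rewrite !mulmxA.
Qed.

(** The corner entry is the conjugate of the denominator in [recovered_y]. If it vanished, the
    inverse would take its default value 0 and the factor need not be triangular. *)
Fixpoint nondegenerate n (w : word R) : Prop :=
  match w with
  | [::] => True
  | Core _ _ :: w' => nondegenerate n w'
  | Tri A1 _ :: w' => core_prod n A1 ord0 ord_max != 0 /\ nondegenerate n w'
  end.

(** [X] unitary with [X e_1 = e_1] leaves the first row alone, and lifted matrices leave the last
    column alone. *)
Lemma framed_corner n (X A : 'M[C]_n.+1) (U : 'M[C]_n) :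
  X \is unitarymx -> fixes_first X ->
  (X^t* *m A *m lift_mx U) ord0 ord_max = A ord0 ord_max.
Proof.
move=> hX fX; rewrite (mx_entryE (X^t* *m A *m lift_mx U)) (mx_entryE A).
have e1 : delta_mx (ord0 : 'I_1) ord0 *m X^t* = delta_mx ord0 ord0.
  by rewrite -[RHS]hadj_delta -fX hadjM hadj_delta.
have e2 : lift_mx U *m delta_mx ord_max (ord0 : 'I_1) = delta_mx ord_max ord0.
  have := congr1 (fun M => M^t*) (lift_mx_last (U^t*)).
  by rewrite hadjM hadj_delta -lift_mx_adj hadjK.
by rewrite -!mulmxA e2 !mulmxA e1.
Qed.

Definition corner_bound n (e : R) (ref : seq ('M[C]_n.+1 * 'M[C]_n.+1 * 'M[C]_n)) :=
  forall x, x \in ref -> e < normc (x.1.1 ord0 ord_max).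

Lemma track_nondegenerate n e (A : 'M[C]_n) w W ref Z :
  corner_bound e ref -> track e A w W ref Z -> nondegenerate n w.
Proof.
elim: w A W ref => [|[i G|A1 B1] w IH] A W ref hr //=; first exact: IH.
case: ref hr => // [[[A0 B0] W'] ref] hr [U [V [X [[hU hV hX fX] [h1 h2 h3 h4]]]]].
split; last by apply: IH h4 => x hx; apply: hr; rewrite inE hx orbT.
apply/eqP => z; have := hr _ (mem_head _ _); apply/negP; rewrite -leNgt /=.
apply: le_trans h2; apply: le_trans (normc_le_fnorm _ ord0 ord_max).
by rewrite mxE z add0r mxE (framed_corner _ _ hX fX) normc_opp.
Qed.
End Runs.

(** * Triangularity of the stored factors *)

Section Triangular.
Variable R : rcfType.
Local Notation C := (R[i]).

Lemma mul_coremx_entry m n i (M : 'M[C]_(m, n)) (G : 'M[C]_2) (hi : (i.+1 < n)%N) r s :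
  (M *m coremx n i G) r s =
  if s == i :> nat then M r (Ordinal (ltnW hi)) * G ord0 ord0
                        + M r (Ordinal hi) * G ord_max ord0
  else if s == i.+1 :> nat then M r (Ordinal (ltnW hi)) * G ord0 ord_max
                        + M r (Ordinal hi) * G ord_max ord_max
  else M r s.
Proof.
have ij a : (M *m inj_mx R n 2 i) r a = M r (if a == ord0 then Ordinal (ltnW hi) else Ordinal hi).
  rewrite mxE; have ha := ltn_ord a.
  have hb : (i + a < n)%N by lia.
  under eq_bigr => l _ do rewrite mxE.
  rewrite (@sum_pick _ _ (fun l => M r l) _ (Ordinal hb)).
    congr (M _ _); apply/val_inj; rewrite -[in RHS]val_eqE /=.
    by case: ifP => /=; lia.
  by move=> l; rewrite -val_eqE.
have m1 : ord_max = lift ord0 ord0 :> 'I_2 by apply/val_inj.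
rewrite (coremxE G hi) embE mulmxDr mulmx1 !mulmxA inj_adjE.
have e2 (K : 'M[C]_(m, 2)) (L : 'M[C]_(2, n)) : (K *m L) r s = K r ord0 * L ord0 s + K r ord_max * L ord_max s.
  by rewrite mxE !big_ord_recl big_ord0 addr0 m1.
have e3 (K : 'M[C]_(m, 2)) a : (K *m (G - 1%:M)) r a
    = K r ord0 * (G - 1%:M) ord0 a + K r ord_max * (G - 1%:M) ord_max a.
  by rewrite mxE !big_ord_recl big_ord0 addr0 m1.
rewrite mxE e2 !e3 !ij !mxE /= ?(addn0, addn1).

have [hs|hs] := eqVneq (s : nat) i.
  have -> : s = Ordinal (ltnW hi) by apply/val_inj.
  have -> : (i == i.+1) = false by lia.
  rewrite /= ?mulr1n ?mulr0n; ring.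
have [hs1|hs1] := eqVneq (s : nat) i.+1.
  have -> : s = Ordinal hi by apply/val_inj.
  rewrite /= ?mulr1n ?mulr0n; ring.
rewrite /= ?mulr1n ?mulr0n; ring.
Qed.

(** The parts are carried together through the induction: the first and fourth describe columns [m]
    and beyond, which the next core mixes; the others give the Hessenberg shape, the subdiagonal and
    the corner in terms of single cores. *)
Lemma partial_core_prod n (A : cores R) m : (m <= n)%N ->
  let P : 'M[C]_n.+1 := \prod_(i < m) coremx n.+1 i (A i) in
  [/\ forall i j : 'I_n.+1, (m < j)%N -> P i j = (i == j)%:R,
      forall i j : 'I_n.+1, (j < m)%N -> (j.+1 < i)%N -> P i j = 0,
      forall i j : 'I_n.+1, (j < m)%N -> i = j.+1 :> nat -> P i j = A j ord_max ord0,
      forall i j : 'I_n.+1, j = m :> nat -> (m < i)%N -> P i j = 0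
    & forall j : 'I_n.+1, j = m :> nat -> P ord0 j = \prod_(l < m) A l ord0 ord_max].
Proof.
elim: m => [|m IH] hm /=.
  rewrite big_ord0; split=> //.
  - by move=> i j _; rewrite mxE.
  - by move=> i j ej hi; rewrite mxE -val_eqE /=; have -> : (i == j :> nat) = false by lia.
  by move=> j ej; rewrite big_ord0 mxE -val_eqE /= ej.
have [h1 h2 h3 h4 h5] := IH (ltnW hm).
rewrite big_ord_recr /=; set P := \prod_(i < m) _ in h1 h2 h3 h4 h5 *.
have hm1 : (m.+1 < n.+1)%N by [].
have e i j := @mul_coremx_entry _ _ m P (A m) hm1 i j.
split.
- move=> i j hj; rewrite [LHS]e.
  have -> : (j == m :> nat) = false by lia.
  have -> : (j == m.+1 :> nat) = false by lia.
  by apply: h1; lia.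
- move=> i j hj hi; rewrite [LHS]e.
  case: ifP => [/eqP hjm|hjm].
    rewrite (h4 i) /=; [|by []|lia]; rewrite (h1 i) /=; last by [].
    rewrite -val_eqE /=; have -> : (i == m.+1 :> nat) = false by lia.
    by rewrite !mul0r addr0.
  have -> : (j == m.+1 :> nat) = false by lia.
  by apply: h2; lia.
- move=> i j hj hi; rewrite [LHS]e.
  case: ifP => [/eqP hjm|hjm].
    rewrite (h4 i) /=; [|by []|lia]; rewrite (h1 i) /=; last by [].
    rewrite -val_eqE /= hi hjm eqxx.
    by rewrite mul0r add0r mul1r.
  have -> : (j == m.+1 :> nat) = false by lia.
  by apply: h3; lia.
- move=> i j hj hi; rewrite [LHS]e hj eqxx.
  have -> : (m.+1 == m) = false by lia.
  rewrite (h4 i) /=; [|by []|lia]; rewrite (h1 i) /=; last by [].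
  rewrite -val_eqE /=; have -> : (i == m.+1 :> nat) = false by lia.
  by rewrite !mul0r addr0.
- move=> j hj; rewrite [LHS]e hj eqxx.
  have -> : (m.+1 == m) = false by lia.
  by rewrite (h5 _ (erefl : Ordinal (ltnW hm1) = m :> nat)) (h1 ord0) //= mul0r addr0 big_ord_recr.
Qed.

(** The first row and the first column both have norm 1 and share the diagonal entry. *)
Lemma unitary2_offdiag (G : 'M[C]_2) : G \is unitarymx ->
  G ord_max ord0 = 0 -> G ord0 ord_max = 0.
Proof.
move=> hG z; have m1 : ord_max = lift ord0 ord0 :> 'I_2 by apply/val_inj.
have e1 := congr1 (fun M : 'M[C]_2 => M ord0 ord0) (mulUhadj hG).
have e2 := congr1 (fun M : 'M[C]_2 => M ord0 ord0) (mulhadjU hG).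
move: e1 e2; rewrite !mxE !big_ord_recl !big_ord0 !mxE -m1 z.
rewrite !addr0 mulr0 addr0 [Num.conj _ * _]mulrC /= => e1 e2.
move: e1; rewrite e2 => /(canRL (addKr _)); rewrite addNr -normCK => /eqP.
by rewrite expf_eq0 /= normr_eq0 => /eqP.
Qed.

Lemma core_prod_hessenberg n (A : cores R) (i j : 'I_n.+1) :
  (j.+1 < i)%N -> core_prod n A i j = 0.
Proof.
move=> h; have [_ h2 _ _ _] := partial_core_prod A (leqnn n).
apply: h2 => //; have := ltn_ord i; lia.
Qed.

(** The corner is the product of the upper off-diagonal entries of the cores, so none of these
    vanishes; by unitarity neither do the lower ones, which form the subdiagonal. *)
Lemma core_prod_subdiag n (A : cores R) (i j : 'I_n.+1) :
  unitary_cores n A -> core_prod n A ord0 ord_max != 0 ->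
  i = j.+1 :> nat -> core_prod n A i j != 0.
Proof.
have hn := leqnn n; have [_ _ h3 _ h5] := partial_core_prod A hn.
move=> hA hc hij; have hj : (j < n)%N by have := ltn_ord i; move: hij; clear; lia.
apply/eqP; rewrite [LHS](h3 i j hj hij) => z; move/eqP: hc; apply.
rewrite [LHS](h5 ord_max erefl); apply/eqP/prodf_eq0.
exists (Ordinal hj) => //=; apply/eqP.
exact (unitary2_offdiag (hA _ hj) z).
Qed.

Lemma pid_delta n (j : 'I_n) :
  (pid_mx n : 'M[C]_(n.+1, n)) *m delta_mx j (ord0 : 'I_1) = delta_mx (lift ord_max j) ord0.
Proof.
rewrite -colE; apply/matrixP => r s; rewrite !mxE ord1 eqxx andbT -val_eqE [val (lift _ _)]lift_max.
by case: eqP => //= ->; rewrite ltn_ord.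
Qed.

Lemma delta_pidT n (j : 'I_n) :
  delta_mx (ord0 : 'I_1) j *m (pid_mx n : 'M[C]_(n.+1, n))^T = delta_mx ord0 (lift ord_max j).
Proof. by rewrite -[LHS]trmxK trmx_mul trmxK !trmx_delta pid_delta trmx_delta. Qed.

Lemma pid_conj_entry n (M : 'M[C]_n.+1) (i j : 'I_n) :
  ((pid_mx n)^T *m M *m pid_mx n) i j = M (lift ord_max i) (lift ord_max j).
Proof.
rewrite (mx_entryE (_ *m pid_mx n)) (mx_entryE M) -(pid_delta j) -(delta_pidT i).
by rewrite !mulmxA.
Qed.

(** This is the equation that the formula for [y] solves. *)
Lemma recovered_form_last_row n (e : 'cV[C]_n) (f : 'rV[C]_n) (A B : 'M[C]_n) :
  (f *m A *m e) ord0 ord0 != 0 ->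
  f *m (A *m (B + e *m (- ((f *m A *m e) ord0 ord0)^-1 *: (f *m (A *m B))))) = 0.
Proof.
move=> h; rewrite mulmxDr mulmxDr (mulmxA A e) -scalemxAr -scalemxAr (mulmxA f (A *m e)).
rewrite (mulmxA f A e) {2}[f *m A *m e]mx11_scalar mul_scalar_mx scalerA mulNr mulVf //.
by rewrite scaleN1r subrr.
Qed.

(* C M = B + e_1 y^T for the unprojected M, whose last row vanishes.  Below the
   first row this equates the Hessenberg matrix B with C M, and the subdiagonal
   of C does not vanish, so the rows of M are determined from the bottom up. *)
Lemma tri_mx_upper n (A B : cores R) : unitary_cores n A -> core_prod n A ord0 ord_max != 0 ->
  upper_tri (tri_mx n A B).
Proof.
move=> hA hc; have hU := core_prod_unitary hA.
rewrite tri_mxE /recovered_mx /recovered_form.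
set P := core_prod n A in hc hU *; set Q := core_prod n B.
set f := delta_mx ord0 ord_max; set e := delta_mx ord0 ord0.
set y := _ *: _; set M := P^t* *m (Q + e *m y).
have hPM : P *m M = Q + e *m y by rewrite /M mulmxA (mulUhadj hU) mul1mx.
have hlast : f *m M = 0.
  by apply: recovered_form_last_row; rewrite /f /e -mx_entryE !mxE conjC_eq0.
have Mz : forall d (i j : 'I_n.+1), (n - i <= d)%N -> (j < i)%N -> M i j = 0.
  elim=> [|d IH] i j hd hji.
    have -> : i = ord_max by apply/val_inj; have := ltn_ord i; move: hd; clear; rewrite /=; lia.
    by have := congr1 (fun K : 'rV[C]_n.+1 => K ord0 j) hlast; rewrite -rowE !mxE.
  have [hin|hin] := leqP n i.
    by apply: IH => //; move: hin; clear; lia.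
  have hi1 : (i.+1 < n.+1)%N by [].
  have := congr1 (fun K : 'M[C]_n.+1 => K (Ordinal hi1) j) hPM.
  have -> : (Q + e *m y) (Ordinal hi1) j = 0.
    rewrite mxE (core_prod_hessenberg B (i := Ordinal hi1)) //=.
    by rewrite mxE big1 ?addr0 // => l _; rewrite mxE /= mul0r.
  rewrite mxE (bigD1 i) //= big1 ?addr0.
    move=> /eqP; rewrite mulf_eq0 (negbTE (core_prod_subdiag (i := Ordinal hi1) hA hc erefl)) /=.
    by move/eqP.
  move=> l hl; have [hli|hli] := ltnP l i.
    by rewrite (core_prod_hessenberg A (i := Ordinal hi1)) ?mul0r.
  rewrite (IH l j) ?mulr0 //; move: hl hli hd hji; clear; rewrite -val_eqE /=; lia.
move=> i j hji; rewrite pid_conj_entry; apply: (Mz n); [exact: leq_subr|by rewrite !lift_max].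
Qed.
Lemma upper_triM n (A B : 'M[C]_n) : upper_tri A -> upper_tri B -> upper_tri (A *m B).
Proof.
move=> hA hB i j hij; rewrite mxE big1 // => l _.
have [hl|hl] := ltnP l i; first by rewrite (hA _ _ hl) mul0r.
by rewrite (hB l j (leq_trans hij hl)) mulr0.
Qed.

Lemma word_mx_upper n (w : word R) :
  (forall i G, List.In (Core i G) w -> is_diag_mx G) ->
  wf_word n w -> nondegenerate n w -> upper_tri (word_mx n w).
Proof.
elim: w => [|[i G|A B] w IH] hd.
- by move=> _ _ r s hrs; rewrite /word_mx big_nil mxE -val_eqE gtn_eqF.
- move=> [[hi hG] hw] hn; rewrite word_mx_cons; apply: upper_triM.
    move=> r s hrs; rewrite /= mxE; case: ifP => [/andP [hr hs]|_].
      have /is_diag_mxP -> // := hd i G (or_introl erefl).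
      by rewrite !inordK; move: hrs hr hs; clear; lia.
    by rewrite -val_eqE gtn_eqF.
  by apply: IH hw hn => j H hH; apply: (hd j); right.
- move=> [[hA hB] hw] [hc hn]; rewrite word_mx_cons; apply: upper_triM.
    exact: tri_mx_upper.
  by apply: IH hw hn => j H hH; apply: (hd j); right.
Qed.

End Triangular.

(** * Perturbation of a single spike factor *)

Section Perturbation.
Variable R : rcfType.
Local Notation C := (R[i]).
Local Notation Pi n := (pid_mx n : 'M[C]_(n.+1, n)).

Lemma recovered_formE n N (P : 'M[C]_(n, N)) (Q : 'M[C]_(N, n)) e f (A B : 'M[C]_N) (u : 'cV[C]_N) (y : 'rV[C]_N) (c : C) :
  A *m e = u -> f *m (A *m B) = y -> - ((f *m u) ord0 ord0)^-1 = c ->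
  recovered_form P Q e f A B = P *m (A *m B) *m Q + c *: (P *m u *m (y *m Q)).
Proof.
move=> hu hy hc; rewrite /recovered_form hy -(mulmxA f A e) hu hc mulmxDr (mulmxA A e) hu.
by rewrite -scalemxAr mulmxDr mulmxDl -scalemxAr -scalemxAl !mulmxA.
Qed.

(** The large factor [al] cancels against [al^-1 *: a] and survives only next to the error [b] of
    the column. *)
Lemma rank1_update n (M1 M2 : 'M[C]_n) (a b : 'cV[C]_n) (r g : 'rV[C]_n) (al s : C) :
  al != 0 ->
  M1 + M2 + (al * s) *: ((al^-1 *: a + b) *m (r + g))
  = M1 + al *: ((al^-1 *: a) *m r) + ((M2 + ((s * al) *: b) *m g) + ((s * al) *: b) *m r
      + a *m ((s - 1) *: r + s *: g)).
Proof.
move=> al0; apply/matrixP => i j; rewrite !mxE !big_ord1 !mxE.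
move: (M1 i j) (M2 i j) (a i 0) (b i 0) (r 0 j) (g 0 j) => m1 m2 x y z t.
by field.
Qed.

(** [G] and [w] are the errors of [A B] and [A e]. The denominator [f A e] moves from [- al^-1] to
    [- al^-1 / s], so the scaling of the recovered row goes from [al] to [al * s]. *)
Lemma recovered_form_perturb n N (P : 'M[C]_(n, N)) (Q : 'M[C]_(N, n)) e f
    (A0 B0 A1 B1 : 'M[C]_N) (x : 'cV[C]_N) (t : 'rV[C]_N) (al : C) :
  let G := A1 *m B1 - A0 *m B0 in
  let w := A1 *m e - A0 *m e in
  let s := (1 - al * (f *m w) ord0 ord0)^-1 in
  al != 0 -> 1 - al * (f *m w) ord0 ord0 != 0 ->
  A0 *m e = al^-1 *: x -> f *m x = - 1%:M -> f *m (A0 *m B0) = t ->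
  recovered_form P Q e f A1 B1 = recovered_form P Q e f A0 B0
    + ((P *m G *m Q + (P *m ((s * al) *: w)) *m (f *m G *m Q))
       + (P *m ((s * al) *: w)) *m (t *m Q)
       + P *m x *m ((s - 1) *: (t *m Q) + s *: (f *m G *m Q))).
Proof.
move=> G w s al0 s0 hx fx ht.
have f0 : (f *m (al^-1 *: x)) ord0 ord0 = - al^-1.
  by rewrite -scalemxAr fx !mxE eqxx mulr1n mulrN mulr1.
have eu : A1 *m e = al^-1 *: x + w by rewrite -hx /w addrC subrK.
have ey : f *m (A1 *m B1) = t + f *m G.
  by rewrite -ht -mulmxDr /G addrC subrK.
have f1 : - ((f *m (al^-1 *: x + w)) ord0 ord0)^-1 = al * s.
  rewrite mulmxDr mxE f0 /s; set d := (f *m w) ord0 ord0 in s0 *.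
  have -> : - al^-1 + d = - (al^-1 * (1 - al * d)).
    by rewrite mulrBr mulr1 mulrA mulVf // mul1r opprB addrC.
  by rewrite invrN opprK invfM invrK.
have c0 : - ((f *m (al^-1 *: x)) ord0 ord0)^-1 = al by rewrite f0 invrN invrK opprK.
rewrite (recovered_formE P Q eu ey f1) (recovered_formE P Q hx ht c0).
have -> : P *m (A1 *m B1) *m Q = P *m (A0 *m B0) *m Q + P *m G *m Q.
  by rewrite -mulmxDl -mulmxDr /G [in RHS]addrC subrK.
rewrite (mulmxDl t (f *m G) Q) (mulmxDr P (al^-1 *: x) w) -!(scalemxAr _ P).
exact: rank1_update.
Qed.

Lemma fnorm_pidTM n m (M : 'M[C]_(n.+1, m)) : fnorm ((Pi n)^T *m M) <= fnorm M.
Proof.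
rewrite -(@ler_pXn2r _ 2) // ?nnegrE ?fnorm_ge0 // !fnorm_sqr.
rewrite big_ord_recr /=.
have -> : \sum_(i < n) \sum_j normc (M (widen_ord (leqnSn n) i) j) ^+ 2
    = \sum_(i < n) \sum_j normc (((Pi n)^T *m M) i j) ^+ 2.
  apply: eq_bigr => i _; apply: eq_bigr => j _; congr (normc _ ^+ 2).
  rewrite (mx_entryE (_ *m M)) (mulmxA _ _ M) delta_pidT -mx_entryE.
  by congr (M _ _); apply/val_inj; rewrite [RHS]lift_max.
by rewrite lerDl sumr_ge0 // => j _; exact: sqr_ge0.
Qed.

Lemma fnormM_pid n m (M : 'M[C]_(m, n.+1)) : fnorm (M *m (Pi n)) <= fnorm M.
Proof.
rewrite -fnorm_adj hadjM -(fnorm_adj M).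
have -> : (Pi n)^t* = (pid_mx n)^T.
  by rewrite pid_mx_inj inj_adjE.
exact: fnorm_pidTM.
Qed.

(* [exact_storage] in terms of core products, with a bound on [al], whose modulus
   is the norm of the extended spike. *)
Definition rolled n (h : R) (A : 'M[C]_n) (j : 'I_n) (C0 B0 : 'M[C]_n.+1) : Prop :=
  [/\ C0 \is unitarymx, B0 \is unitarymx, A = recovered_mx C0 B0,
      B0 = C0 *m tperm_mx (lift ord_max j) ord_max
    & exists al, [/\ al != 0, normc al <= h & C0 *m extended_spike A j = al *: delta_mx ord0 ord0]].

Lemma extended_spike_fnorm n (A : 'M[C]_n) j :
  fnorm (extended_spike A j) ^+ 2 = \sum_i normc (A i j) ^+ 2 + 1.
Proof.
rewrite fnorm_sqr big_ord_recr /=; congr (_ + _).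
  apply: eq_bigr => i _; rewrite big_ord1 mxE.
  have -> : widen_ord (leqnSn n) i = lift ord_max i.
    by apply/val_inj; rewrite [RHS]lift_max.
  by rewrite liftK.
by rewrite big_ord1 mxE unlift_none normc_opp ComplexField.Normc.normc1 expr1n.
Qed.

Lemma exact_storage_rolled n (h : R) (A : 'M[C]_n) j (C0 B0 : cores R) : 0 <= h ->
  \sum_i normc (A i j) ^+ 2 + 1 <= h ^+ 2 ->
  exact_storage A j C0 B0 -> rolled h A j (core_prod n C0) (core_prod n B0).
Proof.
move=> h0 hh [hu [al ha] hB hA].
have hC : core_prod n C0 \is unitarymx by apply: core_prod_unitary => i /hu [].
have hB' : core_prod n B0 \is unitarymx by apply: core_prod_unitary => i /hu [].
split; [exact hC|exact hB'|exact (etrans hA (tri_mxE n C0 B0))|exact hB|exists al].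
have en : normc al = fnorm (extended_spike A j).
  by rewrite -(fnormUM _ hC) ha fnormZ fnorm_delta mulr1.
split; [| |exact ha].
  apply/eqP => z; have := extended_spike_fnorm A j; rewrite -en z.
  rewrite ComplexField.Normc.normc0 expr0n /= => e.
  have : 0 <= \sum_i normc (A i j) ^+ 2 by apply: sumr_ge0 => i _; exact: sqr_ge0.
  by rewrite -[X in _ <= X](addrK 1) -e sub0r oppr_ge0 ler10.
by rewrite en -(@ler_pXn2r _ 2) // ?nnegrE ?fnorm_ge0 // extended_spike_fnorm.
Qed.

(** [C0^* B0] is a transposition, whose last row is [e_j^T], and [C0^* e_1] is the extended spike
    divided by [al]; hence the recovered row is [al] times [e_j^T]. *)
Lemma rolled_facts n (A : 'M[C]_n) (j : 'I_n) (C0 B0 : 'M[C]_n.+1) al :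
  C0 \is unitarymx -> al != 0 ->
  B0 = C0 *m tperm_mx (lift ord_max j) ord_max ->
  C0 *m extended_spike A j = al *: delta_mx ord0 ord0 ->
  [/\ (C0)^t* *m delta_mx ord0 (ord0 : 'I_1) = al^-1 *: extended_spike A j,
      delta_mx (ord0 : 'I_1) ord_max *m extended_spike A j = - 1%:M,
      delta_mx (ord0 : 'I_1) ord_max *m (C0^t* *m B0) = delta_mx ord0 (lift ord_max j)
    & (Pi n)^T *m extended_spike A j = col j A].
Proof.
move=> hC al0 hB ha; split.
- have := congr1 (fun v => C0^t* *m v) ha; rewrite mulmxA (mulhadjU hC) mul1mx => ->.
  by rewrite -scalemxAr scalerA mulVf // scale1r.
- by rewrite -rowE; apply/matrixP => a b; rewrite !mxE !ord1 unlift_none.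
- rewrite hB (mulmxA _ C0) (mulhadjU hC) mul1mx -rowE /tperm_mx.
  by apply/matrixP => a b; rewrite !mxE !ord1 tpermR eqxx eq_sym.
- apply/matrixP => a b; rewrite (mx_entryE (_ *m extended_spike A j)) mulmxA delta_pidT -mx_entryE.
  by rewrite !mxE liftK.
Qed.

(* The only term of order [h ^+ 2 * e] is [th] times the rank-one matrix with the
   spike as its column and [e_j^T] as its row. *)
Lemma recovered_mx_perturb n (h e : R) (A : 'M[C]_n) j (C0 B0 C1 B1 : 'M[C]_n.+1) :
  rolled h A j C0 B0 -> 1 <= h -> 0 <= e -> e * h <= 2^-1 ->
  fnorm (C1 - C0) <= e -> fnorm (B1 - B0) <= e ->
  exists D v th g,
    [/\ recovered_mx C1 B1 = A + (D + v *m delta_mx (ord0 : 'I_1) j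
            + col j A *m (th *: delta_mx (ord0 : 'I_1) j + g)),
        fnorm D <= 6%:R * e, fnorm v <= 2%:R * h * e, normc th <= 2%:R * h * e
      & fnorm g <= 6%:R * e].
Proof.
move=> [hC hB hA hBC [al [al0 hal ha]]] h1 e0 eh dC dB.
have [f1 f2 f3 f4] := rolled_facts hC al0 hBC ha.
set f := delta_mx ord0 ord_max in f2 f3.
set e1 := delta_mx ord0 ord0 in f1.
set x := extended_spike A j in f1 f2 f4.
pose G := C1^t* *m B1 - C0^t* *m B0.
pose w := C1^t* *m e1 - C0^t* *m e1.
have he : e <= 2^-1 by apply: le_trans eh; rewrite ler_peMr.
have hdC : fnorm (C1^t* - C0^t*) <= e by rewrite -hadjB fnorm_adj.
have nG : fnorm G <= 3%:R * e.
  have -> : G = (C1^t* - C0^t*) *m (B1 - B0) + (C1^t* - C0^t*) *m B0 + C0^t* *m (B1 - B0).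
    rewrite -mulmxDr subrK mulmxBl mulmxBr /G; apply/matrixP => a b; rewrite !mxE; ring.
  have -> : 3%:R * e = e + e + e by ring.
  apply: le_trans (fnormD _ _) _; apply: lerD; last by rewrite (fnormUM _ (unitarymx_adj hC)).
  apply: le_trans (fnormD _ _) _; apply: lerD; last by rewrite (fnormMU _ hB).
  apply: le_trans (fnormM _ _) _; apply: (@le_trans _ _ (e * e)).
    by apply: ler_pM => //; exact: fnorm_ge0.
  by rewrite ler_piMr //; apply: le_trans he _; rewrite invf_le1 ?ler1n ?ltr0n.
have nw : fnorm w <= e.
  rewrite /w -mulmxBl; apply: le_trans (fnormM _ _) _.
  by rewrite fnorm_delta mulr1.
have nf (p : nat) (M : 'M[C]_(n.+1, p)) : fnorm (f *m M) <= fnorm M.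
  by apply: le_trans (fnormM _ _) _; rewrite fnorm_delta mul1r.
(* [1 - d] is the ratio of the new denominator to the old one; [e * h <= 1/2] bounds its inverse [s]
   by 2. *)
pose d := al * (f *m w) ord0 ord0.
have nd : normc d <= h * e.
  rewrite /d ComplexField.Normc.normcM; apply: ler_pM; rewrite ?normc_ge0 //.
  apply: le_trans (normc_le_fnorm _ _ _) _; exact: le_trans (nf _ _) nw.
have nd2 : normc d <= 2^-1 by rewrite (le_trans nd) // mulrC.
have n1d : 2^-1 <= normc (1 - d).
  have := normc_add (1 - d) d; rewrite subrK ComplexField.Normc.normc1 => hh.
  have : 1 <= normc (1 - d) + 2^-1 by apply: le_trans hh _; rewrite lerD2l.
  by rewrite -lerBlDr {1}(splitr 1) mul1r addrK.
have s0 : 1 - d != 0.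
  apply/eqP => z; move: n1d; rewrite z ComplexField.Normc.normc0.
  by rewrite leNgt invr_gt0 ltr0n.
pose s := (1 - d)^-1.
have ns : normc s <= 2%:R.
  rewrite /s ComplexField.Normc.normcV -[2%:R]invrK lef_pV2 // posrE ?invr_gt0 ?ltr0n //.
  by apply: lt_le_trans n1d; rewrite invr_gt0 ltr0n.
(* This makes the coefficient [s - 1] of order [h * e]. It multiplies the full spike column, so a
   mere bound on [s] would not do. *)
have es : s - 1 = s * d.
  by rewrite /s; move: d s0 {nd nd2 n1d s ns} => z hz; field.
have nsw : fnorm ((s * al) *: w) <= 2%:R * h * e.
  rewrite fnormZ ComplexField.Normc.normcM; apply: ler_pM => //.
  - by rewrite mulr_ge0 // normc_ge0.
  - exact: fnorm_ge0.
  - by apply: ler_pM; rewrite ?normc_ge0.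
have nfG : fnorm (f *m G *m (Pi n)) <= 3%:R * e.
  by apply: le_trans (fnormM_pid _) _; apply: le_trans (nf _ _) nG.
have main := recovered_form_perturb (Pi n)^T (Pi n) (A1 := C1^t*) B1 al0 s0 f1 f2 f3.
have nPv : fnorm ((Pi n)^T *m ((s * al) *: w)) <= 2%:R * h * e.
  exact: le_trans (fnorm_pidTM _) nsw.
exists ((Pi n)^T *m G *m (Pi n)
   + ((Pi n)^T *m ((s * al) *: w)) *m (f *m G *m (Pi n))),
  ((Pi n)^T *m ((s * al) *: w)), (s - 1), (s *: (f *m G *m (Pi n))).
have tQ : delta_mx (ord0 : 'I_1) (lift ord_max j) *m (Pi n) = delta_mx ord0 j :> 'rV[C]_n.
  rewrite -delta_pidT -mulmxA pid_mx_inj -inj_adjE inj_isom ?mulmx1 //.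
split.
- rewrite {1}hA /recovered_mx main tQ f4; exact: erefl.
- have -> : 6%:R * e = 3%:R * e + 3%:R * e by ring.
  apply: le_trans (fnormD _ _) _; apply: lerD.
    apply: le_trans (fnormM_pid _) _; exact: le_trans (fnorm_pidTM _) nG.
  apply: le_trans (fnormM _ _) _.
  apply: (@le_trans _ _ (2%:R * h * e * (3%:R * e))).
    by apply: ler_pM => //; exact: fnorm_ge0.
  have -> : 2%:R * h * e * (3%:R * e) = 2%:R * (e * h) * (3%:R * e) by ring.
  rewrite ler_piMl ?mulr_ge0 //.
  by move: eh; move: (e * h) => z; clear; lra.
- exact nPv.
- rewrite es ComplexField.Normc.normcM -mulrA; apply: ler_pM => //; exact: normc_ge0.
- rewrite fnormZ; have -> : 6%:R * e = 2%:R * (3%:R * e) by ring.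
  by apply: ler_pM => //; [exact: normc_ge0|exact: fnorm_ge0].
Qed.
End Perturbation.

(** * Perturbation of the product *)

Section Products.
Variable R : rcfType.
Local Notation C := (R[i]).

Lemma fnormM_le m n p (A : 'M[C]_(m, n)) (B : 'M[C]_(n, p)) (a b : R) :
  fnorm A <= a -> fnorm B <= b -> fnorm (A *m B) <= a * b.
Proof.
move=> ha hb; apply: le_trans (fnormM A B) _.
by apply: ler_pM => //; exact: fnorm_ge0.
Qed.

Lemma fnormD_le m n (A B : 'M[C]_(m, n)) (a b : R) :
  fnorm A <= a -> fnorm B <= b -> fnorm (A + B) <= a + b.
Proof. by move=> ha hb; apply: le_trans (fnormD A B) _; exact: lerD. Qed.

Lemma fnorm_col m n (A : 'M[C]_(m, n)) j : fnorm (col j A) <= fnorm A.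
Proof. by rewrite colE; apply: le_trans (fnormM _ _) _; rewrite fnorm_delta mulr1. Qed.

Fixpoint nominal n (W : 'M[C]_n) (ref : seq ('M[C]_n.+1 * 'M[C]_n.+1 * 'M[C]_n)) : 'M[C]_n :=
  if ref is (C0, B0, W') :: ref' then W *m (recovered_mx C0 B0 *m nominal W' ref') else W.

(* [pre] is the product of everything to the left.  The bounds on partial products
   and on the row [j] control the two ends of the rank-one terms of
   [recovered_mx_perturb] uniformly in the number of factors. *)
Fixpoint well_scaled n (h : R) (pre W : 'M[C]_n)
    (ref : seq ('M[C]_n.+1 * 'M[C]_n.+1 * 'M[C]_n)) : Prop :=
  [/\ W \is unitarymx, fnorm pre <= h, fnorm (nominal W ref) <= h &
    if ref is (C0, B0, W') :: ref' then
      [/\ fnorm (recovered_mx C0 B0) <= h,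
          exists2 j, rolled h (recovered_mx C0 B0) j C0 B0 & fnorm (row j (nominal W' ref')) <= 1
        & well_scaled h (pre *m (W *m recovered_mx C0 B0)) W' ref']
    else True].

(** The first three terms on the right are linear in the errors of the core group, of the stored
    factor and of the tail; the rest contains products of at least two errors. *)
Lemma product_expansion n (W A s E D d : 'M[C]_n) :
  (W + E) *m (A + D) *m (s + d) - W *m (A *m s)
  = E *m (A *m s) + W *m D *m s + (W *m A *m d + (E *m (D *m s) + (W *m D + E *m (A + D)) *m d)).
Proof.
rewrite (mulmxDr _ s d) (mulmxDl W E) (mulmxDr W) (mulmxDl (W *m A + _)) (mulmxDl (W *m A)).
rewrite (mulmxDl (W *m A + W *m D) _ d) (mulmxDl (W *m A) (W *m D) d) (mulmxDl (W *m D) _ d).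
rewrite (mulmxDr E A D) (mulmxDl (E *m A) _ s) !mulmxA.
move: (W *m A *m s) (W *m D *m s) (E *m A *m s) (E *m D *m s) (W *m A *m d) (W *m D *m d) => x1 x2 x3 x4 x5 x6.
move: ((E *m A + E *m D) *m d) => x7.
apply/matrixP => i j; rewrite !mxE; ring.
Qed.

Lemma rank1_distribute n (pre W D s : 'M[C]_n) (v c : 'cV[C]_n) (g : 'rV[C]_n) j (th : C) :
  pre *m (W *m (D + v *m delta_mx (ord0 : 'I_1) j
     + c *m (th *: delta_mx (ord0 : 'I_1) j + g)) *m s)
  = pre *m (W *m D) *m s + pre *m (W *m v) *m row j s
      + pre *m W *m c *m (th *: row j s + g *m s).
Proof.
rewrite (rowE j s); move: (delta_mx _ j) => y.
have -> : th *: (y *m s) + g *m s = (th *: y + g) *m s by rewrite mulmxDl scalemxAl.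
by rewrite !mulmxA -!mulmxDl -!mulmxA -!mulmxDr !mulmxA.
Qed.

(* [K] depends on [h] and [k] only, not on the run that produced the perturbation. *)
Lemma perturbed_bound (h : R) (k : nat) : 1 <= h ->
  exists2 K : R, 0 <= K &
  forall n (ref : seq ('M[C]_n.+1 * 'M[C]_n.+1 * 'M[C]_n)) (pre W P : 'M[C]_n) (e : R),
  size ref = k -> 0 <= e -> e * h <= 2^-1 -> well_scaled h pre W ref -> perturbed e W ref P ->
  fnorm (P - nominal W ref) <= K * e /\
  fnorm (pre *m (P - nominal W ref)) <= (17 * k + 1)%N%:R * h ^+ 2 * e + K * e ^+ 2.
Proof.
move=> h1; have h0 : 0 <= h by apply: le_trans ler01 h1.
have hh : h <= h ^+ 2 by rewrite expr2 ler_peMl.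
(* Origin of [17 * k + 1]: the last core group contributes 1, and each stored factor 17, namely 1
   for the core group before it and 16 for the factor itself. *)
elim: k => [|k [K K0 IH]].
  exists 1 => // n [|//] pre W P e _ e0 eh [hW hp hr _] /= hP; rewrite mul1r; split=> //.
  rewrite mul1r; apply: le_trans (fnormM_le hp hP) _.
  rewrite -[X in X <= _]addr0; apply: lerD; last exact: sqr_ge0.
  by rewrite muln0 add0n mul1r; exact (ler_wpM2r e0 hh).
(* Coefficient of [e ^+ 2] in the products of several errors: [16 h^3] with the exact tail, and
   [16 h^2 + h + 16 h^2 <= 33 h^2] times the constant [K] of the tail error. *)
set B2 := 16%:R * h ^+ 3 + 33%:R * h ^+ 2 * K.
have B20 : 0 <= B2 by rewrite addr_ge0 ?mulr_ge0 ?exprn_ge0.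
exists (h + 16%:R * h ^+ 3 + h * K + B2 + (K + h * B2)).
  by rewrite !addr_ge0 ?mulr_ge0 ?exprn_ge0.
move=> n [//|[[C0 B0] W'] ref] pre W P e [hs] e0 eh.
move=> [hW hpre hrp [hT [j hroll hrow] hg]] [W1 [C1 [B1 [P' [dW dC dB hP' ->]]]]].
have [IH1 IH2] := IH n ref _ W' P' e hs e0 eh hg hP'.
have [hW' hpre' hsuf _] : [/\ W' \is unitarymx, fnorm (pre *m (W *m recovered_mx C0 B0)) <= h,
    fnorm (nominal W' ref) <= h & True] by case: (ref) hg => [|[[? ?] ?] ?] [? ? ? ?].
have e1 : e <= 1.
  by apply: (@le_trans _ _ (e * h)); [rewrite ler_peMr|apply: le_trans eh _; rewrite invf_le1 ?ler1n ?ltr0n].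
have [D [v [th [g [eT nD nv nth ng]]]]] := recovered_mx_perturb hroll h1 e0 eh dC dB.
rewrite [nominal W _]/= in hrp *.
set T := recovered_mx C0 B0 in hT hg hpre' IH2 hrp eT *.
set s := nominal W' ref in hrow hsuf IH1 IH2 hrp *.
set T1 := recovered_mx C1 B1 in eT *.
have [E eE] : exists E, W1 = W + E by exists (W1 - W); rewrite addrC subrK.
have [d ed] : exists d, P' = s + d by exists (P' - s); rewrite addrC subrK.
have nE : fnorm E <= e by rewrite eE addrC addKr in dW.
have nd : fnorm d <= K * e by rewrite ed addrC addKr in IH1.
rewrite ed [s + d - s]addrC addKr in IH2; rewrite ed.
set De := D + _ + _ in eT.
have ndelta : fnorm (delta_mx (ord0 : 'I_1) j : 'rV[C]_n) <= 1 by rewrite fnorm_delta.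
have nc : fnorm (col j T) <= h by exact: le_trans (fnorm_col _ _) hT.
have nth1 (M : 'rV[C]_n) : fnorm M <= 1 -> fnorm (th *: M) <= 2%:R * h * e.
  move=> hM; rewrite fnormZ -[X in _ <= X]mulr1.
  by apply: ler_pM => //; [exact: normc_ge0|exact: fnorm_ge0].
have nDe : fnorm De <= 16%:R * h ^+ 2 * e.
  apply: (@le_trans _ _ (6%:R * e + 2%:R * h * e * 1 + h * (2%:R * h * e + 6%:R * e))).
    apply: fnormD_le; first exact (fnormD_le nD (fnormM_le nv ndelta)).
    exact (fnormM_le nc (fnormD_le (nth1 _ ndelta) ng)).
  have -> : 6%:R * e + 2%:R * h * e * 1 + h * (2%:R * h * e + 6%:R * e)
     = (6%:R + 8%:R * h + 2%:R * h ^+ 2) * e by ring.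
  rewrite ler_wpM2r //; move: h1 hh; move: (h ^+ 2) => z; clear; lra.
have nAs : fnorm (T *m s) <= h by rewrite -(fnormUM _ hW).
have nEA : fnorm (E *m (T *m s)) <= e * h := fnormM_le nE nAs.
have nWDe : fnorm (W *m De) <= 16%:R * h ^+ 2 * e by rewrite (fnormUM _ hW).
have nWT : fnorm (W *m T) <= h by rewrite (fnormUM _ hW).
have nWDs : fnorm (W *m De *m s) <= 16%:R * h ^+ 2 * e * h := fnormM_le nWDe hsuf.
have nWAd : fnorm (W *m T *m d) <= h * (K * e) := fnormM_le nWT nd.
set R2 := E *m (De *m s) + (W *m De + E *m (T + De)) *m d.
have nR2 : fnorm R2 <= B2 * e ^+ 2.
  apply: (@le_trans _ _ (e * (16%:R * h ^+ 2 * e * h) +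
      (16%:R * h ^+ 2 * e + e * (h + 16%:R * h ^+ 2 * e)) * (K * e))).
    exact (fnormD_le (fnormM_le nE (fnormM_le nDe hsuf))
      (fnormM_le (fnormD_le nWDe (fnormM_le nE (fnormD_le hT nDe))) nd)).
  have -> : B2 * e ^+ 2 = e * (16%:R * h ^+ 2 * e * h) + 33%:R * h ^+ 2 * e * (K * e).
    by rewrite /B2; ring.
  rewrite lerD2l ler_wpM2r ?mulr_ge0 //.
  have -> : 16%:R * h ^+ 2 * e + e * (h + 16%:R * h ^+ 2 * e)
     = (16%:R * h ^+ 2 + h + 16%:R * h ^+ 2 * e) * e by ring.
  rewrite ler_wpM2r //.
  have : 16%:R * h ^+ 2 * e <= 16%:R * h ^+ 2 by rewrite ler_piMr ?mulr_ge0 ?exprn_ge0.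
  move: hh; move: (16%:R * h ^+ 2 * e) (h ^+ 2) => y z; clear; lra.
have eP : W1 *m T1 *m (s + d) - W *m (T *m s) = E *m (T *m s) + W *m De *m s + (W *m T *m d + R2).
  by rewrite eE eT; exact: product_expansion.
rewrite eP.
have ee : e ^+ 2 <= e by rewrite expr2 ler_piMr.
split.
  apply: (@le_trans _ _ (e * h + 16%:R * h ^+ 2 * e * h + (h * (K * e) + B2 * e ^+ 2))).
    exact (fnormD_le (fnormD_le nEA nWDs) (fnormD_le nWAd nR2)).
  have -> : (h + 16%:R * h ^+ 3 + h * K + B2 + (K + h * B2)) * e
    = e * h + 16%:R * h ^+ 2 * e * h + (h * (K * e) + B2 * e) + (K + h * B2) * e by ring.
  rewrite -[X in X <= _]addr0; apply: lerD; last by rewrite mulr_ge0 // addr_ge0 // mulr_ge0.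
  by rewrite !lerD2l ler_wpM2l.
rewrite (mulmxDr pre (_ + _) (_ + _)) (mulmxDr pre (E *m _)) (mulmxDr pre _ R2).
have q1 : fnorm (pre *m (E *m (T *m s))) <= h * (e * h) := fnormM_le hpre nEA.
(* Multiplying norms would give [h ^+ 4] here. Instead, [pre W] times the spike is a column of the
   partial product [pre W T], and [e_j^T s] is a row of norm at most 1, which leaves
   [6 + 2 + 2 + 6 = 16] times [h ^+ 2 * e]. *)
have q2 : fnorm (pre *m (W *m De *m s)) <= 16%:R * h ^+ 2 * e.
  have -> : 16%:R * h ^+ 2 * e = h * (6%:R * e) * h + h * (2%:R * h * e) * 1
      + h * (2%:R * h * e + 6%:R * e * h) by ring.
  have -> : pre *m (W *m De *m s) = pre *m (W *m D) *m s + pre *m (W *m v) *m row j s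
      + col j (pre *m (W *m T)) *m (th *: row j s + g *m s).
    have -> : col j (pre *m (W *m T)) = pre *m W *m col j T by rewrite !colE !mulmxA.
    exact: rank1_distribute.
  have nWD : fnorm (W *m D) <= 6%:R * e by rewrite (fnormUM _ hW).
  have nWv : fnorm (W *m v) <= 2%:R * h * e by rewrite (fnormUM _ hW).
  have ncol := le_trans (fnorm_col _ j) hpre'.
  exact (fnormD_le (fnormD_le (fnormM_le (fnormM_le hpre nWD) hsuf)
    (fnormM_le (fnormM_le hpre nWv) hrow))
    (fnormM_le ncol (fnormD_le (nth1 _ hrow) (fnormM_le ng hsuf)))).
(* The tail error is preceded by [pre W T], the [pre] of the next level. *)
have q3 : fnorm (pre *m (W *m T *m d)) <= (17 * k + 1)%N%:R * h ^+ 2 * e + K * e ^+ 2.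
  by rewrite (mulmxA pre (W *m T) d).
have q4 : fnorm (pre *m R2) <= h * (B2 * e ^+ 2) := fnormM_le hpre nR2.
apply: (@le_trans _ _ (h * (e * h) + 16%:R * h ^+ 2 * e
   + ((17 * k + 1)%N%:R * h ^+ 2 * e + K * e ^+ 2 + h * (B2 * e ^+ 2)))).
  exact (fnormD_le (fnormD_le q1 q2) (fnormD_le q3 q4)).
have -> : (17 * k.+1 + 1)%N%:R = 17%:R + (17 * k + 1)%N%:R :> R.
  by rewrite -natrD; congr (_%:R); clear; lia.
set z := (17 * k + 1)%N%:R.
have -> : (17%:R + z) * h ^+ 2 * e + (h + 16%:R * h ^+ 3 + h * K + B2 + (K + h * B2)) * e ^+ 2
  = h * (e * h) + 16%:R * h ^+ 2 * e + (z * h ^+ 2 * e + K * e ^+ 2 + h * (B2 * e ^+ 2))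
    + (h + 16%:R * h ^+ 3 + h * K + B2) * e ^+ 2 by ring.
by rewrite lerDl mulr_ge0 ?sqr_ge0 // !addr_ge0 ?mulr_ge0 ?exprn_ge0.
Qed.
End Products.

(** * The initial factors *)

Section Initial.
Variable R : rcfType.
Local Notation C := (R[i]).

Definition interleaved n (W A : nat -> 'M[C]_n) m k := \prod_(m <= i < k) (W i *m A i).

(** The demands of the perturbation bound on the exact factors, with [c i] the spike column of
    factor [i]: its [e_j^T] must meet a row of norm at most 1 in the tail. The [+ 1] comes from the
    entry -1 of the extended spike. *)
Definition admissible n (h : R) (k : nat) (W A : nat -> 'M[C]_n) (c : nat -> 'I_n) : Prop :=
  [/\ forall i, W i \is unitarymx, W k = 1%:M,
      forall m, (m <= k)%N ->
        fnorm (interleaved W A 0 m) <= h /\ fnorm (interleaved W A m k) <= h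
    & forall i, (i < k)%N ->
      [/\ fnorm (A i) <= h, fnorm (row (c i) (interleaved W A i.+1 k)) <= 1
        & \sum_r normc (A i r (c i)) ^+ 2 + 1 <= h ^+ 2]].

Fixpoint represents n (W A : nat -> 'M[C]_n) (c : nat -> 'I_n) m
    (ref : seq ('M[C]_n.+1 * 'M[C]_n.+1 * 'M[C]_n)) : Prop :=
  if ref is (C0, B0, W') :: ref' then
    [/\ exists Cc Bc, [/\ exact_storage (A m) (c m) Cc Bc, C0 = core_prod n Cc & B0 = core_prod n Bc],
        W' = W m.+1 & represents W A c m.+1 ref']
  else True.

Definition factor_word (gs : nat -> seq (nat * 'M[C]_2)) (Cs Bs : nat -> cores R) m l : word R :=
  flatten [seq rcons (core_word (gs i)) (Tri (Cs i) (Bs i)) | i <- iota m l].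

Lemma lift_mx1 n : lift_mx (1%:M : 'M[C]_n) = 1%:M.
Proof. exact: emb1. Qed.

Lemma stored_near eps n (M : 'M[C]_n) j (C1 B1 : cores R) : stored eps M j C1 B1 ->
  exists Cc Bc, [/\ exact_storage M j Cc Bc, unitary_cores n C1, unitary_cores n B1,
    fnorm (core_prod n C1 - core_prod n Cc) <= n%:R * eps &
    fnorm (core_prod n B1 - core_prod n Bc) <= n%:R * eps].
Proof.
move=> [Cc [Bc [hex hs]]]; exists Cc, Bc; have [hu _ _ _] := hex.
have u1 : unitary_cores n Cc by move=> i /hu [].
have u2 : unitary_cores n Bc by move=> i /hu [].
have u3 : unitary_cores n C1 by move=> i /hs [].
have u4 : unitary_cores n B1 by move=> i /hs [].
split; [exact hex|exact u3|exact u4| |].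
  by apply: (core_prod_fnorm u3 u1) => i /hs [].
by apply: (core_prod_fnorm u4 u2) => i /hs [].
Qed.

(** All frames start as the identity; the error [n * eps] is that of a product of [n] stored
    cores. *)
Lemma initial_track eps n (A : nat -> 'M[C]_n) c gs (Cs Bs : nat -> cores R) l m : 0 <= eps ->
  (forall i, (i < m + l)%N -> wf_word n (core_word (gs i))) -> gs (m + l)%N = [::] ->
  (forall i, (m <= i < m + l)%N -> stored eps (A i) (c i) (Cs i) (Bs i)) ->
  let W := fun i => word_mx n (core_word (gs i)) in
  exists ref, [/\ size ref = l, represents W A c m ref,
    wf_word n (factor_word gs Cs Bs m l)
    & track (n%:R * eps) 1%:M (factor_word gs Cs Bs m l) (W m) ref 1%:M].
Proof.
move=> eps0 hwf hend hst W; elim: l m hwf hend hst => [|l IH] m hwf hend hst.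
  exists [::]; split=> //; rewrite /= /W -[in gs m](addn0 m) hend /core_word /= /word_mx big_nil.
  by split=> //; rewrite mulmx1 subrr fnorm0 mulr_ge0.
have hm : (m <= m < m + l.+1)%N by rewrite leqnn addnS ltnS leq_addr.
have [||| ref [hs hr hw ht]] := IH m.+1.
- by move=> i hi; apply: hwf; rewrite addnS -addSn.
- by rewrite addSnnS.
- by move=> i /andP [h1 h2]; apply: hst; rewrite (ltnW h1) addnS -addSn.
have [Cc [Bc [hex uC uB nC nB]]] := stored_near (hst m hm).
have hg : wf_word n (core_word (gs m)) by apply: hwf; case/andP: hm.
have u1 := @unitarymx1 R n; have u1' := @unitarymx1 R n.+1.
exists ((core_prod n Cc, core_prod n Bc, W m.+1) :: ref); split.
- by rewrite /= hs.
- by split; [exists Cc, Bc| |].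
- rewrite /factor_word /= -cats1 -catA; apply/wf_cat.
  exact (conj hg (conj (conj uC uB) hw)).
rewrite /factor_word /= -cats1 -catA track_core_word mul1mx.
exists 1%:M, 1%:M, 1%:M; split; first by split; [exact u1|exact u1|exact u1'|rewrite /fixes_first mul1mx].
rewrite lift_mx1 hadjmx1 !mul1mx !mulmx1; split; [|exact nC|exact nB|exact ht].
by rewrite subrr fnorm0 mulr_ge0.
Qed.

Lemma represents_nominal n (W A : nat -> 'M[C]_n) c m k ref : (m + size ref)%N = k ->
  represents W A c m ref -> W k = 1%:M -> nominal (W m) ref = interleaved W A m k.
Proof.
rewrite /interleaved; elim: ref m => [|[[C0 B0] W'] ref IH] m /=.
  by rewrite addn0 => -> _ ->; rewrite big_geq.
rewrite addnS -addSn => hk [[Cc [Bc [[_ _ _ hA] -> ->]]] -> hr] hW.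
rewrite big_ltn; last by rewrite -hk leq_addr.
rewrite (IH _ hk hr hW) -tri_mxE -hA.
by rewrite -[RHS]/(_ *m _) mulmxA.
Qed.

Lemma represents_well_scaled n (h : R) (W A : nat -> 'M[C]_n) c k : 0 <= h ->
  admissible h k W A c ->
  forall m ref, (m + size ref)%N = k -> represents W A c m ref ->
  well_scaled h (interleaved W A 0 m) (W m) ref.
Proof.
move=> h0 [hW hWk hp hi] m ref; elim: ref m => [|[[C0 B0] W'] ref IH] m hk hr.
  have hm : (m <= k)%N by rewrite -hk leq_addr.
  have [h1 h2] := hp m hm.
  split; [exact (hW m)|exact h1| |exact I].
  by rewrite (represents_nominal hk hr hWk).
have hm : (m < k)%N by rewrite -hk /= addnS ltnS leq_addr.
have [h1 h2] := hp m (ltnW hm).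
have [h3 h4 h5] := hi m hm.
have e1 := represents_nominal hk hr hWk.
have hk' : (m.+1 + size ref)%N = k by rewrite -hk /= addSnnS.
case: hr => -[Cc [Bc [hex eC eB]]] eW hr.
have e2 := represents_nominal hk' hr hWk.
have hA : recovered_mx C0 B0 = A m by case: hex => _ _ _ ->; rewrite eC eB tri_mxE.
split; [exact (hW m)|exact h1|by rewrite e1|].
rewrite hA eW; split; [exact h3| |].
  exists (c m); last by rewrite e2.
  rewrite eC eB; apply: (exact_storage_rolled h0 h5).
  exact hex.
have := IH m.+1 hk' hr; rewrite /interleaved big_nat_recr //=.
Qed.

(** The corner has modulus [1 / normc al >= 1 / h], which exceeds [e] because [e * h <= 1/2]. *)
Lemma represents_corner n (h e : R) (W A : nat -> 'M[C]_n) c k : 1 <= h -> e * h <= 2^-1 ->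
  admissible h k W A c ->
  forall m ref, (m + size ref)%N = k -> represents W A c m ref -> corner_bound e ref.
Proof.
move=> h1 eh [_ _ _ hi] m ref; elim: ref m => [|[[C0 B0] W'] ref IH] m hk //=.
have hm : (m < k)%N by rewrite -hk /= addnS ltnS leq_addr.
have [_ _ h5] := hi m hm.
have hk' : (m.+1 + size ref)%N = k by rewrite -hk /= addSnnS.
move=> [[Cc [Bc [hex eC eB]]] _ hr] x; rewrite inE => /orP [/eqP -> /=|]; last exact: IH hk' hr x.
have h0 : 0 <= h by apply: le_trans ler01 h1.
have [hC _ _ hBC [al [al0 hal ha]]] := exact_storage_rolled h0 h5 hex.
have [f1 f2 _ _] := rolled_facts hC al0 hBC ha.
have : normc ((core_prod n Cc)^t* ord_max ord0) = (normc al)^-1.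
  rewrite mx_entryE -mulmxA f1 -scalemxAr f2 !mxE eqxx mulr1n mulrN mulr1 normc_opp.
  by rewrite ComplexField.Normc.normcV.
rewrite !mxE normc_conj -eC => ->.
have al_gt0 : 0 < normc al.
  rewrite lt_def normc_ge0 andbT; apply/eqP => /ComplexField.Normc.eq0_normc z.
  by rewrite z eqxx in al0.
rewrite -(ltr_pM2r al_gt0) mulVf ?gt_eqF //.
have [e0|e0] := ltP e 0.
  by apply: lt_trans ltr01; rewrite nmulr_rlt0.
apply: (@le_lt_trans _ _ (e * h)); first by rewrite ler_wpM2l.
by apply: le_lt_trans eh _; rewrite invf_lt1 ?ltr1n ?ltr0n.
Qed.
End Initial.

Section Factors.
Variable R : rcfType.
Local Notation C := (R[i]).

Lemma fnorm_le_entries n (M : 'M[C]_n) (a : R) : 0 <= a ->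
  (forall i j, normc (M i j) <= a) -> fnorm M <= n%:R * a.
Proof.
move=> a0 h; rewrite -(@ler_pXn2r _ 2) // ?nnegrE ?fnorm_ge0 ?mulr_ge0 // fnorm_sqr.
have -> : (n%:R * a) ^+ 2 = \sum_(i < n) \sum_(j < n) a ^+ 2.
  by rewrite !sumr_const !card_ord exprMn -mulrnA -natrX mulr_natl.
apply: ler_sum => i _; apply: ler_sum => j _.
by rewrite ler_pXn2r // ?nnegrE ?normc_ge0.
Qed.

(** The additional 1 is absorbed by [n + 1 <= n ^ 2], valid for [n >= 2]. *)
Lemma col_sqr_le_entries n (M : 'M[C]_n) (a : R) j : (1 < n)%N -> 1 <= a ->
  (forall i, normc (M i j) <= a) -> \sum_i normc (M i j) ^+ 2 + 1 <= (n%:R * a) ^+ 2.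
Proof.
move=> hn a1 h; have a0 : 0 <= a by apply: le_trans ler01 a1.
apply: (@le_trans _ _ (n%:R * a ^+ 2 + a ^+ 2)).
  apply: lerD; last by rewrite expr_ge1.
  have -> : n%:R * a ^+ 2 = \sum_(i < n) a ^+ 2 by rewrite sumr_const card_ord mulr_natl.
  by apply: ler_sum => i _; rewrite ler_pXn2r // ?nnegrE ?normc_ge0.
rewrite -[X in _ + X]mul1r -mulrDl exprMn ler_wpM2r ?sqr_ge0 // -natrX natr1 ler_nat.
by move: hn; clear; nia.
Qed.

Lemma normc_bool (b : bool) (a : R) : 1 <= a -> normc (b%:R : C) <= a.
Proof. by move=> a1; rewrite normc_nat; case: b => //=; apply: le_trans ler01 a1. Qed.

Lemma normc_entry n (M : 'M[C]_n) r s : normc (entry M r s) <= fnorm M.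
Proof.
rewrite /entry; case: insub => [r'|]; last by rewrite ComplexField.Normc.normc0 fnorm_ge0.
by case: insub => [s'|]; [exact: normc_le_fnorm|rewrite ComplexField.Normc.normc0 fnorm_ge0].
Qed.

Lemma swap2_unitary : swap2 R \is unitarymx.
Proof.
apply/unitarymxP/matrixP => a b; rewrite !mxE !big_ord_recl big_ord0 !mxE !conjC_nat.
by case: a => [[|[|]] ?] //; case: b => [[|[|]] ?] //; rewrite -!val_eqE /= ?(mulr0, mulr1, addr0, add0r).
Qed.

Lemma row_delta_fnorm n (M : 'M[C]_n) r s0 : (forall s, M r s = (s == s0)%:R) ->
  fnorm (row r M) <= 1.
Proof.
move=> h; suff -> : row r M = delta_mx ord0 s0 by rewrite fnorm_delta.
by apply/matrixP => i s; rewrite !mxE h ord1.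
Qed.

(** * Partial products of spike factorizations (T and the Gaussian S) *)

Section Spikes.
Variables (n k : nat) (M : 'M[C]_n).
Hypotheses (kn : (k <= n)%N) (Mu : upper_tri M).
Hypothesis Mid : forall r s : 'I_n, (s < n - k)%N -> M r s = (r == s)%:R.

Let A i := spike_factor M (n - i.+1).

(** The claimed matrix is upper triangular with the same last [m] spikes as [M], so
    [spike_factorization] applies to it. *)
Lemma spike_prefix m : (m <= k)%N ->
  \prod_(0 <= i < m) A i = \matrix_(r, s) if (s < n - m)%N then (r == s)%:R else M r s.
Proof.
move=> hm; set N := \matrix_(r, s) _.
have Nu : upper_tri N.
  move=> r s hrs; rewrite mxE; case: ifP => _; last exact: Mu.
  by rewrite -val_eqE gtn_eqF.
rewrite [RHS](@spike_factorization R n m) //; first last.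
- by move=> r s hs; rewrite mxE hs.
- exact: leq_trans hm kn.
rewrite big_mkord; apply: eq_bigr => i _; apply/matrixP => r s; rewrite !mxE.
case: ifP => // /eqP hs; have hi := ltn_ord i.
have -> // : (s < n - m)%N = false by move: hs hi hm kn; clear; lia.
Qed.

(** [spike_factorization] with all [k] spikes applies to [M] with its last [m] columns reset; the
    first [m] spike factors are then identities and drop out. *)
Lemma spike_suffix m : (m <= k)%N ->
  \prod_(m <= i < k) A i = \matrix_(r, s) if (s < n - m)%N then M r s else (r == s)%:R.
Proof.
move=> hm; set N := \matrix_(r, s) _.
have Nu : upper_tri N.
  move=> r s hrs; rewrite mxE; case: ifP => _; first exact: Mu.
  by rewrite -val_eqE gtn_eqF.
rewrite [RHS](@spike_factorization R n k) //; last first.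
  by move=> r s hs; rewrite mxE Mid //; case: ifP.
rewrite -(big_mkord xpredT (fun i => spike_factor N (n - i.+1))).
rewrite (@big_cat_nat _ _ _ m 0 k) //= [X in _ = X * _]big_nat [X in _ = X * _]big1.
  rewrite mul1r; apply: eq_big_nat => i hi; apply/matrixP => r s; rewrite !mxE.
  case: ifP => // /eqP hs.
  by have -> : (s < n - m)%N by move: hs hi kn; clear; lia.
move=> i hi; apply/matrixP => r s; rewrite !mxE; case: ifP => // /eqP hs.
have -> // : (s < n - m)%N = false by move: hs hi hm kn; clear; lia.
Qed.

Variables (Q : 'M[C]_n) (W : nat -> 'M[C]_n).
Hypothesis hWE : forall i, W i = if i == 0%N then Q else 1%:M.

Lemma spike_head l : (0 < l)%N -> interleaved W A 0 l = Q *m \prod_(0 <= i < l) A i.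
Proof.
move=> l0; rewrite {1}/interleaved big_ltn // [in RHS]big_ltn // hWE /=.
rewrite (_ : \prod_(1 <= i < l) (W i *m A i) = \prod_(1 <= i < l) A i).
  by rewrite -[LHS]/(_ *m _ *m _) -mulmxA.
rewrite big_nat [RHS]big_nat; apply: eq_bigr => i /andP [hi _].
by rewrite hWE gtn_eqF // mul1mx.
Qed.

Lemma spike_interleaved : (0 < k)%N -> interleaved W A 0 k = Q *m M.
Proof.
move=> k0; rewrite spike_head // spike_prefix //; congr (_ *m _).
by apply/matrixP => r s; rewrite mxE; case: ifP => // /Mid ->.
Qed.

Lemma spike_admissible (c : nat -> 'I_n) : (0 < k)%N -> (1 < n)%N ->
  1 <= fnorm M -> Q \is unitarymx ->
  (forall i, (i < k)%N -> (c i + i.+1)%N = n) ->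
  admissible (n%:R * fnorm M) k W A c.
Proof.
move=> k0 n1 M1 hQ hc; have M0 : 0 <= fnorm M by apply: le_trans ler01 M1.
have head := spike_head.
have tail m l : (0 < m)%N -> interleaved W A m l = \prod_(m <= i < l) A i.
  move=> m0; rewrite /interleaved big_nat [RHS]big_nat; apply: eq_bigr => i /andP [hi _].
  by rewrite hWE -[i == 0%N]negbK -lt0n (leq_trans m0 hi) /= mul1mx.
have nid : fnorm (1%:M : 'M[C]_n) <= n%:R * fnorm M.
  by apply: fnorm_le_entries => // r s; rewrite mxE; exact: normc_bool.
have pre l : (l <= k)%N -> fnorm (\prod_(0 <= i < l) A i) <= n%:R * fnorm M.
  move=> hl; rewrite spike_prefix //; apply: fnorm_le_entries => // r s; rewrite mxE.
  by case: ifP => _; [exact: normc_bool|exact: normc_le_fnorm].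
have suf l : (l <= k)%N -> fnorm (\prod_(l <= i < k) A i) <= n%:R * fnorm M.
  move=> hl; rewrite spike_suffix //; apply: fnorm_le_entries => // r s; rewrite mxE.
  by case: ifP => _; [exact: normc_le_fnorm|exact: normc_bool].
split.
- by move=> i; rewrite hWE; case: eqP => _; [exact hQ|exact (@unitarymx1 R n)].
- by rewrite hWE gtn_eqF.
- move=> m hm; have [->|m0] := posnP m.
    split; first by rewrite /interleaved big_geq //.
    by rewrite head // (fnormUM _ hQ) pre.
  by split; [rewrite head // (fnormUM _ hQ) pre|rewrite tail // suf].
move=> i hi; have ci := hc i hi; split.
- apply: fnorm_le_entries => // r s; rewrite mxE.
  by case: ifP => _; [exact: normc_le_fnorm|exact: normc_bool].
(* As [c i = n - i - 1], row [c i] of the suffix is a unit vector: left of the diagonal [M]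
   vanishes, and from column [c i] on the suffix is the identity. *)
- apply: (@row_delta_fnorm _ _ _ (c i)) => s; rewrite tail // spike_suffix // mxE.
  case: ifP => hs; last by rewrite eq_sym.
  have hsc : (s < c i)%N by move: hs ci; clear; lia.
  by rewrite Mu // -val_eqE ltn_eqF.
- apply: col_sqr_le_entries => // r; rewrite mxE.
  by case: ifP => _; [exact: normc_le_fnorm|exact: normc_bool].
Qed.
End Spikes.

(** * Partial products of the Frobenius factorization *)

Section Frobenius.
Variables (n k : nat) (S : 'M[C]_n).
Hypotheses (k0 : (0 < k)%N) (kn : (k <= n)%N).
Hypothesis Sid : forall r s : 'I_n, (s < n - k)%N -> S r s = (r == (s + k)%N :> nat)%:R.
Hypothesis Sz : forall r i : nat, (i < k)%N -> (r < i)%N -> entry S r (n - k + i) = 0.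

Let A i := frob_factor k S i.
Let Q := downshift R n.

Lemma entry_matrix (F : 'I_n -> 'I_n -> C) (r s : nat) (hr : (r < n)%N) (hs : (s < n)%N) :
  entry (\matrix_(a, b) F a b) r s = F (Ordinal hr) (Ordinal hs).
Proof. by rewrite (entryE (\matrix_(a, b) F a b) (Ordinal hr) (Ordinal hs)) mxE. Qed.

Lemma frob_prefix m : (m <= k)%N ->
  \prod_(0 <= i < m) (Q *m A i) = \matrix_(r, s)
    if (s < n - m)%N then (r == (s + m)%N :> nat)%:R else entry S r (s + m - k).
Proof.
move=> hm; set N := \matrix_(r, s) _.
have [m0|m0] := posnP m.
  rewrite m0 big_geq //; apply/matrixP => r s; rewrite /N !mxE m0 subn0 ltn_ord addn0.
  by rewrite val_eqE.
have mn := leq_trans hm kn.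
have eN a i : (a < n)%N -> (i < m)%N -> entry N a (n - m + i) = entry S a (n - k + i).
  move=> ha hi; have hs : (n - m + i < n)%N by move: hi mn; clear; lia.
  rewrite (entry_matrix _ ha hs) /=.
  have -> : (n - m + i < n - m)%N = false by clear; lia.
  by congr (entry _ _ _); move: hi mn hm kn; clear; lia.
rewrite [RHS](@frob_factorization R n m); first last.
- by move=> r i hi hr; rewrite eN ?Sz //; move: hi hr hm mn; clear; lia.
- by move=> r s hs; rewrite mxE hs.
- by rewrite m0.
rewrite big_mkord; apply: eq_bigr => i _; rewrite -[RHS]/(Q *m _); congr (_ *m _).
have hi := ltn_ord i; apply/matrixP => r s; rewrite !mxE; case: ifP => // _.
case: ifP => _; first by rewrite eN //; move: hi mn; clear; lia.
have [hr|hr] := ltnP (r + i).+1 n; first by rewrite eN.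
by rewrite !entry_out.
Qed.

(** Each removed scalar companion factor accounts for one shift of the rows, so the last columns are
    those of [S] moved up by [m], with zeros, the default of [entry], past the bottom. *)
Lemma frob_suffix m : (m <= k)%N ->
  \prod_(m <= i < k) (Q *m A i) = \matrix_(r, s)
    if (s < n - (k - m))%N then (r == (s + (k - m))%N :> nat)%:R else entry S (r + m) s.
Proof.
move=> hm; set N := \matrix_(r, s) _.
have [mk|mk] := leqP k m.
  have e : (k - m)%N = 0%N by apply/eqP; rewrite subn_eq0.
  rewrite big_geq //; apply/matrixP => r s; rewrite /N !mxE e subn0 ltn_ord addn0.
  by rewrite val_eqE.
have eN a i : (a < n)%N -> (i < k - m)%N ->
    entry N a (n - (k - m) + i) = entry S (a + m) (n - k + (i + m)).
  move=> ha hi; have hs : (n - (k - m) + i < n)%N by move: hi kn mk; clear; lia.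
  rewrite (entry_matrix _ ha hs) /=.
  have -> : (n - (k - m) + i < n - (k - m))%N = false by clear; lia.
  by congr (entry _ _ _); move: hi kn mk; clear; lia.
rewrite [RHS](@frob_factorization R n (k - m)); first last.
- by move=> r i hi hr; rewrite eN ?Sz //; move: hi hr hm kn; clear; lia.
- by move=> r s hs; rewrite mxE hs.
- by rewrite subn_gt0 mk (leq_trans (leq_subr _ _) kn).
rewrite -{1}(add0n m) big_addn big_mkord; apply: eq_bigr => i _.
rewrite -[RHS]/(Q *m _); congr (_ *m _).
have hi := ltn_ord i; apply/matrixP => r s; rewrite !mxE; case: ifP => // _.
case: ifP => _; first by rewrite eN //; move: hi kn; clear; lia.
have [hr|hr] := ltnP (r + i).+1 n; first by rewrite eN // addSn addnA.
by rewrite !entry_out // addnA; apply: leq_trans hr _; clear; lia.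
Qed.

Lemma downshift_unitary : Q \is unitarymx.
Proof.
rewrite /Q -word_mx_downshift /word_mx /downshift_word big_map big_seq.
apply: prodmx_unitary => i; rewrite mem_iota => hi; apply: coremx_unitary.
  by move: hi; clear; lia.
exact swap2_unitary.
Qed.

Variable W : nat -> 'M[C]_n.
Hypothesis hWE : forall i, W i = if (i < k)%N then Q else 1%:M.

Lemma frob_interleavedE m l : (l <= k)%N -> interleaved W A m l = \prod_(m <= i < l) (Q *m A i).
Proof.
move=> hl; rewrite /interleaved big_nat [RHS]big_nat; apply: eq_bigr => i /andP [_ hi].
by rewrite hWE (leq_trans hi hl).
Qed.

Lemma frob_interleaved : interleaved W A 0 k = S.
Proof.
rewrite frob_interleavedE // frob_prefix //; apply/matrixP => r s; rewrite mxE.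
by rewrite addnK entryE; case: ifP => // /Sid ->.
Qed.

Lemma frob_admissible (c : nat -> 'I_n) : (1 < n)%N -> 1 <= fnorm S ->
  (forall i, (i < k)%N -> (c i).+1 = n) ->
  admissible (n%:R * fnorm S) k W A c.
Proof.
move=> n1 S1 hc; have S0 : 0 <= fnorm S by apply: le_trans ler01 S1.
have WA := frob_interleavedE.
have hA i r s : normc (A i r s) <= fnorm S.
  rewrite mxE; case: ifP => _; last exact: normc_bool.
  by case: ifP => _; exact: normc_entry.
split.
- by move=> i; rewrite hWE; case: ifP => _; [exact downshift_unitary|exact (@unitarymx1 R n)].
- by rewrite hWE ltnn.
- move=> m hm; rewrite !WA // frob_prefix // frob_suffix //.
  split; apply: fnorm_le_entries => // r s; rewrite mxE.
    by case: ifP => _; [exact: normc_bool|exact: normc_entry].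
  by case: ifP => _; [exact: normc_bool|exact: normc_entry].
move=> i hi; have ci := hc i hi; split.
- exact: fnorm_le_entries.
(* The last row of the suffix is a unit vector: in the spike columns it reads past the bottom of
   [S], and the shift part has its 1 in this column or, when [i.+1 = k], the suffix is the
   identity. *)
- have hs0 : (n.-1 - (k - i.+1) < n)%N by move: n1; clear; lia.
  apply: (@row_delta_fnorm _ _ _ (Ordinal hs0)) => s; rewrite WA // frob_suffix // mxE.
  have hs := ltn_ord s; case: ifP => h.
    congr (_ %:R); rewrite -val_eqE /=; move: ci h hi kn hs; clear; lia.
  rewrite entry_out; last by move: ci; clear; lia.
  by rewrite -val_eqE /=; have -> : (s == n.-1 - (k - i.+1) :> nat)%N = false
    by move: h hs hi kn n1; clear; lia.
- exact: col_sqr_le_entries.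
Qed.
End Frobenius.
End Factors.

(** * The preprocessing equivalence *)

Section Blocks.
Variable R : rcfType.
Local Notation C := (R[i]).
Variables d k : nat.

Fact block_index_proof (p : 'I_d) (o : 'I_k) : (p * k + o < d * k)%N.
Proof.
have hp := ltn_ord p; apply: leq_trans (_ : p.+1 * k <= d * k)%N; last by rewrite leq_mul2r hp orbT.
by rewrite mulSn addnC ltn_add2r.
Qed.

Definition block_index (p : 'I_d) (o : 'I_k) : 'I_(d * k) := Ordinal (block_index_proof p o).

Lemma block_posK p o : block_pos (block_index p o) = p.
Proof.
apply/val_inj; rewrite /= divnMDl; last by apply: leq_ltn_trans (ltn_ord o).
by rewrite divn_small ?addn0.
Qed.

Lemma block_offK p o : block_off (block_index p o) = o.
Proof. by apply/val_inj; rewrite /= modnMDl modn_small. Qed.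

Lemma block_indexK (r : 'I_(d * k)) : block_index (block_pos r) (block_off r) = r.
Proof. by apply/val_inj; rewrite /= -divn_eq. Qed.

Definition blockmx (F : 'I_d -> 'I_d -> 'M[C]_k) : 'M[C]_(d * k) :=
  \matrix_(r, s) F (block_pos r) (block_pos s) (block_off r) (block_off s).

Lemma blockmxM F G :
  blockmx F *m blockmx G = blockmx (fun p q => \sum_l F p l *m G l q).
Proof.
apply/matrixP => r s; rewrite [LHS]mxE.
rewrite (reindex (fun x : 'I_d * 'I_k => block_index x.1 x.2)) /=; last first.
  exists (fun l => (block_pos l, block_off l)) => [[p o] _|l _] /=.
    by rewrite block_posK block_offK.
  exact: block_indexK.
rewrite [RHS]mxE summxE.
rewrite -(pair_bigA _ (fun p o => blockmx F r (block_index p o) * blockmx G (block_index p o) s)) /=.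
apply: eq_bigr => p _; rewrite [RHS]mxE; apply: eq_bigr => o _.
by rewrite !mxE block_posK block_offK.
Qed.

Lemma blockmx_adj F : (blockmx F)^t* = blockmx (fun p q => (F q p)^t*).
Proof. by apply/matrixP => r s; rewrite !mxE. Qed.

Lemma eq_blockmx F G : (forall p q, F p q = G p q) -> blockmx F = blockmx G.
Proof. by move=> h; apply/matrixP => r s; rewrite !mxE h. Qed.

Definition block_diag (D : 'I_d -> 'M[C]_k) : 'M[C]_(d * k) :=
  blockmx (fun p q => if p == q then D p else 0).

Lemma block_diagM D F : block_diag D *m blockmx F = blockmx (fun p q => D p *m F p q).
Proof.
rewrite blockmxM; apply: eq_blockmx => p q; rewrite (bigD1 p) //= eqxx big1 ?addr0 //.
by move=> l hl; rewrite eq_sym (negbTE hl) mul0mx.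
Qed.

Lemma mul_block_diag D F : blockmx F *m block_diag D = blockmx (fun p q => F p q *m D q).
Proof.
rewrite blockmxM; apply: eq_blockmx => p q; rewrite (bigD1 q) //= eqxx big1 ?addr0 //.
by move=> l hl; rewrite (negbTE hl) mulmx0.
Qed.

Lemma block_diag_adj D : (block_diag D)^t* = block_diag (fun p => (D p)^t*).
Proof.
rewrite blockmx_adj; apply: eq_blockmx => p q; rewrite eq_sym; case: eqP => [->//|_].
by apply/matrixP => i j; rewrite !mxE conjC0.
Qed.

Lemma block_diag_unitary D : (forall p, D p \is unitarymx) -> block_diag D \is unitarymx.
Proof.
move=> h; apply/unitarymxP; rewrite block_diag_adj [block_diag (fun p => _^t*)]/block_diag block_diagM.
apply/matrixP => r s; rewrite [LHS]mxE [RHS]mxE.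
have [e|ne] := eqVneq (block_pos r) (block_pos s).
  rewrite e (mulUhadj (h _)) mxE; congr (_ %:R).
  by rewrite -[in RHS](block_indexK r) -[in RHS](block_indexK s) e -[in RHS]val_eqE -[in LHS]val_eqE /= eqn_add2l.
rewrite mulmx0 mxE; have -> // : (r == s) = false.
by apply/eqP => e; rewrite e eqxx in ne.
Qed.

Lemma companion_S_blocks (M : nat -> 'M[C]_k) : companion_S d M =
  blockmx (fun p q => if (q.+1 == d)%N then - M p else ((p == q.+1 :> nat) : bool)%:R%:M).
Proof.
apply/matrixP => r s; rewrite !mxE; case: ifP => _; first by rewrite !mxE.
by rewrite mxE; case: (_ == _.+1 :> nat); case: (block_off r == block_off s).
Qed.

Lemma companion_T_blocks (N : nat -> 'M[C]_k) : companion_T d N =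
  blockmx (fun p q => if (q.+1 == d)%N then N p.+1 else ((p == q) : bool)%:R%:M).
Proof.
apply/matrixP => r s; rewrite !mxE; case: ifP => _ //.
rewrite mxE -[in LHS](block_indexK r) -[in LHS](block_indexK s).
have [->|ne] := eqVneq (block_pos r) (block_pos s).
  by rewrite -val_eqE -[block_off r == _]val_eqE /= eqn_add2l; case: (r %% k == s %% k)%N.
rewrite mul0rn; have -> // : (block_index (block_pos r) (block_off r) == block_index (block_pos s) (block_off s)) = false.
by apply/eqP => /(congr1 (@block_pos d k)); rewrite !block_posK => e; rewrite e eqxx in ne.
Qed.

Variables A B : 'M[C]_k.
Hypotheses (hA : A \is unitarymx) (hB : B \is unitarymx).

Definition equiv_left := block_diag (fun=> A).
Definition equiv_right := block_diag (fun q => if (q.+1 == d)%N then B else A).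

Lemma equiv_left_unitary : equiv_left \is unitarymx.
Proof. by apply: block_diag_unitary => _; exact hA. Qed.

Lemma equiv_right_unitary : equiv_right \is unitarymx.
Proof. by apply: block_diag_unitary => q; case: ifP => _; [exact hB|exact hA]. Qed.

(** In the first [d - 1] block columns both sides carry [A], which cancels on the identity blocks;
    only the last block column meets [B]. *)
Lemma companion_equiv (F : 'I_d -> 'M[C]_k) (b : 'I_d -> 'I_d -> bool) :
  equiv_left^t* *m blockmx (fun p q => if (q.+1 == d)%N then F p else (b p q)%:R%:M) *m equiv_right
  = blockmx (fun p q => if (q.+1 == d)%N then A^t* *m F p *m B else (b p q)%:R%:M).
Proof.
rewrite block_diag_adj block_diagM mul_block_diag; apply: eq_blockmx => p q.
case: ifP => // _; rewrite mul_mx_scalar -scalemxAl (mulhadjU hA).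
by rewrite scalemx1.
Qed.

Lemma companion_S_equiv (M : nat -> 'M[C]_k) :
  companion_S d (fun j => A^t* *m M j *m B) = equiv_left^t* *m companion_S d M *m equiv_right.
Proof.
rewrite !companion_S_blocks (companion_equiv (fun p => - M p)); apply: eq_blockmx => p q.
by rewrite mulmxN mulNmx.
Qed.

Lemma companion_T_equiv (N : nat -> 'M[C]_k) :
  companion_T d (fun j => A^t* *m N j *m B) = equiv_left^t* *m companion_T d N *m equiv_right.
Proof. by rewrite !companion_T_blocks (companion_equiv (fun p => N p.+1)). Qed.
End Blocks.

(** * Backward error of a complete run *)

Section Backward.
Variable R : rcfType.
Local Notation C := (R[i]).

(** Starting condition common to [T] and to both factorizations of [S], with identity outer
    frames. *)
Definition tracks_from n (eps h : R) k (S : 'M[C]_n) (w : word R) : Prop :=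
  exists W A c ref,
    [/\ admissible h k W A c, size ref = k, represents W A c 0 ref,
        interleaved W A 0 k = S /\ wf_word n w
      & track (n%:R * eps) 1%:M w (W 0%N) ref 1%:M].

Lemma factor_word_head g (Cs Bs : nat -> cores R) k : (0 < k)%N ->
  factor_word (fun i => if i == 0%N then g else [::]) Cs Bs 0 k
  = core_word g ++ tri_word k Cs Bs.
Proof.
case: k => // k _; rewrite /factor_word /tri_word /= -cats1 -catA /=; congr (_ ++ (_ :: _)).
transitivity (flatten [seq [:: Tri (Cs i) (Bs i)] | i <- iota 1 k]).
  by congr flatten; apply/eq_in_map => i; rewrite mem_iota => /andP [hi _]; rewrite gtn_eqF.
by elim: (iota 1 k) => //= i s ->.
Qed.

Lemma spike_tracks n k eps (M : 'M[C]_n) g (Cs Bs : nat -> cores R) :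
  (0 < k)%N -> (k <= n)%N -> (1 < n)%N -> 0 <= eps -> 1 <= fnorm M -> upper_tri M ->
  (forall r s : 'I_n, (s < n - k)%N -> M r s = (r == s)%:R) ->
  wf_word n (core_word g) ->
  (forall (i : nat) (j : 'I_n), (i < k)%N -> (j + i.+1)%N = n ->
     stored eps (spike_factor M j) j (Cs i) (Bs i)) ->
  tracks_from eps (n%:R * fnorm M) k (word_mx n (core_word g) *m M)
    (core_word g ++ tri_word k Cs Bs).
Proof.
move=> k0 kn n1 eps0 M1 Mu Mid hg hst; have n0 := ltnW n1.
pose c i : 'I_n := insubd (Ordinal n0) (n - i.+1)%N.
have hc i : (i < k)%N -> (c i + i.+1)%N = n.
  move=> hi; rewrite val_insubd; have -> : (n - i.+1 < n)%N by rewrite ltn_subrL.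
  by move: hi kn; clear; lia.
pose gs i : seq (nat * 'M[C]_2) := if i == 0%N then g else [::].
pose W i := word_mx n (core_word (gs i)).
have hW i : W i = if i == 0%N then word_mx n (core_word g) else 1%:M.
  by rewrite /W /gs; case: eqP => // _; rewrite /core_word /= /word_mx big_nil.
have hgs i : wf_word n (core_word (gs i)) by rewrite /gs; case: eqP.
have hs i : (0 <= i < 0 + k)%N -> stored eps (spike_factor M (n - i.+1)) (c i) (Cs i) (Bs i).
  move=> /andP [_ hi]; rewrite add0n in hi; have e := hc i hi.
  by have -> : (n - i.+1 = c i)%N; [move: e; clear; lia|apply: hst].
have hend : gs (0 + k)%N = [::] by rewrite /gs add0n gtn_eqF.
have [ref [h1 h2 h3 h4]] :=
  initial_track (A := fun i => spike_factor M (n - i.+1)) eps0 (fun i _ => hgs i) hend hs.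
exists W, (fun i => spike_factor M (n - i.+1)), c, ref.
rewrite factor_word_head // in h3 h4; split; [|exact h1|exact h2| |exact h4].
  exact (spike_admissible kn Mu Mid hW k0 n1 M1 (core_word_unitary hg) hc).
split; [exact (spike_interleaved kn Mu Mid hW k0)|exact h3].
Qed.

Lemma downshift_core_word n :
  downshift_word R n = core_word [seq (i, swap2 R) | i <- iota 0 n.-1].
Proof. by rewrite /core_word -map_comp. Qed.

Lemma downshift_word_wf n : wf_word n (downshift_word R n).
Proof.
rewrite downshift_core_word; apply: wf_cores; apply/allP => x /mapP [i hi ->] /=.
apply/andP; split; last exact (swap2_unitary R).
by move: hi; rewrite mem_iota; clear; lia.
Qed.

Lemma frob_tracks n k eps (S : 'M[C]_n) (Cs Bs : nat -> cores R) :
  (0 < k)%N -> (k <= n)%N -> (1 < n)%N -> 0 <= eps -> 1 <= fnorm S ->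
  (forall r s : 'I_n, (s < n - k)%N -> S r s = (r == (s + k)%N :> nat)%:R) ->
  (forall r i : nat, (i < k)%N -> (r < i)%N -> entry S r (n - k + i) = 0) ->
  (forall (i : nat) (j : 'I_n), (i < k)%N -> j.+1 = n ->
     stored eps (frob_factor k S i) j (Cs i) (Bs i)) ->
  tracks_from eps (n%:R * fnorm S) k S
    (flatten [seq rcons (downshift_word R n) (Tri (Cs i) (Bs i)) | i <- iota 0 k]).
Proof.
move=> k0 kn n1 eps0 S1 Sid Sz hst; have n0 := ltnW n1.
have hl : (n.-1 < n)%N by rewrite prednK.
pose c (i : nat) : 'I_n := Ordinal hl.
have hc i : (i < k)%N -> (c i).+1 = n by move=> _; rewrite /= prednK.
pose g := [seq (i, swap2 R) | i <- iota 0 n.-1].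
pose gs i : seq (nat * 'M[C]_2) := if (i < k)%N then g else [::].
pose W i := word_mx n (core_word (gs i)).
have hW i : W i = if (i < k)%N then downshift R n else 1%:M.
  rewrite /W /gs; case: ifP => // _; last by rewrite /core_word /= /word_mx big_nil.
  by rewrite -downshift_core_word word_mx_downshift.
have hgs i : wf_word n (core_word (gs i)).
  by rewrite /gs; case: ifP => // _; rewrite -downshift_core_word; exact: downshift_word_wf.
have hs i : (0 <= i < 0 + k)%N -> stored eps (frob_factor k S i) (c i) (Cs i) (Bs i).
  by move=> /andP [_ hi]; apply: hst; rewrite //= prednK.
have hend : gs (0 + k)%N = [::] by rewrite /gs add0n ltnn.
have [ref [h1 h2 h3 h4]] :=
  initial_track (A := frob_factor k S) eps0 (fun i _ => hgs i) hend hs.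
have ew : factor_word gs Cs Bs 0 k
   = flatten [seq rcons (downshift_word R n) (Tri (Cs i) (Bs i)) | i <- iota 0 k].
  congr flatten; apply/eq_in_map => i; rewrite mem_iota => /andP [_ hi].
  by rewrite add0n in hi; rewrite /gs hi -downshift_core_word.
exists W, (frob_factor k S), c, ref.
rewrite ew in h3 h4; split; [|exact h1|exact h2| |exact h4].
  exact (frob_admissible kn Sz hW n1 S1 hc).
split; [exact (frob_interleaved kn Sid Sz hW)|exact h3].
Qed.

Lemma backward_error (h : R) k : 1 <= h -> exists2 K : R, 0 <= K &
  forall n (S L Z : 'M[C]_n) W A c ref (w : word R) (e : R),
  admissible h k W A c -> size ref = k -> represents W A c 0 ref ->
  interleaved W A 0 k = S -> 0 <= e -> e * h <= 2^-1 ->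
  L \is unitarymx -> Z \is unitarymx -> wf_word n w -> track e L w (W 0%N) ref Z ->
  nondegenerate n w /\ exists dS,
    word_mx n w = L^t* *m (S + dS) *m Z /\
    fnorm dS <= (17 * k + 1)%N%:R * h ^+ 2 * e + K * e ^+ 2.
Proof.
move=> h1; have [K K0 hK] := @perturbed_bound R h k h1; exists K => //.
move=> n S L Z W A c ref w e had hs hr hS e0 eh hL hZ hw ht.
have h0 : 0 <= h := le_trans ler01 h1.
have hk : (0 + size ref)%N = k by rewrite add0n.
split; first exact (track_nondegenerate (represents_corner h1 eh had hk hr) ht).
have [P hP eP] := track_perturbed hL hZ hw ht.
have [_ b] := hK n ref _ _ P e hs e0 eh (represents_well_scaled h0 had hk hr) hP.
have hWk : W k = 1%:M by case: had.
move: b; rewrite (represents_nominal hk hr hWk) hS /interleaved big_geq // mul1mx => b.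
exists (P - S); split; last exact b.
by rewrite addrC subrK -mulmxA -eP mulmxA (mulhadjU hL) mul1mx.
Qed.

Lemma hess_tri_cores n k (G : cores R) (RC RB TC TB : nat -> cores R) i H :
  List.In (Core i H) (hess_tri_word n k G RC RB TC TB).1 -> (i.+1 < n)%N /\ H = G i.
Proof.
rewrite /hess_tri_word /=.
have h0 (s : seq nat) : List.In (Core i H) [seq Tri (RC i) (RB i) | i <- s] -> False.
  by elim: s => //= a s IH [].
have h1 (s : seq nat) r : (forall a, a \in s -> (a.+1 < n)%N) ->
    (List.In (Core i H) r -> False) ->
    List.In (Core i H) ([seq Core i (G i) | i <- s] ++ r) -> (i.+1 < n)%N /\ H = G i.
  move=> hs hr; elim: s hs => [_ /hr //|a s IH hs] [[<- <-]|]; first by rewrite hs ?mem_head.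
  by apply: IH => b hb; apply: hs; rewrite inE hb orbT.
apply: h1; last exact: h0.
by move=> a; rewrite mem_iota; clear; lia.
Qed.

Lemma tri_word_cores k (TC TB : nat -> cores R) i H : ~ List.In (Core i H) (tri_word k TC TB).
Proof. by rewrite /tri_word; elim: (iota 0 k) => //= a s IH []. Qed.

(** [e] is the whole error budget, [n * eps] for the initial storage and [eps] for each counted
    operation. *)
Lemma run_backward (hS hT : R) k : 1 <= hS -> 1 <= hT -> exists2 K : R, 0 <= K &
  forall n kind eps m (S T Sh Th : 'M[C]_n) (e : R), 0 <= eps ->
  (forall st, initial_state eps kind k S T st ->
     tracks_from eps hS k S st.1 /\ tracks_from eps hT k T st.2) ->
  n%:R * eps + m%:R * eps <= e -> e * hS <= 2^-1 -> e * hT <= 2^-1 ->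
  computed_schur eps m kind k S T Sh Th ->
  exists L Z dS dT, [/\ [/\ L \is unitarymx, Z \is unitarymx, upper_tri Sh & upper_tri Th],
    Sh = L^t* *m (S + dS) *m Z, Th = L^t* *m (T + dT) *m Z,
    fnorm dS <= (17 * k + 1)%N%:R * hS ^+ 2 * e + K * e ^+ 2 &
    fnorm dT <= (17 * k + 1)%N%:R * hT ^+ 2 * e + K * e ^+ 2].
Proof.
move=> hS1 hT1; have [KS KS0 bS] := @backward_error hS k hS1.
have [KT KT0 bT] := @backward_error hT k hT1.
exists (KS + KT); first by rewrite addr_ge0.
move=> n kind eps m S T Sh Th e eps0 hinit he eS eT.
move=> [st0 [st1 [st2 [m1 [m2 [h0 [h1 _] [h2 h3] hm [-> ->]]]]]]].
have [[WS [AS [cS [refS [S1 S2 S3 [S4 S5] S6]]]]]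
      [WT [AT [cT [refT [T1 T2 T3 [T4 T5] T6]]]]]] := hinit st0 h0.
have e0 : 0 <= e by apply: le_trans he; rewrite addr_ge0 ?mulr_ge0.
have t0 : tracked (n%:R * eps) st0 (WS 0%N) refS (WT 0%N) refT.
  split; [exact S5|exact T5|exists 1%:M, 1%:M; split; [|  |exact S6|exact T6]]; exact (@unitarymx1 R n).
have [w1 w2 [L [Z [hL hZ t1 t2]]]] :=
  qr_iteration_tracked h2 eps0 (chase_tracked h1 eps0 t0).
have ee : n%:R * eps + m1%:R * eps + m2%:R * eps <= e.
  by move: he; rewrite hm natrD mulrDl addrA.
have [nS [dS [eqS ndS]]] := bS n S L Z _ _ _ _ _ e S1 S2 S3 S4 e0 eS hL hZ w1 (track_le ee t1).
have [nT [dT [eqT ndT]]] := bT n T L Z _ _ _ _ _ e T1 T2 T3 T4 e0 eT hL hZ w2 (track_le ee t2).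
have K1 : KS * e ^+ 2 <= (KS + KT) * e ^+ 2 by rewrite ler_wpM2r ?sqr_ge0 // lerDl.
have K2 : KT * e ^+ 2 <= (KS + KT) * e ^+ 2 by rewrite ler_wpM2r ?sqr_ge0 // lerDr.
exists L, Z, dS, dT; split; [|exact eqS|exact eqT| |].
- case: h3 => G [RC [RB [TC [TB [hG est]]]]].
  split; [exact hL|exact hZ| |].
    apply: word_mx_upper w1 nS => i H; rewrite est => /hess_tri_cores [hi ->].
    exact: hG.
  by apply: word_mx_upper w2 nT => i H; rewrite est => /tri_word_cores.
- by apply: le_trans ndS _; rewrite lerD2l.
- by apply: le_trans ndT _; rewrite lerD2l.
Qed.
End Backward.

(** * Block companion pencils as starting data *)

Section Companion.
Variable R : rcfType.
Local Notation C := (R[i]).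
Variables d k : nat.
Hypotheses (d1 : (1 < d)%N) (k0 : (0 < k)%N).

Let n := (d * k)%N.

Lemma block_size_le : (k <= n)%N.
Proof. by rewrite /n leq_pmull // ltnW. Qed.

Lemma block_dim_gt1 : (1 < n)%N.
Proof. by rewrite /n; move: d1 k0; clear; nia. Qed.

Lemma last_block_pos (r : 'I_(d * k)) : (n - k <= r)%N -> (block_pos r).+1 = d.
Proof. by rewrite /n -last_block_col => /eqP. Qed.

Lemma first_block_small : (k < n)%N.
Proof. by rewrite /n; move: d1 k0; clear; nia. Qed.

Lemma companion_T_left (N : nat -> 'M[C]_k) (r s : 'I_(d * k)) :
  (s < n - k)%N -> companion_T d N r s = (r == s)%:R.
Proof. by move=> hs; rewrite mxE last_block_col leqNgt hs. Qed.

Lemma companion_T_upper (N : nat -> 'M[C]_k) : upper_tri (N d) -> upper_tri (companion_T d N).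
Proof.
move=> Nu r s hsr; have [hs|hs] := ltnP s (n - k).
  by rewrite companion_T_left // -val_eqE gtn_eqF.
have er := last_block_pos (leq_trans hs (ltnW hsr)); have es := last_block_pos hs.
rewrite mxE es eqxx er; apply: Nu.
have ep : block_pos s = block_pos r :> nat by apply: succn_inj; rewrite es er.
by move: hsr; rewrite {1}(block_posE s) {1}(block_posE r) ep ltn_add2l.
Qed.

(** For [d > 1] an identity block column remains. The resulting [h >= 1] lets lower powers of [h] be
    absorbed into [h ^+ 2]. *)
Lemma companion_T_ge1 (N : nat -> 'M[C]_k) : 1 <= fnorm (companion_T d N).
Proof.
have h0 : (0 < d * k)%N := ltnW block_dim_gt1.
have hs : (Ordinal h0 < n - k)%N by rewrite /= subn_gt0 first_block_small.
apply: le_trans (normc_le_fnorm _ (Ordinal h0) (Ordinal h0)).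
by rewrite companion_T_left // eqxx ComplexField.Normc.normc1.
Qed.

Lemma companion_S_ge1 (M : nat -> 'M[C]_k) : 1 <= fnorm (companion_S d M).
Proof.
have h0 : (0 < d * k)%N := ltnW block_dim_gt1.
have hs : (Ordinal h0 < n - k)%N by rewrite /= subn_gt0 first_block_small.
apply: le_trans (normc_le_fnorm _ (Ordinal first_block_small) (Ordinal h0)).
by rewrite companion_S_left // eqxx ComplexField.Normc.normc1.
Qed.

Lemma companion_S_first_rows (M : nat -> 'M[C]_k) (r s : 'I_(d * k)) :
  (r < k)%N -> (n - k <= s)%N ->
  exists a b : 'I_k, [/\ (r = a :> nat), (s = n - k + b :> nat)%N
    & companion_S d M r s = - M 0%N a b].
Proof.
move=> hr hs; exists (block_off r), (block_off s); have es := last_block_pos hs.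
split.
- by rewrite /= modn_small.
- rewrite [LHS]block_posE; congr (_ + _)%N.
  move: es; rewrite /n; move: (nat_of_ord (block_pos s)) => p <-.
  by rewrite mulSn addKn.
- by rewrite mxE es eqxx /= divn_small.
Qed.

Lemma companion_S_lower (M : nat -> 'M[C]_k) : lower_tri (M 0%N) ->
  forall r i : nat, (i < k)%N -> (r < i)%N -> entry (companion_S d M) r (n - k + i) = 0.
Proof.
move=> Ml r i hi hri.
have hr : (r < d * k)%N by exact: leq_trans (ltn_trans hri hi) block_size_le.
have hs : (n - k + i < d * k)%N by have := block_size_le; rewrite /n; move: hi; clear; lia.
rewrite (entryE (companion_S d M) (Ordinal hr) (Ordinal hs)).
have [a [b [ea eb ->]]] := companion_S_first_rows M (r := Ordinal hr) (s := Ordinal hs)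
  (ltn_trans hri hi) (leq_addr i _).
rewrite Ml ?oppr0 //; move: ea eb hri => /= -> /eqP; rewrite eqn_add2l => /eqP ->; exact.
Qed.

Let M0 (M : nat -> 'M[C]_k) := ((downshift R n)^t*) ^+ k *m companion_S d M.

Lemma upshift_S_left M (r s : 'I_(d * k)) : (s < n - k)%N -> M0 M r s = (r == s)%:R.
Proof.
move=> hs; rewrite /M0 upshift_exp_entry.
have hp : ((r + k) %% n < d * k)%N by rewrite ltn_mod ltnW ?block_dim_gt1.
rewrite (entryE (companion_S d M) (Ordinal hp) s) companion_S_left //=.
congr (_ %:R); rewrite -val_eqE /=; congr nat_of_bool.
have hr : (r < n)%N := ltn_ord r; have kn := block_size_le.
have [h2|h2] := ltnP (r + k) n.
  by rewrite modn_small // eqn_add2r.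
have -> : (r + k = (r + k - n) + n)%N by rewrite subnK.
rewrite modnDr modn_small; move: hs hr kn h2; clear; lia.
Qed.

(** [Q^-k] moves the first [k] rows to the bottom, so that the negated block [M 0] becomes the last
    diagonal block. *)
Lemma upshift_S_upper M : upper_tri (M 0%N) -> upper_tri (M0 M).
Proof.
move=> Mu r s hsr; have [hs|hs] := ltnP s (n - k).
  by rewrite upshift_S_left // -val_eqE gtn_eqF.
rewrite /M0 upshift_exp_entry; have hr : (r < n)%N := ltn_ord r; have kn := block_size_le.
have e : ((r + k) %% n = r - (n - k))%N.
  have -> : (r + k = (r - (n - k)) + n)%N by move: hs hsr kn; clear; lia.
  rewrite modnDr modn_small //; move: hr; clear; lia.
have hp : ((r + k) %% n < d * k)%N by rewrite ltn_mod ltnW ?block_dim_gt1.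
rewrite (entryE (companion_S d M) (Ordinal hp) s).
have hrk : (Ordinal hp < k)%N by rewrite /= e; move: hr kn k0; clear; lia.
have [a [b [ea eb ->]]] := companion_S_first_rows M hrk hs.
rewrite Mu ?oppr0 //; move: ea eb => /=; rewrite e => <- eb.
move: hs hsr eb; rewrite /n; lia.
Qed.

Lemma initial_tracks_from eps (M N : nat -> 'M[C]_k) kind st : 0 <= eps ->
  preprocessed kind d M N ->
  initial_state eps kind k (companion_S d M) (companion_T d N) st ->
  tracks_from eps (n%:R * fnorm (companion_S d M)) k (companion_S d M) st.1 /\
  tracks_from eps (n%:R * fnorm (companion_T d N)) k (companion_T d N) st.2.
Proof.
move=> eps0 [Nu hM] [RC [RB [TC [TB [hT -> hS]]]]].
have kn := block_size_le; have n1 := block_dim_gt1.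
split; last first.
  have h := @spike_tracks R _ _ _ _ [::] TC TB k0 kn n1 eps0 (companion_T_ge1 N)
    (companion_T_upper Nu) (companion_T_left N) I hT.
  by move: h; rewrite /core_word /= /word_mx big_nil mul1mx.
case: kind hM hS => hM [hS ->].
  exact (frob_tracks k0 kn n1 eps0 (companion_S_ge1 M) (@companion_S_left R d k M)
    (companion_S_lower hM) hS).
pose g := flatten (nseq k [seq (i, swap2 R) | i <- iota 0 n.-1]).
have eg : core_word g = flatten (nseq k (downshift_word R n)).
  by rewrite /core_word /g map_flatten map_nseq downshift_core_word.
have hu : downshift R n \is unitarymx := downshift_unitary R n.
have wfg : wf_word n (core_word g).
  rewrite eg; elim: (k) => //= k' IH; apply/wf_cat; exact (conj (@downshift_word_wf R n) IH).
have eQ : word_mx n (core_word g) = downshift R n ^+ k.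
  rewrite eg; elim: (k) => [|k' IH] /=; first by rewrite /word_mx big_nil.
  by rewrite word_mx_cat IH word_mx_downshift exprS.
have pU m : downshift R n ^+ m \is unitarymx.
  elim: m => [|m IH]; first exact (@unitarymx1 R n).
  rewrite exprS; exact (mul_unitarymx hu IH).
have pA m : (downshift R n)^t* ^+ m = (downshift R n ^+ m)^t*.
  elim: m => [|m IH]; first by rewrite !expr0 [RHS]hadjmx1.
  by rewrite exprSr exprS IH [RHS]hadjM.
(* The Gaussian spikes belong to [Q^-k S], so the bounds come out in the norm of that matrix. *)
have nM0 : fnorm (M0 M) = fnorm (companion_S d M).
  by rewrite /M0 pA (fnormUM _ (unitarymx_adj (pU k))).
have h := @spike_tracks R _ _ _ (M0 M) g RC RB k0 kn n1 eps0.
have eM : downshift R n ^+ k *m M0 M = companion_S d M.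
  by rewrite /M0 pA mulmxA (mulUhadj (pU k)) mul1mx.
move: h; rewrite nM0 eQ eM eg; apply.
- exact: companion_S_ge1.
- exact: upshift_S_upper.
- exact: upshift_S_left.
- by rewrite -eg.
- exact: hS.
Qed.
End Companion.

(** * Undoing the preprocessing, and the final bounds *)

Lemma equiv_conj (R : rcfType) n (L Z U V S dS : 'M[R[i]]_n) :
  U \is unitarymx -> V \is unitarymx ->
  L^t* *m (U^t* *m S *m V + dS) *m Z
  = (U *m L)^t* *m (S + U *m dS *m V^t*) *m (V *m Z)
  /\ fnorm (U *m dS *m V^t*) = fnorm dS.
Proof.
move=> hU hV; split.
  have e : U^t* *m (S + U *m dS *m V^t*) *m V = U^t* *m S *m V + dS.
    rewrite mulmxDr mulmxDl !mulmxA (mulhadjU hU) mul1mx -(mulmxA dS) (mulhadjU hV).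
    by rewrite mulmx1.
  by rewrite hadjM -e !mulmxA.
by rewrite (fnormMU _ (unitarymx_adj hV)) (fnormUM _ hU).
Qed.

Theorem theorem15 (R : realType) :
  exists p0 : {poly {poly R}},
  forall (c : R) (q : {poly {poly R}}), 0 < c ->
  forall (kind : factorization) (d k : nat) (P M N : nat -> 'M[R[i]]_k)
    (A B : 'M[R[i]]_k),
    (1 < d)%N -> (0 < k)%N ->
    companion_splitting d P M N ->
    A \is unitarymx -> B \is unitarymx ->
    let M' := fun j : nat => A^t* *m M j *m B in
    let N' := fun j : nat => A^t* *m N j *m B in
    preprocessed kind d M' N' ->
    let S := companion_S d M in
    let T := companion_T d N in
    let p := c * (1 + eval2 q d k) * eval2 p0 d k in
    exists u0 K : R, 0 < u0 /\
  forall (u : R) (m : nat) (Sh Th : 'M[R[i]]_(d * k)),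
    0 < u -> u <= u0 -> m%:R <= eval2 q d k ->
    computed_schur (c * u) m kind k
      (companion_S d M') (companion_T d N') Sh Th ->
  exists U V dS dT : 'M[R[i]]_(d * k),
    [/\ [/\ U \is unitarymx, V \is unitarymx, upper_tri Sh & upper_tri Th],
        Sh = U^t* *m (S + dS) *m V,
        Th = U^t* *m (T + dT) *m V,
        fnorm dT <= p * fnorm T ^+ 2 * u + K * u ^+ 2 &
        fnorm dS <= p * fnorm S ^+ 2 * u + K * u ^+ 2].
Proof.
(* This is [18 d^3 k^4], that is [18 k n^3]: [17 k + 1 <= 18 k] from the product, [n^2] from taking
   [h] as [n] times the norm, and one more [n] from the budget [n + m <= n (1 + q)]. *)
exists (18%:R * 'X^3 * ('X^4)%:P) => c q c0 kind d k P M N A B d1 k0 _ hA hB M' N' hpre S T p.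
have ep0 : eval2 (18%:R * 'X^3 * ('X^4)%:P : {poly {poly R}}) d k = 18%:R * d%:R ^+ 3 * k%:R ^+ 4.
  by rewrite /eval2 !(hornerM, hornerXn, hornerC, hornerMn, hornerE).
set z := eval2 q d k in p *; set n := (d * k)%N.
have hU := equiv_left_unitary d hA; have hV := equiv_right_unitary d hA hB.
have eS : companion_S d M' = (equiv_left d A)^t* *m S *m equiv_right d A B := @companion_S_equiv R d k A B hA M.
have eT : companion_T d N' = (equiv_left d A)^t* *m T *m equiv_right d A B := @companion_T_equiv R d k A B hA N.
have nS : fnorm (companion_S d M') = fnorm S by rewrite eS (fnormMU _ hV) (fnormUM _ (unitarymx_adj hU)).
have nT : fnorm (companion_T d N') = fnorm T by rewrite eT (fnormMU _ hV) (fnormUM _ (unitarymx_adj hU)).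
have S1 : 1 <= fnorm S := companion_S_ge1 d1 k0 M.
have T1 : 1 <= fnorm T := companion_T_ge1 d1 k0 N.
have n1 : 1 <= n%:R :> R by rewrite ler1n ltnW // block_dim_gt1.
pose hS := n%:R * fnorm S; pose hT := n%:R * fnorm T.
have hS1 : 1 <= hS by apply: le_trans n1 _; rewrite ler_peMr // (le_trans ler01).
have hT1 : 1 <= hT by apply: le_trans n1 _; rewrite ler_peMr // (le_trans ler01).
have [K K0 main] := @run_backward R hS hT k hS1 hT1.
(* [a * u] is the error budget. [z] is known to be nonnegative only once some [m] satisfies
   [m%:R <= z], hence the absolute value. *)
pose a := c * (1 + `|z|) * n%:R.
have a0 : 0 < a by rewrite !mulr_gt0 // ?(lt_le_trans ltr01) // lerDl normr_ge0.
have hST : 0 < hS + hT by rewrite addr_gt0 // (lt_le_trans ltr01).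
have p1 : 0 < 2%:R * (hS + hT) * a by rewrite mulr_gt0 // mulr_gt0 // ltr0n.
(* The threshold amounts to [a * u * (hS + hT) <= 1/2], which covers the smallness condition for
   both matrices. *)
exists (2%:R * (hS + hT) * a)^-1, (K * a ^+ 2); split; first by rewrite invr_gt0.
move=> u m Sh Th u_gt0 hu hm hrun.
have z0 : 0 <= z by apply: le_trans hm.
have ea : a = c * (1 + z) * n%:R by rewrite /a ger0_norm.
have eps0 : 0 <= c * u by rewrite mulr_ge0 // ltW.
have hsum : a * u * (hS + hT) <= 2^-1.
  move: hu; rewrite -(ler_pM2l p1) mulfV ?gt_eqF // => hu.
  move: hu; move: (hS + hT) => y; clear; lra.
have au0 : 0 <= a * u by rewrite mulr_ge0 ?ltW.
have eSle : a * u * hS <= 2^-1.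
  by apply: le_trans hsum; rewrite ler_wpM2l // lerDl (le_trans ler01).
have eTle : a * u * hT <= 2^-1.
  by apply: le_trans hsum; rewrite ler_wpM2l // lerDr (le_trans ler01).
have budget : n%:R * (c * u) + m%:R * (c * u) <= a * u.
  have -> : a * u = (n%:R + z * n%:R) * (c * u) by rewrite ea; ring.
  rewrite -mulrDl ler_wpM2r // lerD2l; apply: le_trans hm _.
  by rewrite ler_peMr.
have init st : initial_state (c * u) kind k (companion_S d M') (companion_T d N') st ->
    tracks_from (c * u) hS k (companion_S d M') st.1 /\
    tracks_from (c * u) hT k (companion_T d N') st.2.
  by move=> h; have := initial_tracks_from d1 k0 eps0 hpre h; rewrite nS nT.
have [L [Z [dS [dT [[hL hZ uS uT] fS fT bS bT]]]]] :=
  main _ kind _ m _ _ _ _ (a * u) eps0 init budget eSle eTle hrun.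
have [gS eqS] := equiv_conj L Z S dS hU hV; have [gT eqT] := equiv_conj L Z T dT hU hV.
have bound x : 1 <= x -> (17 * k + 1)%N%:R * (n%:R * x) ^+ 2 * (a * u) + K * (a * u) ^+ 2
    <= p * x ^+ 2 * u + K * a ^+ 2 * u ^+ 2.
  move=> x1; have -> : K * (a * u) ^+ 2 = K * a ^+ 2 * u ^+ 2 by ring.
  rewrite lerD2r.
  have -> : p * x ^+ 2 * u = (18%:R * k%:R) * ((n%:R * x) ^+ 2 * (a * u)).
    by rewrite /p ep0 ea /n natrM; ring.
  rewrite -[X in X <= _]mulrA ler_wpM2r //.
    by rewrite mulr_ge0 // sqr_ge0.
  by rewrite -natrM ler_nat; move: k0; clear; lia.
(* The preprocessing matrices go into [U] and [V], and the errors are rotated back without change of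
   norm. *)
exists (equiv_left d A *m L), (equiv_right d A B *m Z),
  (equiv_left d A *m dS *m (equiv_right d A B)^t*), (equiv_left d A *m dT *m (equiv_right d A B)^t*).
split.
- split; [exact (mul_unitarymx hU hL)|exact (mul_unitarymx hV hZ)|exact uS|exact uT].
- by rewrite fS eS; exact gS.
- by rewrite fT eT; exact gT.
- rewrite eqT; exact (le_trans bT (bound _ T1)).
- rewrite eqS; exact (le_trans bS (bound _ S1)).
Qed.
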